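(* Let $\Omega\subset\mathbb{H}$ be a slice contractible circular domain and let $g\in\mathcal{R}(\Omega)$ be a never vanishing function such that $g_v$ is a zero divisor. Then there exists $f\in\mathcal{R}(\Omega)$ such that $\exp_*(f)=g$.
   Context: $\mathbb{H}$ is the algebra of quaternions; $q=q_0+q_v$ with $q_0$ real and $q_v$ purely imaginary, $q^c=q_0-q_v$, $\mathbb{S}=\{I\in\mathbb{H}: I^2=-1\}$, $\mathbb{C}_I=\mathbb{R}+\mathbb{R}I$, $\mathbb{C}_I^+=\{\alpha+I\beta:\beta\ge0\}$, $\mathbb{S}_q=\{q_0+\|q_v\|J: J\in\mathbb{S}\}$, $\Omega_I=\Omega\cap\mathbb{C}_I$, $\Omega_I^+=\Omega\cap\mathbb{C}_I^+$. A domain (nonempty connected open set) $\Omega\subset\mathbb{H}$ is circular if $\mathbb{S}_q\subset\Omega$ for all $q\in\Omega$; it is a slice domain if $\Omega\cap\mathbb{R}\neq\emptyset$ and a product domain if $\Omega\cap\mathbb{R}=\emptyset$. It is slice contractible if, for some (equivalently any) $I\in\mathbb{S}$, $\Omega_I$ is a simply connected domain when $\Omega$ is slice, respectively $\Omega_I^+$ is a simply connected domain when $\Omega$ is product. A function $f:\Omega\to\mathbb{H}$ is slice regular if $f(\alpha+I\beta)=F_0(\alpha+\sqrt{-1}\beta)+I F_1(\alpha+\sqrt{-1}\beta)$ for all $I\in\mathbb{S}$ and $\alpha,\beta\in\mathbb{R}$ with $\alpha+I\beta\in\Omega$, where $F_0,F_1:\{\alpha+\sqrt{-1}\beta:\alpha+I\beta\in\Omega\}\to\mathbb{H}$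 are $C^1$, $F_0(\bar z)=F_0(z)$, $F_1(\bar z)=-F_1(z)$ and $\partial_\alpha F_0=\partial_\beta F_1$, $\partial_\beta F_0=-\partial_\alpha F_1$. $\mathcal{R}(\Omega)$ is the set of slice regular functions; $f\in\mathcal{R}(\Omega)$ is slice preserving if $f(\Omega_I)\subset\mathbb{C}_I$ for all $I\in\mathbb{S}$, and $\mathcal{R}_{\mathbb{R}}(\Omega)$ is the set of slice preserving functions. The $*$-product is $(f*g)(q)=0$ if $f(q)=0$, and $(f*g)(q)=f(q)\,g(f(q)^{-1}qf(q))$ otherwise; with pointwise sum it makes $\mathcal{R}(\Omega)$ an associative algebra. The slice conjugate $f^c$ is the function induced by $(F_0^c,F_1^c)$ (pointwise conjugates), and $f^s=f*f^c$. A function $f\not\equiv0$ is a zero divisor (for $*$) if and only if $f^s\equiv0$. Every $f\in\mathcal{R}(\Omega)$ is uniquely $f=f_0+f_1i+f_2j+f_3k$ with $f_\ell\in\mathcal{R}_{\mathbb{R}}(\Omega)$; $f_0$ is its real part and $f_v=f-f_0$ its vector part. $\exp_*(f)=\sum_{n\ge0}f^{*n}/n!$, with $f^{*n}$ the $n$-th $*$-power. *)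

(* Defs.v *)
From HB Require Import structures.
From mathcomp Require Import all_boot all_order all_algebra.
From mathcomp Require Import all_classical all_reals all_analysis.
From mathcomp Require Import ring.

Set Implicit Arguments.
Unset Strict Implicit.
Unset Printing Implicit Defensive.

Import Order.TTheory GRing.Theory Num.Theory.
Import numFieldNormedType.Exports.

Local Open Scope classical_set_scope.
Local Open Scope ring_scope.

(* The norm inherited from row vectors is the max norm; it induces the usual
   topology of R^4. The Euclidean norm is only needed on vector parts, see
   [norm_vec]. *)
Definition quat (R : realType) : Type := 'rV[R]_4.

HB.instance Definition _ (R : realType) := NormedModule.copy (quat R) 'rV[R]_4.

Definition Quat (R : realType) (a b c d : R) : quat R :=
  \row_(l < 4) [:: a; b; c; d]`_l.

Section Algebra.
Variable R : realType.
Implicit Types p q r : quat R.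

Definition q_re q : R := q ord0 (inord 0).
Definition q_i q : R := q ord0 (inord 1).
Definition q_j q : R := q ord0 (inord 2).
Definition q_k q : R := q ord0 (inord 3).

Definition one_quat : quat R := Quat 1 0 0 0.

Definition mul_quat p q : quat R :=
  Quat (q_re p * q_re q - q_i p * q_i q - q_j p * q_j q - q_k p * q_k q)
       (q_re p * q_i q + q_i p * q_re q + q_j p * q_k q - q_k p * q_j q)
       (q_re p * q_j q - q_i p * q_k q + q_j p * q_re q + q_k p * q_i q)
       (q_re p * q_k q + q_i p * q_j q - q_j p * q_i q + q_k p * q_re q).

Lemma quat_eq p q : q_re p = q_re q -> q_i p = q_i q -> q_j p = q_j q ->
  q_k p = q_k q -> p = q.
Proof.
move=> e0 e1 e2 e3; apply/rowP => l; rewrite -(inord_val l).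
by case: l => -[|[|[|[|//]]]].
Qed.

Lemma q_reD p q : q_re (p + q) = q_re p + q_re q.
Proof. by rewrite /q_re mxE. Qed.
Lemma q_iD p q : q_i (p + q) = q_i p + q_i q.
Proof. by rewrite /q_i mxE. Qed.
Lemma q_jD p q : q_j (p + q) = q_j p + q_j q.
Proof. by rewrite /q_j mxE. Qed.
Lemma q_kD p q : q_k (p + q) = q_k p + q_k q.
Proof. by rewrite /q_k mxE. Qed.
Lemma q_reN q : q_re (- q) = - q_re q.
Proof. by rewrite /q_re mxE. Qed.
Lemma q_iN q : q_i (- q) = - q_i q.
Proof. by rewrite /q_i mxE. Qed.
Lemma q_jN q : q_j (- q) = - q_j q.
Proof. by rewrite /q_j mxE. Qed.
Lemma q_kN q : q_k (- q) = - q_k q.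
Proof. by rewrite /q_k mxE. Qed.
Lemma q_reZ (a : R) q : q_re (a *: q) = a * q_re q.
Proof. by rewrite /q_re mxE. Qed.
Lemma q_iZ (a : R) q : q_i (a *: q) = a * q_i q.
Proof. by rewrite /q_i mxE. Qed.
Lemma q_jZ (a : R) q : q_j (a *: q) = a * q_j q.
Proof. by rewrite /q_j mxE. Qed.
Lemma q_kZ (a : R) q : q_k (a *: q) = a * q_k q.
Proof. by rewrite /q_k mxE. Qed.
Lemma q_re0 : q_re 0 = 0.
Proof. by rewrite /q_re mxE. Qed.
Lemma q_i0 : q_i 0 = 0.
Proof. by rewrite /q_i mxE. Qed.
Lemma q_j0 : q_j 0 = 0.
Proof. by rewrite /q_j mxE. Qed.
Lemma q_k0 : q_k 0 = 0.
Proof. by rewrite /q_k mxE. Qed.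
Lemma q_reE (a b c d : R) : q_re (Quat a b c d) = a.
Proof. by rewrite /q_re mxE inordK. Qed.
Lemma q_iE (a b c d : R) : q_i (Quat a b c d) = b.
Proof. by rewrite /q_i mxE inordK. Qed.
Lemma q_jE (a b c d : R) : q_j (Quat a b c d) = c.
Proof. by rewrite /q_j mxE inordK. Qed.
Lemma q_kE (a b c d : R) : q_k (Quat a b c d) = d.
Proof. by rewrite /q_k mxE inordK. Qed.

Definition quat_simp := (q_reD, q_iD, q_jD, q_kD, q_reN, q_iN, q_jN, q_kN,
  q_reZ, q_iZ, q_jZ, q_kZ, q_re0, q_i0, q_j0, q_k0, q_reE, q_iE, q_jE, q_kE).

Fact mul_quatA : associative mul_quat.
Proof.
move=> p q r; apply: quat_eq; rewrite /mul_quat !quat_simp; ring.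
Qed.

Fact mul_1quat : left_id one_quat mul_quat.
Proof.
move=> p; apply: quat_eq; rewrite /mul_quat /one_quat !quat_simp; ring.
Qed.

Fact mul_quat1 : right_id one_quat mul_quat.
Proof.
move=> p; apply: quat_eq; rewrite /mul_quat /one_quat !quat_simp; ring.
Qed.

Fact mul_quatDl : left_distributive mul_quat +%R.
Proof.
move=> p q r; apply: quat_eq; rewrite /mul_quat !quat_simp; ring.
Qed.

Fact mul_quatDr : right_distributive mul_quat +%R.
Proof.
move=> p q r; apply: quat_eq; rewrite /mul_quat !quat_simp; ring.
Qed.

Fact one_quat_neq0 : one_quat != 0.
Proof.
by apply/eqP => /(congr1 q_re); rewrite !quat_simp; apply/eqP; exact: oner_neq0.
Qed.

HB.instance Definition _ := GRing.Zmodule_isNzRing.Build (quat R)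
  mul_quatA mul_1quat mul_quat1 mul_quatDl mul_quatDr one_quat_neq0.

Lemma mul_quatE p q : p * q = mul_quat p q. Proof. by []. Qed.

Lemma q_reM p q : q_re (p * q) =
  q_re p * q_re q - q_i p * q_i q - q_j p * q_j q - q_k p * q_k q.
Proof. by rewrite mul_quatE q_reE. Qed.
Lemma q_iM p q : q_i (p * q) =
  q_re p * q_i q + q_i p * q_re q + q_j p * q_k q - q_k p * q_j q.
Proof. by rewrite mul_quatE q_iE. Qed.
Lemma q_jM p q : q_j (p * q) =
  q_re p * q_j q - q_i p * q_k q + q_j p * q_re q + q_k p * q_i q.
Proof. by rewrite mul_quatE q_jE. Qed.
Lemma q_kM p q : q_k (p * q) =
  q_re p * q_k q + q_i p * q_j q - q_j p * q_i q + q_k p * q_re q.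
Proof. by rewrite mul_quatE q_kE. Qed.
Lemma q_re1 : q_re 1 = 1. Proof. exact: q_reE. Qed.
Lemma q_i1 : q_i 1 = 0. Proof. exact: q_iE. Qed.
Lemma q_j1 : q_j 1 = 0. Proof. exact: q_jE. Qed.
Lemma q_k1 : q_k 1 = 0. Proof. exact: q_kE. Qed.

Definition quatE := (q_reM, q_iM, q_jM, q_kM, q_re1, q_i1, q_j1, q_k1,
  quat_simp).

Fact scale_quatAl (a : R) p q : a *: (p * q) = (a *: p) * q.
Proof.
apply: quat_eq; rewrite !quatE; ring.
Qed.

HB.instance Definition _ :=
  GRing.Lmodule_isLalgebra.Build R (quat R) scale_quatAl.

Fact scale_quatAr (a : R) p q : a *: (p * q) = p * (a *: q).
Proof.
apply: quat_eq; rewrite !quatE; ring.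
Qed.

HB.instance Definition _ :=
  GRing.Lalgebra_isAlgebra.Build R (quat R) scale_quatAr.

Definition conj_quat q : quat R := Quat (q_re q) (- q_i q) (- q_j q) (- q_k q).

Definition sqnorm_quat q : R :=
  q_re q ^+ 2 + q_i q ^+ 2 + q_j q ^+ 2 + q_k q ^+ 2.

Definition inv_quat q : quat R := (sqnorm_quat q)^-1 *: conj_quat q.

Lemma sqnorm_quat_eq0 q : (sqnorm_quat q == 0) = (q == 0).
Proof.
apply/eqP/eqP => [|->]; last by rewrite /sqnorm_quat !quat_simp !expr0n /= !addr0.
rewrite /sqnorm_quat => /eqP.
rewrite !paddr_eq0 ?addr_ge0 ?sqr_ge0// !sqrf_eq0.
by move=> /andP[/andP[/andP[/eqP? /eqP?] /eqP?] /eqP?]; apply: quat_eq;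
  rewrite quat_simp.
Qed.

Fact mul_Vquat : {in [pred q | q != 0], left_inverse 1 inv_quat *%R}.
Proof.
move=> q; rewrite inE -sqnorm_quat_eq0 => q0.
by apply: quat_eq; rewrite /inv_quat /conj_quat !quatE; move: q0; rewrite /sqnorm_quat => q0; field.
Qed.

Fact mul_quatV : {in [pred q | q != 0], right_inverse 1 inv_quat *%R}.
Proof.
move=> q; rewrite inE -sqnorm_quat_eq0 => q0.
by apply: quat_eq; rewrite /inv_quat /conj_quat !quatE; move: q0; rewrite /sqnorm_quat => q0; field.
Qed.

Fact unit_quatP p q : q * p = 1 /\ p * q = 1 -> p \in [pred q : quat R | q != 0].
Proof.
move=> [qp _]; rewrite inE; apply/eqP => p0; move: qp.
by rewrite p0 mulr0 => /eqP; rewrite eq_sym oner_eq0.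
Qed.

Fact inv_quat_out : {in [predC [pred q : quat R | q != 0]], inv_quat =1 id}.
Proof.
move=> q; rewrite !inE negbK => /eqP ->.
by apply: quat_eq; rewrite /inv_quat /conj_quat !quat_simp ?oppr0 mulr0.
Qed.

HB.instance Definition _ := GRing.NzRing_hasMulInverse.Build (quat R)
  mul_Vquat mul_quatV unit_quatP inv_quat_out.

Definition qI : quat R := Quat 0 1 0 0.
Definition qJ : quat R := Quat 0 0 1 0.
Definition qK : quat R := Quat 0 0 0 1.

Definition norm_vec q : R := Num.sqrt (q_i q ^+ 2 + q_j q ^+ 2 + q_k q ^+ 2).

Definition imag_unit : set (quat R) := [set I | I * I = -1].

Definition real_line : set (quat R) := [set q | exists a : R, q = a%:A].

Definition slice (I : quat R) : set (quat R) :=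
  [set q | exists a b : R, q = a%:A + b *: I].

Definition half_slice (I : quat R) : set (quat R) :=
  [set q | exists a b : R, 0 <= b /\ q = a%:A + b *: I].

Definition sphere_of q : set (quat R) :=
  [set (q_re q)%:A + norm_vec q *: J | J in imag_unit].

End Algebra.

Arguments qI {R}.
Arguments qJ {R}.
Arguments qK {R}.
Arguments imag_unit {R}.
Arguments real_line {R}.

Section SimplyConnected.
Variables (R : realType) (T : topologicalType).

Definition path_in (A : set T) (gamma : R -> T) :=
  {within `[0, 1], continuous gamma} /\
  (forall t, 0 <= t <= 1 -> A (gamma t)).

Definition simply_connected (A : set T) :=
  (forall x y, A x -> A y ->
     exists gamma, [/\ path_in A gamma, gamma 0 = x & gamma 1 = y]) /\
  (forall gamma, path_in A gamma -> gamma 0 = gamma 1 ->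
     exists H : R * R -> T,
       [/\ {within `[0, 1] `*` `[0, 1], continuous H},
           forall s t, 0 <= s <= 1 -> 0 <= t <= 1 -> A (H (s, t)),
           forall t, 0 <= t <= 1 -> H (0, t) = gamma t /\ H (1, t) = gamma 0 &
           forall s, 0 <= s <= 1 -> H (s, 0) = gamma 0 /\ H (s, 1) = gamma 0]).

End SimplyConnected.

Section SliceRegular.
Variable R : realType.
Notation H := (quat R).
Implicit Types (Omega : set H) (f g h : H -> H).

Definition domain Omega := [/\ Omega !=set0, connected Omega & open Omega].

Definition circular Omega := forall q, Omega q -> sphere_of q `<=` Omega.

Definition slice_domain Omega := domain Omega /\ Omega `&` real_line !=set0.

Definition product_domain Omega := domain Omega /\ Omega `&` real_line = set0.

Definition simply_connected_domain_in (I : H) (A : set H) :=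
  [/\ A !=set0, connected A, @open (subspace (slice I)) A &
      simply_connected R A].

Definition slice_contractible Omega := exists2 I, imag_unit I &
  (slice_domain Omega /\ simply_connected_domain_in I (Omega `&` slice I)) \/
  (product_domain Omega /\
     simply_connected_domain_in I (Omega `&` half_slice I)).

(* Complex numbers alpha + sqrt(-1) beta are represented by pairs. *)
Definition planar Omega : set (R * R) :=
  [set z | exists2 I, imag_unit I & Omega (z.1%:A + z.2 *: I)].

Definition C1_on (D : set (R * R)) (F : R * R -> H) :=
  forall v, v = (1, 0) \/ v = (0, 1) ->
  forall z, D z -> derivable F z v /\ {for z, continuous ('D_v F)}.

Definition slice_regular_stem (D : set (R * R)) (F0 F1 : R * R -> H) :=
  [/\ C1_on D F0 /\ C1_on D F1,
      forall z, D z -> F0 (z.1, - z.2) = F0 z,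
      forall z, D z -> F1 (z.1, - z.2) = - F1 z,
      forall z, D z -> 'D_(1, 0) F0 z = 'D_(0, 1) F1 z &
      forall z, D z -> 'D_(0, 1) F0 z = - 'D_(1, 0) F1 z].

(* Functions on Omega are represented by total functions, whose values outside
   Omega are irrelevant. *)
Definition slice_regular Omega f :=
  exists F0 F1 : R * R -> H, slice_regular_stem (planar Omega) F0 F1 /\
  forall I, imag_unit I -> forall a b : R, Omega (a%:A + b *: I) ->
    f (a%:A + b *: I) = F0 (a, b) + I * F1 (a, b).

Definition slice_preserving Omega f := slice_regular Omega f /\
  forall I, imag_unit I -> f @` (Omega `&` slice I) `<=` slice I.

Definition star f g : H -> H := fun q =>
  if f q == 0 then 0 else f q * g ((f q)^-1 * q * f q).

Definition vanishes_on Omega f := forall q, Omega q -> f q = 0.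

(* Two-sided reading: f is a left or a right zero divisor. *)
Definition zero_divisor Omega f :=
  [/\ slice_regular Omega f, ~ vanishes_on Omega f &
      exists h, [/\ slice_regular Omega h, ~ vanishes_on Omega h &
        vanishes_on Omega (star f h) \/ vanishes_on Omega (star h f)]].

Definition is_vector_part Omega f fv := exists f0 f1 f2 f3 : H -> H,
  [/\ [/\ slice_preserving Omega f0, slice_preserving Omega f1,
          slice_preserving Omega f2 & slice_preserving Omega f3],
      forall q, Omega q ->
        f q = f0 q + f1 q * qI + f2 q * qJ + f3 q * qK &
      forall q, Omega q -> fv q = f q - f0 q].

Definition star_pow f n : H -> H := iter n (star f) (fun=> 1).

Definition is_star_exp Omega f g := forall q, Omega q ->
  series (fun n => (n`!%:R^-1 : R) *: star_pow f n q) @ \oo --> g q.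

End SliceRegular.

(* Main.v *)
Require Import Defs.
From mathcomp Require Import all_boot all_order all_algebra.
From mathcomp Require Import all_classical all_reals all_analysis.
From mathcomp Require Import complex ring lra.

Set Implicit Arguments.
Unset Strict Implicit.
Unset Printing Implicit Defensive.

Import Order.TTheory GRing.Theory Num.Theory.
Import numFieldNormedType.Exports.

Local Open Scope classical_set_scope.
Local Open Scope ring_scope.

(** Write [g = g0 + gv].  A slice function is determined by its stem, a function
    of the complex variable [z = alpha + sqrt(-1) beta] with values in the
    quaternions with complex coefficients, and on stems the star product is the
    pointwise product ([star_stem]).  Let [c0, c1, c2, c3] be the holomorphic
    components of the stem of [g], and [V] the stem of [gv], with components
    [0, c1, c2, c3].

    If [gv] is a zero divisor, [V] is annihilated on the left or on the right by
    some holomorphic stem [B] that is not identically zero.  Multiplying once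
    more by [V] gives [s B = 0] with [s = c1 ^ 2 + c2 ^ 2 + c3 ^ 2].  So [s]
    vanishes near a point where [B] does not, hence everywhere by unique
    continuation ([zero_divisor_norm]); in other words [V ^ 2 = - s = 0].

    On a slice domain this cannot happen: the components are real at real points,
    so [s = 0] makes them vanish on a real segment, hence everywhere
    ([slice_domain_no_zero_divisor]).

    On a product domain, [c0] has no zeros: where [c0] vanishes, the value of
    [g] at a suitable point of the sphere is zero, because [V ^ 2 = 0] says that
    the real and imaginary parts of [V] are orthogonal vectors of equal length
    ([invertible_real_part]).  The part of the domain of the stems in the upper
    half plane is simply connected, so [c0 = exp L] there ([holomorphic_log]),
    and [L] extends to the lower half plane by conjugation ([conj_extension]).
    Let [f] be the function with stem [L + N], where [N = V / c0].  As [L] is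
    central and [N ^ 2 = 0], the [n]-th power of [L + N] is
    [L ^ n + n L ^ (n - 1) N] ([star_pow_stem]), and the exponential series sums
    to [exp L (1 + N) = c0 + V].

    Both analytic ingredients are proved for continuously differentiable
    solutions of the Cauchy-Riemann equations, without any contour integral.

    Unique continuation: such a function [f] has local primitives [F]
    ([local_primitive]), and these have second derivatives, so that the maximum
    principle for [F] follows from the second derivative test ([max_modulus]).
    Applied to [F / (z - c) ^ n] with [n] going to infinity, it shows that zeros
    of [F] on the inner part of the boundary of a region propagate to a whole
    disc ([zero_in_disc]).

    Logarithms: an argument of a function without zeros on a square is a sum of
    small arctangents ([square_arg_lift]); a homotopy contracting a loop then
    shows that the variation of the argument along the loop is zero
    ([variation_loop]), so that the variation along paths defines the argument
    ([exists_argument]), which is locally an arctangent and therefore as smooth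
    as the function ([local_argument]). *)

(** * Complex valued functions of two real variables *)

Section Holomorphic.
Variable R : realType.
Implicit Types (u : R * R -> R) (f g h : R * R -> complex R) (z v : R * R)
  (w : complex R) (D : set (R * R)).

Lemma is_derive_slice_x u z d :
  is_derive z (1, 0) u d <-> is_derive z.1 1 (fun x => u (x, z.2)) d.
Proof.
have e : (fun h : R => h^-1 *: ((u \o shift z) (h *: (1, 0)) - u z))
  = (fun h : R => h^-1 *: (((fun x => u (x, z.2)) \o shift z.1) (h *: 1) - u (z.1, z.2))).
  apply/funext => h /=; congr (_ *: (u _ - u _)); last by case: z.
  by rewrite /shift/= /GRing.scale/= /GRing.add /= /add_pair /= scaler0 add0r.
split=> -[].
  by rewrite /derivable /derive e => ? ?; split.
by rewrite /derivable /derive -e => ? ?; split.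
Qed.

Lemma is_derive_slice_y u z d :
  is_derive z (0, 1) u d <-> is_derive z.2 1 (fun y => u (z.1, y)) d.
Proof.
have e : (fun h : R => h^-1 *: ((u \o shift z) (h *: (0, 1)) - u z))
  = (fun h : R => h^-1 *: (((fun y => u (z.1, y)) \o shift z.2) (h *: 1) - u (z.1, z.2))).
  apply/funext => h /=; congr (_ *: (u _ - u _)); last by case: z.
  by rewrite /shift/= /GRing.scale/= /GRing.add /= /add_pair /= scaler0 add0r.
split=> -[].
  by rewrite /derivable /derive e => ? ?; split.
by rewrite /derivable /derive -e => ? ?; split.
Qed.

Definition cderive f z (v : R * R) w :=
  is_derive z v (fun t => complex.Re (f t)) (complex.Re w) /\
  is_derive z v (fun t => complex.Im (f t)) (complex.Im w).

(** The complex derivative is tested along the two coordinate axes only, on real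
    and imaginary parts: this is the form in which the partial derivatives of a
    stem function are given, and it contains the Cauchy-Riemann equations. *)
Definition cdiff f z w := cderive f z (1, 0) w /\ cderive f z (0, 1) ('i%C * w).

Definition ccont f z :=
  (complex.Re (f t) @[t --> z] --> complex.Re (f z)) /\
  (complex.Im (f t) @[t --> z] --> complex.Im (f z)).

Definition hol D f := exists f', forall z, D z -> cdiff f z (f' z) /\ ccont f' z.

Lemma cReM (a b : complex R) : complex.Re (a * b) =
  complex.Re a * complex.Re b - complex.Im a * complex.Im b.
Proof. by case: a b => [? ?] [? ?]. Qed.

Lemma cImM (a b : complex R) : complex.Im (a * b) =
  complex.Re a * complex.Im b + complex.Im a * complex.Re b.
Proof. by case: a b => [? ?] [? ?]. Qed.

Lemma cReD (a b : complex R) : complex.Re (a + b) = complex.Re a + complex.Re b.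
Proof. by case: a b => [? ?] [? ?]. Qed.
Lemma cImD (a b : complex R) : complex.Im (a + b) = complex.Im a + complex.Im b.
Proof. by case: a b => [? ?] [? ?]. Qed.
Lemma cReN (a : complex R) : complex.Re (- a) = - complex.Re a.
Proof. by case: a. Qed.
Lemma cImN (a : complex R) : complex.Im (- a) = - complex.Im a.
Proof. by case: a. Qed.

Lemma complexP (a b : complex R) : complex.Re a = complex.Re b ->
  complex.Im a = complex.Im b -> a = b.
Proof. by case: a b => [? ?] [? ?] /= -> ->. Qed.

Lemma cRe_conj (a : complex R) : complex.Re (conjc a) = complex.Re a.
Proof. by case: a. Qed.
Lemma cIm_conj (a : complex R) : complex.Im (conjc a) = - complex.Im a.
Proof. by case: a. Qed.

(** The squared modulus with real values; it is smooth and multiplicative, and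
    spares the square root of the modulus, which takes complex values here. *)
Definition nsq (a : complex R) : R := complex.Re a ^+ 2 + complex.Im a ^+ 2.

Lemma nsqM a b : nsq (a * b) = nsq a * nsq b.
Proof. rewrite /nsq cReM cImM; ring. Qed.

Lemma nsq_ge0 a : 0 <= nsq a.
Proof. by rewrite addr_ge0 ?sqr_ge0. Qed.

Lemma nsq_eq0 a : (nsq a == 0) = (a == 0).
Proof.
rewrite /nsq paddr_eq0 ?sqr_ge0// !sqrf_eq0; apply/andP/eqP => [[/eqP ? /eqP ?]|->//].
exact: complexP.
Qed.

Lemma nsq_gt0 a : (0 < nsq a) = (a != 0).
Proof. by rewrite lt_neqAle eq_sym nsq_ge0 andbT nsq_eq0. Qed.

Lemma cReV a : complex.Re (a^-1) = complex.Re a / nsq a.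
Proof. by case: a. Qed.
Lemma cImV a : complex.Im (a^-1) = - complex.Im a / nsq a.
Proof. by case: a => a b; rewrite /= mulNr. Qed.

(** The rules of differential calculus, for functions given by lambda terms
    instead of by operations on the ring of functions. *)
Lemma is_deriveD_fun u1 u2 z v d1 d2 : is_derive z v u1 d1 ->
  is_derive z v u2 d2 -> is_derive z v (fun t => u1 t + u2 t) (d1 + d2).
Proof. exact: is_deriveD. Qed.

Lemma is_deriveB_fun u1 u2 z v d1 d2 : is_derive z v u1 d1 ->
  is_derive z v u2 d2 -> is_derive z v (fun t => u1 t - u2 t) (d1 - d2).
Proof. exact: is_deriveB. Qed.

Lemma is_deriveN_fun u z v d : is_derive z v u d ->
  is_derive z v (fun t => - u t) (- d).
Proof. exact: is_deriveN. Qed.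

Lemma is_deriveM_fun u1 u2 z v d1 d2 : is_derive z v u1 d1 ->
  is_derive z v u2 d2 ->
  is_derive z v (fun t => u1 t * u2 t) (u1 z * d2 + u2 z * d1).
Proof. exact: is_deriveM. Qed.

Lemma is_deriveV_fun u z v d : u z != 0 -> is_derive z v u d ->
  is_derive z v (fun t => (u t)^-1) (- d / u z ^+ 2).
Proof.
move=> u0 [du <-]; split; first exact: derivableV.
rewrite [LHS](deriveV u0 du) /GRing.scale/=.
by field.
Qed.

Lemma cderiveD f g z v w w' : cderive f z v w -> cderive g z v w' ->
  cderive (fun t => f t + g t) z v (w + w').
Proof.
move=> [f1 f2] [g1 g2]; split.
  rewrite cReD; under eq_fun do rewrite cReD; exact: is_deriveD_fun.
rewrite cImD; under eq_fun do rewrite cImD; exact: is_deriveD_fun.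
Qed.

Lemma cderiveM f g z v w w' : cderive f z v w -> cderive g z v w' ->
  cderive (fun t => f t * g t) z v (f z * w' + w * g z).
Proof.
move=> [f1 f2] [g1 g2]; split.
  rewrite cReD !cReM; under eq_fun do rewrite cReM.
  apply: (is_derive_eq
    (is_deriveB_fun (is_deriveM_fun f1 g1) (is_deriveM_fun f2 g2))).
  by ring.
rewrite cImD !cImM; under eq_fun do rewrite cImM.
apply: (is_derive_eq
  (is_deriveD_fun (is_deriveM_fun f1 g2) (is_deriveM_fun f2 g1))).
by ring.
Qed.

Lemma is_derive_nsq f z v w : cderive f z v w ->
  is_derive z v (fun t => nsq (f t))
    (2 * (complex.Re (f z) * complex.Re w + complex.Im (f z) * complex.Im w)).
Proof.
move=> [f1 f2]; rewrite /nsq; under eq_fun do rewrite !expr2.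
apply: (is_derive_eq
  (is_deriveD_fun (is_deriveM_fun f1 f1) (is_deriveM_fun f2 f2))).
by ring.
Qed.

Lemma cderiveV f z v w : f z != 0 -> cderive f z v w ->
  cderive (fun t => (f t)^-1) z v (- w / f z ^+ 2).
Proof.
move=> f0 df; have [f1 f2] := df.
have n0 : nsq (f z) != 0 by rewrite nsq_eq0.
have dV := is_deriveV_fun n0 (is_derive_nsq df).
split.
  under eq_fun do rewrite cReV.
  apply: (is_derive_eq (is_deriveM_fun f1 dV)).
  rewrite -(exprVn (f z)) (expr2 (f z)^-1) !(cReM, cImM, cReN, cImN, cReV, cImV).
  by move: n0; rewrite /nsq => n0; field.
under eq_fun do rewrite cImV mulNr.
apply: (is_derive_eq (is_deriveN_fun (is_deriveM_fun f2 dV))).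
rewrite -(exprVn (f z)) (expr2 (f z)^-1) !(cReM, cImM, cReN, cImN, cReV, cImV).
by move: n0; rewrite /nsq => n0; field.
Qed.

Lemma cderive_cst w z v : cderive (fun=> w) z v 0.
Proof. by split; exact: is_derive_cst. Qed.

Lemma cdiffD f g z w w' : cdiff f z w -> cdiff g z w' ->
  cdiff (fun t => f t + g t) z (w + w').
Proof.
move=> [f1 f2] [g1 g2]; split; first exact: cderiveD.
by rewrite mulrDr; exact: cderiveD.
Qed.

Lemma cdiffM f g z w w' : cdiff f z w -> cdiff g z w' ->
  cdiff (fun t => f t * g t) z (f z * w' + w * g z).
Proof.
move=> [f1 f2] [g1 g2]; split; first exact: cderiveM.
rewrite mulrDr mulrCA (mulrA _ w); exact: cderiveM.
Qed.

Lemma cdiffV f z w : f z != 0 -> cdiff f z w ->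
  cdiff (fun t => (f t)^-1) z (- w / f z ^+ 2).
Proof.
move=> f0 [f1 f2]; split; first exact: cderiveV.
rewrite mulrA mulrN; exact: cderiveV.
Qed.

Lemma cdiff_cst w z : cdiff (fun=> w) z 0.
Proof. by split; rewrite ?mulr0; exact: cderive_cst. Qed.

Definition toC z : complex R := Complex z.1 z.2.

Lemma cdiff_id z : cdiff toC z 1.
Proof.
split; split; rewrite ?mulr1 /=.
- by apply/is_derive_slice_x; exact: is_derive_id.
- by apply/is_derive_slice_x; exact: is_derive_cst.
- by apply/is_derive_slice_y; exact: is_derive_cst.
- by apply/is_derive_slice_y; exact: is_derive_id.
Qed.

Lemma ccontD f g z : ccont f z -> ccont g z -> ccont (fun t => f t + g t) z.
Proof.
move=> [f1 f2] [g1 g2]; split.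
  by rewrite cReD; under eq_fun do rewrite cReD; exact: cvgD.
by rewrite cImD; under eq_fun do rewrite cImD; exact: cvgD.
Qed.

Lemma ccontM f g z : ccont f z -> ccont g z -> ccont (fun t => f t * g t) z.
Proof.
move=> [f1 f2] [g1 g2]; split.
  by rewrite cReM; under eq_fun do rewrite cReM; apply: cvgB; exact: cvgM.
by rewrite cImM; under eq_fun do rewrite cImM; apply: cvgD; exact: cvgM.
Qed.

Lemma ccontN f z : ccont f z -> ccont (fun t => - f t) z.
Proof.
move=> [f1 f2]; split.
  by rewrite cReN; under eq_fun do rewrite cReN; exact: cvgN.
by rewrite cImN; under eq_fun do rewrite cImN; exact: cvgN.
Qed.

Lemma cvg_nsq f z : ccont f z -> nsq (f t) @[t --> z] --> nsq (f z).
Proof.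
move=> [f1 f2]; rewrite /nsq !expr2; under eq_fun do rewrite !expr2.
by apply: cvgD; exact: cvgM.
Qed.

Lemma ccontV f z : f z != 0 -> ccont f z -> ccont (fun t => (f t)^-1) z.
Proof.
move=> f0 cf; have n0 : nsq (f z) != 0 by rewrite nsq_eq0.
have cn := cvg_nsq cf; case: cf => f1 f2; split.
  rewrite cReV; under eq_fun do rewrite cReV.
  by apply: cvgM => //; exact: cvgV.
rewrite cImV; under eq_fun do rewrite cImV.
by apply: cvgM; [exact: cvgN|exact: cvgV].
Qed.

Lemma ccont_cst w z : ccont (fun=> w) z.
Proof. by split; exact: cvg_cst. Qed.

Lemma nbhs_boxP z (A : set (R * R)) : nbhs z A <-> exists2 e : R, 0 < e &
  forall t, `|t.1 - z.1| < e -> `|t.2 - z.2| < e -> A t.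
Proof.
split.
  move=> /nbhs_ballP[e /= e0 eA]; exists e => // t t1 t2; apply: eA; split => /=;
  by rewrite -ball_normE /= distrC.
move=> [e e0 eA]; apply/nbhs_ballP; exists e => //= t [/=].
by rewrite -!ball_normE /= !(distrC _ t.1) !(distrC _ t.2); exact: eA.
Qed.

(** The hypothesis covers a symmetric interval around [a], so that [b] may lie on
    either side of [a]. *)
Lemma mean_value_bound (f df : R -> R) (a b C : R) :
  (forall x, `|x - a| <= `|b - a| -> is_derive x 1 f (df x) /\ `|df x| <= C) ->
  `|f b - f a| <= C * `|b - a|.
Proof.
move=> H.
have cf x : `|x - a| <= `|b - a| -> {for x, continuous f}.
  move=> /H[[dfx _] _].
  exact/differentiable_continuous/derivable1_diffP.
have [ab|ba] := leP a b.
  have d x : x \in `]a, b[%R -> is_derive x 1 f (df x).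
    rewrite in_itv/= => /andP[ax xb].
    by apply: (proj1 (H _ _)); rewrite !ger0_norm; lra.
  have c : {within `[a, b], continuous f}.
    apply: continuous_in_subspaceT => x; rewrite inE /= in_itv/= => /andP[ax xb].
    by apply: cf; rewrite !ger0_norm; lra.
  have [x] := MVT_segment ab d c.
  rewrite in_itv/= => /andP[ax xb] ->; rewrite normrM ler_wpM2r//.
  by apply: (proj2 (H _ _)); rewrite !ger0_norm; lra.
have d x : x \in `]b, a[%R -> is_derive x 1 f (df x).
  rewrite in_itv/= => /andP[ax xb].
  by apply: (proj1 (H _ _)); rewrite !ler0_norm; lra.
have c : {within `[b, a], continuous f}.
  apply: continuous_in_subspaceT => x; rewrite inE /= in_itv/= => /andP[ax xb].
  by apply: cf; rewrite !ler0_norm; lra.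
have [x] := MVT_segment (ltW ba) d c.
rewrite in_itv/= => /andP[ax xb] e; rewrite distrC e normrM (distrC b) ler_wpM2r//.
by apply: (proj2 (H _ _)); rewrite !ler0_norm; lra.
Qed.

(** Continuous partial derivatives bound the increments of the function, so
    they make it jointly continuous. *)
Lemma partials_cvg (u d1 d2 : R * R -> R) z :
  (\forall t \near z, is_derive (t : R * R) (1, 0) u (d1 t) /\
     is_derive (t : R * R) (0, 1) u (d2 t)) ->
  d1 t @[t --> z] --> d1 z -> d2 t @[t --> z] --> d2 z ->
  u t @[t --> z] --> u z.
Proof.
move=> du c1 c2.
have b1 : \forall t \near z, `|d1 t| <= `|d1 z| + 1.
  move/cvgrPdist_le : c1 => /(_ 1 ltr01); apply: filterS => t.
  by rewrite distrC => h; have := ler_normD (d1 z) (d1 t - d1 z); rewrite subrKC; lra.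
have b2 : \forall t \near z, `|d2 t| <= `|d2 z| + 1.
  move/cvgrPdist_le : c2 => /(_ 1 ltr01); apply: filterS => t.
  by rewrite distrC => h; have := ler_normD (d2 z) (d2 t - d2 z); rewrite subrKC; lra.
pose G (t : R * R) := [/\ is_derive t ((1, 0) : R * R) u (d1 t),
  is_derive t ((0, 1) : R * R) u (d2 t), `|d1 t| <= `|d1 z| + 1 & `|d2 t| <= `|d2 z| + 1].
have /nbhs_boxP[r r0 H] : nbhs z G.
  apply: filterS (filterI (filterI du b1) b2) => t [[[? ?] ?] ?]; by split.

set M := `|d1 z| + `|d2 z| + 1.
have M1 : `|d1 z| + 1 <= M by rewrite /M; have := normr_ge0 (d2 z); lra.
have M2 : `|d2 z| + 1 <= M by rewrite /M; have := normr_ge0 (d1 z); lra.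
have M0 : 0 < M by apply: lt_le_trans M1; rewrite ltr_wpDl.
clearbody M.
apply/cvgrPdist_le => e e0; apply/nbhs_boxP; exists (Num.min r (e / (M + M))) => [|t].
  by rewrite lt_min r0 /= divr_gt0 // addr_gt0.
rewrite /= !lt_min => /andP[t1 t1e] /andP[t2 t2e].
have h1 : `|u (t.1, z.2) - u (z.1, z.2)| <= M * `|t.1 - z.1|.
  apply: (@mean_value_bound (fun x => u (x, z.2)) (fun x => d1 (x, z.2))) => x xz.
  have [] := H (x, z.2); rewrite /= ?subrr ?normr0//; first lra.
  move=> /is_derive_slice_x ? _ ? _; split => //.
  by apply: le_trans M1.
have h2 : `|u (t.1, t.2) - u (t.1, z.2)| <= M * `|t.2 - z.2|.
  apply: (@mean_value_bound (fun y => u (t.1, y)) (fun y => d2 (t.1, y))) => y yz.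
  have [] := H (t.1, y); rewrite /= ?subrr ?normr0//; first lra.
  move=> _ /is_derive_slice_y ? _ ?; split => //.
  by apply: le_trans M2.
rewrite distrC; move: t1e t2e; rewrite !ltr_pdivlMr ?addr_gt0// => t1e t2e.
have := ler_normD (u (t.1, t.2) - u (t.1, z.2)) (u (t.1, z.2) - u (z.1, z.2)).
rewrite subrKA; move: h1 h2 t1e t2e; case: (t) (z) => [? ?] [? ?] /=; nra.
Unshelve. all: by end_near. Qed.

(** Only the derivative is assumed continuous in the definition of [hol];
    continuity of the function itself comes from [partials_cvg]. *)
Lemma hol_continuous D f : open D -> hol D f -> forall z, D z -> ccont f z.
Proof.
move=> oD [f' Hf] z Dz; have nD : nbhs z D by exact: open_nbhs_nbhs.
have [_ [c1 c2]] := Hf z Dz.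
split.
  apply: (@partials_cvg _ (fun t => complex.Re (f' t)) (fun t => - complex.Im (f' t))) => //;
    last exact: cvgN.
  apply: filterS nD => t /Hf[[[? _] [h _]] _]; split => //.
  by move: h; rewrite cReM /= mul0r mul1r sub0r.
apply: (@partials_cvg _ (fun t => complex.Im (f' t)) (fun t => complex.Re (f' t))) => //.
apply: filterS nD => t /Hf[[[_ ?] [_ h]] _]; split => //.
by move: h; rewrite cImM /= mul0r mul1r add0r.
Qed.

Lemma hol_cst D w : hol D (fun=> w).
Proof. by exists (fun=> 0) => z _; split; [exact: cdiff_cst|exact: ccont_cst]. Qed.

Lemma holD D f g : hol D f -> hol D g -> hol D (fun t => f t + g t).
Proof.
move=> [f' Hf] [g' Hg]; exists (fun t => f' t + g' t) => z Dz.
by have [? ?] := Hf z Dz; have [? ?] := Hg z Dz; split; [exact: cdiffD|exact: ccontD].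
Qed.

Lemma holM D f g : open D -> hol D f -> hol D g -> hol D (fun t => f t * g t).
Proof.
move=> oD hf hg; have cf := hol_continuous oD hf; have cg := hol_continuous oD hg.
move: hf hg => [f' Hf] [g' Hg].
exists (fun t => f t * g' t + f' t * g t) => z Dz.
have [? ?] := Hf z Dz; have [? ?] := Hg z Dz; split; first exact: cdiffM.
by apply: ccontD; apply: ccontM => //; [exact: cf|exact: cg].
Qed.

Lemma holV D f : open D -> (forall z, D z -> f z != 0) -> hol D f ->
  hol D (fun t => (f t)^-1).
Proof.
move=> oD f0 hf; have cf := hol_continuous oD hf; move: hf => [f' Hf].
exists (fun t => - f' t / f t ^+ 2) => z Dz.
have [? ?] := Hf z Dz; split; first exact: cdiffV (f0 z Dz) _.
apply: ccontM; first exact: ccontN.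
apply: ccontV; first by rewrite expf_neq0// f0.
by apply: ccontM; exact: cf.
Qed.

Lemma cdiff_uniq f z w w' : cdiff f z w -> cdiff f z w' -> w = w'.
Proof.
move=> [[[_ e1] [_ e2]] _] [[[_ e1'] [_ e2']] _].
by apply: complexP; [rewrite -e1 -e1'|rewrite -e2 -e2'].
Qed.

End Holomorphic.

(** * Local primitives *)

Section Primitive.
Variable R : realType.
Implicit Types (z v : R * R).

Lemma near_dist (x d : R) : 0 < d -> \forall t \near x, `|t - x| < d.
Proof.
by move=> d0; apply/nbhs_ballP; exists d => //= t; rewrite -ball_normE /= distrC.
Qed.

Lemma is_derive_eps (f : R -> R) (x d : R) :
  (forall e, 0 < e -> \forall t \near x,
     `|f t - f x - (t - x) * d| <= e * `|t - x|) -> is_derive x 1 f d.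
Proof.
move=> H; suff c : h^-1 *: (f (h *: 1 + x) - f x) @[h --> 0^'] --> d.
  by split; [apply/cvg_ex; exists d|exact/cvg_lim].
apply/cvgrPdist_le => e e0.
have /nbhs_ballP[r /= r0 Hr] := H e e0.
near=> h.
have h0 : h != 0 by near: h; exact: nbhs_dnbhs_neq.
have : `|f (h + x) - f x - (h + x - x) * d| <= e * `|h + x - x|.
  apply: Hr; rewrite -ball_normE /= opprD addrCA subrr addr0 normrN.
  by near: h; exact: dnbhs0_lt.
rewrite addrK => h1.
rewrite distrC /GRing.scale/= mulr1 -(@ler_pM2r _ `|h|) ?normr_gt0// -normrM.
by rewrite mulrBl mulrAC mulVf// mul1r (mulrC d).
Unshelve. all: by end_near. Qed.

Lemma continuous_antiderivative (phi : R -> R) (y0 r : R) : 0 < r ->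
  (forall y, `|y - y0| <= r -> {for y, continuous phi}) ->
  exists Phi : R -> R, Phi y0 = 0 /\
    forall y, `|y - y0| < r -> is_derive y 1 Phi (phi y).
Proof.
move=> r0 cphi.
pose I y := (\int[lebesgue_measure]_(t in `[y0 - r, y]) (phi t))%R.
have intphi : lebesgue_measure.-integrable `[y0 - r, y0 + r] (EFin \o phi).
  apply: continuous_compact_integrable; first exact: segment_compact.
  apply: continuous_in_subspaceT => y; rewrite inE/= in_itv/= => /andP[? ?].
  by apply: cphi; rewrite ler_norml; lra.
have dI y : `|y - y0| < r -> is_derive y 1 I (phi y).
  rewrite ltr_norml => /andP[y1 y2].
  have ly : y < y0 + r by lra.
  have gy : y0 - r < y by lra.
  have cy : {for y, continuous phi} by apply: cphi; rewrite ler_norml; lra.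
  have [? e] := continuous_FTC1_closed ly intphi gy cy.
  by split => //; rewrite -derive1E.
exists (fun y => I y - I y0); split; first by rewrite subrr.
move=> y /dI h; rewrite -[phi y]subr0.
by apply: is_deriveB.
Qed.

(** Differentiation under the integral sign, for antiderivatives [B] of [phi] in
    the vertical direction, when the horizontal derivative [chi] of [phi] is also
    the vertical derivative of some [psi].  Subtracting from the increment of [B]
    its expected linear part leaves a function of the height whose derivative is
    small, uniformly in the height because [chi] is uniformly continuous on a
    vertical segment; the mean value bound concludes. *)
Lemma derive_antiderivative (phi psi chi B : R * R -> R) z0 (r : R) z :
  (forall z, `|z.1 - z0.1| < r -> `|z.2 - z0.2| < r ->
     [/\ is_derive z (1, 0) phi (chi z), is_derive z (0, 1) psi (chi z),
         chi t @[t --> z] --> chi z,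
         B (z.1, z0.2) = 0 & is_derive z (0, 1) B (phi z)]) ->
  `|z.1 - z0.1| < r -> `|z.2 - z0.2| < r ->
  is_derive z (1, 0) B (psi z - psi (z.1, z0.2)).
Proof.
move=> H; case: z => x y /= xr yr; apply/is_derive_slice_x => /=.
apply: is_derive_eps => e e0.
(* The bound for the vertical derivative of the error is integrated over a
   length of [`|y - z0.2|], which may be 0. *)
pose e1 := e / (`|y - z0.2| + 1).
have e10 : 0 < e1 by rewrite divr_gt0 // ltr_wpDl.
have chi_unif : \forall t \near x, `[z0.2 - `|y - z0.2|, z0.2 + `|y - z0.2|] `<=`
    [set s | `|chi (t, s) - chi (x, s)| <= e1].
  have /compact_near_coveringP nc := @segment_compact R (z0.2 - `|y - z0.2|) (z0.2 + `|y - z0.2|).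
  apply: (nc R (nbhs x) (fun t s => `|chi (t, s) - chi (x, s)| <= e1)) => s.
  rewrite /= in_itv/= => /andP[s1 s2].
  have sr : `|s - z0.2| < r by apply: le_lt_trans yr; rewrite ler_norml; lra.
  have [_ _ c _ _] := H (x, s) xr sr.
  have /nbhs_boxP[d d0 Hd] : nbhs (x, s) [set t : R * R | `|chi t - chi (x, s)| <= e1 / 2].
    have e12 : 0 < e1 / 2 by rewrite divr_gt0.
    move/cvgrPdist_le : c => /(_ _ e12); apply: filterS => t.
    by rewrite distrC.
  exists (ball s d, ball x d) => /=.
    by split; exact: nbhsx_ballx.
  move=> [s' t] [/= bs bt].
  rewrite -!ball_normE /= in bs bt; rewrite distrC in bs; rewrite distrC in bt.
  have /= h1 := Hd (t, s') bt bs.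
  have := Hd (x, s'); rewrite /= subrr normr0 => /(_ d0 bs) /= h2.
  have := ler_normB (chi (t, s') - chi (x, s)) (chi (x, s') - chi (x, s)).
  by rewrite opprB addrA subrK; lra.
have rx : 0 < r - `|x - z0.1| by rewrite subr_gt0.
have nA : nbhs x ((fun t => `[z0.2 - `|y - z0.2|, z0.2 + `|y - z0.2|] `<=`
    [set s | `|chi (t, s) - chi (x, s)| <= e1]) `&` ball x (r - `|x - z0.1|)).
  by apply: filterI => //; exact: nbhsx_ballx.
have /nbhs_ballP[d /= d0 Hd] := nA.
apply/nbhs_ballP; exists d => //= x1 bx1.
have Hx t : `|t - x| <= `|x1 - x| -> `|t - z0.1| < r /\
    forall s, `|s - z0.2| <= `|y - z0.2| -> `|chi (t, s) - chi (x, s)| <= e1.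
  move=> tx; have /Hd[h1 h2] : ball x d t.
    rewrite -ball_normE /= distrC; apply: le_lt_trans tx _.
    by rewrite distrC; move: bx1; rewrite -ball_normE.
  split.
    move: h2; rewrite -ball_normE /= distrC => h2.
    by have := ler_normD (t - x) (x - z0.1); rewrite subrKA; lra.
  move=> s; rewrite ler_norml => /andP[s1 s2]; apply: h1.
  by rewrite /= in_itv/=; apply/andP; lra.
have phi_incr s : `|s - z0.2| <= `|y - z0.2| ->
    `|phi (x1, s) - phi (x, s) - (x1 - x) * chi (x, s)| <= e1 * `|x1 - x|.
  move=> sy; have sr : `|s - z0.2| < r by lra.
  have -> : phi (x1, s) - phi (x, s) - (x1 - x) * chi (x, s) =
    (phi (x1, s) - x1 * chi (x, s)) - (phi (x, s) - x * chi (x, s)) by ring.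
  apply: (@mean_value_bound _ (fun t => phi (t, s) - t * chi (x, s))
    (fun t => chi (t, s) - chi (x, s))) => t /Hx[tr /(_ s sy) ->]; split => //.
  have [/is_derive_slice_x /= dphi _ _ _ _] := H (t, s) tr sr.
  apply: is_deriveB.
  apply: (is_derive_eq (is_deriveM (is_derive_id t 1) (is_derive_cst (chi (x, s)) t 1))).
  by rewrite /GRing.scale/= mulr0 mulr1 add0r.
have x1r : `|x1 - z0.1| < r by apply: (proj1 (Hx _ _)).
pose E s := (B (x1, s) - B (x, s)) - (x1 - x) * (psi (x, s) - psi (x, z0.2)).
have E0 : E z0.2 = 0.
  have z00 : `|z0.2 - z0.2| < r by rewrite subrr normr0; apply: le_lt_trans yr.
  have [_ _ _ b1 _] := H (x1, z0.2) x1r z00.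
  have [_ _ _ b2 _] := H (x, z0.2) xr z00.
  by rewrite /E b1 b2 !subrr mulr0 subrr.
have : `|E y - E z0.2| <= (e1 * `|x1 - x|) * `|y - z0.2|.
  apply: (@mean_value_bound _ E
    (fun s => phi (x1, s) - phi (x, s) - (x1 - x) * chi (x, s))) => s sy.
  split; last exact: phi_incr.
  have sr : `|s - z0.2| < r by lra.
  have [_ _ _ _ /is_derive_slice_y b1] := H (x1, s) x1r sr.
  have [_ /is_derive_slice_y p1 _ _ /is_derive_slice_y b2] := H (x, s) xr sr.
  apply: is_deriveB.
  apply: (is_derive_eq (is_deriveM (is_derive_cst (x1 - x) s 1)
     (is_deriveB p1 (is_derive_cst (psi (x, z0.2)) s 1)))).
  by rewrite /GRing.scale/= mulr0 subr0 addr0.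
rewrite E0 subr0 => /le_trans; apply.
rewrite mulrAC ler_wpM2r// /e1 mulrAC ler_pdivrMr ?ltr_wpDl//.
by rewrite ler_wpM2l ?(ltW e0)// lerDl.
Qed.

Definition box z0 (r : R) : set (R * R) :=
  [set z | `|z.1 - z0.1| < r /\ `|z.2 - z0.2| < r].

Lemma open_box z0 (r : R) : open (box z0 r).
Proof.
have [r0|r0] := leP r 0.
  suff -> : box z0 r = set0 by exact: open0.
  by apply/seteqP; split => // z [/lt_le_trans/(_ r0)]; rewrite normr_lt0.
suff -> : box z0 r = ball z0 r by exact: ball_open.
apply/seteqP; split => z; rewrite /ball /= /prod_ball -!ball_normE /=.
  by rewrite !(distrC z0.1) !(distrC z0.2).
by rewrite !(distrC z0.1) !(distrC z0.2).
Qed.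

(** A primitive of a holomorphic function is obtained by integrating first along
    the horizontal line through the centre and then vertically; by the
    Cauchy-Riemann equations its horizontal derivative is that function too. *)
Lemma local_primitive (f : R * R -> complex R) z0 (r : R) : 0 < r ->
  hol (box z0 r) f ->
  exists F : R * R -> complex R, F z0 = 0 /\
    forall z, `|z.1 - z0.1| < r / 2 -> `|z.2 - z0.2| < r / 2 -> cdiff F z (f z).
Proof.
move=> r0 hf; set D := box z0 r in hf.
have oD : open D by exact: open_box.
have cf := hol_continuous oD hf; case: hf => f' Hf.
have r20 : 0 < r / 2 by rewrite divr_gt0.
have rr x : `|x| <= r / 2 -> `|x| < r by lra.
have z0D : `|z0.1 - z0.1| < r /\ `|z0.2 - z0.2| < r by rewrite !subrr normr0.
have cx (u : R * R -> R) z : u t @[t --> z] --> u z ->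
    {for z.1, continuous (fun x => u (x, z.2))}.
  case: z => x y cu; apply/cvgrPdist_le => /= e e0.
  move/cvgrPdist_le : cu => /(_ e e0)/nbhs_boxP[d d0 Hd].
  apply: filterS (near_dist _ d0) => t xt.
  by apply: Hd => //=; rewrite subrr normr0.
have cy (u : R * R -> R) z : u t @[t --> z] --> u z ->
    {for z.2, continuous (fun y => u (z.1, y))}.
  case: z => x y cu; apply/cvgrPdist_le => /= e e0.
  move/cvgrPdist_le : cu => /(_ e e0)/nbhs_boxP[d d0 Hd].
  apply: filterS (near_dist _ d0) => t xt.
  by apply: Hd => //=; rewrite subrr normr0.
have antix (u : R * R -> R) : (forall z, D z -> u t @[t --> z] --> u z) ->
    exists A, A z0.1 = 0 /\ forall x, `|x - z0.1| < r / 2 ->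
      is_derive x 1 A (u (x, z0.2)).
  move=> cu; apply: continuous_antiderivative => // x /rr xr.
  by apply: (cx u (x, z0.2)); apply: cu; split => //; case: z0D.
have antiy (u : R * R -> R) : (forall z, D z -> u t @[t --> z] --> u z) ->
    exists B, forall z, `|z.1 - z0.1| < r / 2 -> `|z.2 - z0.2| < r / 2 ->
      B (z.1, z0.2) = 0 /\ is_derive z (0, 1) B (u z).
  move=> cu.
  have /choice[B HB] : forall x, exists A, `|x - z0.1| < r / 2 ->
      A z0.2 = 0 /\ forall y, `|y - z0.2| < r / 2 -> is_derive y 1 A (u (x, y)).
    move=> x; have [xr|xr] := boolP (`|x - z0.1| < r / 2); last by exists id.
    have [A HA] : exists A, A z0.2 = 0 /\ forall y, `|y - z0.2| < r / 2 ->
        is_derive y 1 A (u (x, y)).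
      apply: (@continuous_antiderivative (fun y => u (x, y))) => // y /rr yr.
      by apply: (cy u (x, y)); apply: cu; split => //; apply: rr; exact: ltW.
    by exists A.
  exists (fun z => B z.1 z.2) => -[x y] /= xr yr.
  have [Bz0 HBx] := HB x xr; split => //.
  by apply/is_derive_slice_y; exact: HBx.
have [A1 [A10 HA1]] := antix _ (fun z Dz => proj1 (cf z Dz)).
have [A2 [A20 HA2]] := antix _ (fun z Dz => proj2 (cf z Dz)).
have [B1 HB1] := antiy _ (fun z Dz => proj1 (cf z Dz)).
have [B2 HB2] := antiy _ (fun z Dz => proj2 (cf z Dz)).
have z00 : `|z0.1 - z0.1| < r / 2 /\ `|z0.2 - z0.2| < r / 2 by rewrite !subrr normr0.
exists (fun z => Complex (A1 z.1 - B2 z) (A2 z.1 + B1 z)); split.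
  have [b1 _] := HB1 z0 (proj1 z00) (proj2 z00).
  have [b2 _] := HB2 z0 (proj1 z00) (proj2 z00).
  rewrite -surjective_pairing in b1; rewrite -surjective_pairing in b2.
  by rewrite A10 A20 b1 b2 subr0 addr0.
move=> z z1 z2.
have inD t : `|t.1 - z0.1| < r / 2 -> `|t.2 - z0.2| < r / 2 -> D t.
  by move=> t1 t2; split; apply: rr; exact: ltW.
have [B10 B1y] := HB1 z z1 z2; have [B20 B2y] := HB2 z z1 z2.
have B1x : is_derive z (1, 0) B1 (complex.Im (f z) - complex.Im (f (z.1, z0.2))).
  apply: (@derive_antiderivative (fun z => complex.Re (f z))
    (fun z => complex.Im (f z)) (fun z => complex.Re (f' z)) B1 z0 (r / 2)) => // t t1 t2.
  have [[[d1 d2] [d3 d4]] [c1 c2]] := Hf t (inD t t1 t2).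
  have [b1 b2] := HB1 t t1 t2; split => //.
  by move: d4; rewrite cImM /= mul0r mul1r add0r.
have B2x : is_derive z (1, 0) B2 (- complex.Re (f z) - - complex.Re (f (z.1, z0.2))).
  apply: (@derive_antiderivative (fun z => complex.Im (f z)) (fun z => - complex.Re (f z))
    (fun z => complex.Im (f' z)) B2 z0 (r / 2)) => // t t1 t2.
  have [[[d1 d2] [d3 d4]] [c1 c2]] := Hf t (inD t t1 t2).
  have [b1 b2] := HB2 t t1 t2; split => //.
  move: d3; rewrite cReM /= mul0r mul1r sub0r => d3.
  by rewrite -[complex.Im (f' t)]opprK; exact: is_deriveN_fun.
have A1x : is_derive z (1, 0) (fun t => A1 t.1) (complex.Re (f (z.1, z0.2))).
  by apply/is_derive_slice_x; exact: HA1.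
have A2x : is_derive z (1, 0) (fun t => A2 t.1) (complex.Im (f (z.1, z0.2))).
  by apply/is_derive_slice_x; exact: HA2.
have A1y : is_derive z (0, 1) (fun t => A1 t.1) 0.
  by apply/is_derive_slice_y => /=; exact: is_derive_cst.
have A2y : is_derive z (0, 1) (fun t => A2 t.1) 0.
  by apply/is_derive_slice_y => /=; exact: is_derive_cst.
split; split => /=.
- by apply: (is_derive_eq (is_deriveB_fun A1x B2x)); ring.
- by apply: (is_derive_eq (is_deriveD_fun A2x B1x)); ring.
- by apply: (is_derive_eq (is_deriveB_fun A1y B2y)); rewrite cReM /=; ring.
- by apply: (is_derive_eq (is_deriveD_fun A2y B1y)); rewrite cImM /=; ring.
Qed.

End Primitive.

(** * The maximum principle *)

Section SecondDerivativeTest.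
Variable R : realType.
Implicit Types (z v : R * R) (D K : set (R * R)) (f g F G : R * R -> complex R).

(** At a maximum [f1 x = 0]; if [d2] were positive then [f1] would be positive just
    to the right of [x], and [f] would increase there. *)
Lemma second_derivative_max (f f1 : R -> R) (x d2 : R) :
  (\forall t \near x, is_derive (t : R) 1 f (f1 t)) -> is_derive x 1 f1 d2 ->
  (\forall t \near x, f t <= f x) -> d2 <= 0.
Proof.
move=> df df1 fmax; rewrite leNgt; apply/negP => d20.
have f1x : f1 x = 0.
  have /nbhs_ballP[r /= r0 Hr] : nbhs x ((fun t : R => is_derive t 1 f (f1 t)) `&`
    (fun t => f t <= f x)) by exact: filterI.
  have inb t : t \in `]x - r, x + r[ -> ball x r t.
    by rewrite in_itv/= -ball_normE /= ltr_norml => /andP[? ?]; lra.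
  have xx : x \in `]x - r, x + r[ by rewrite in_itv/=; lra.
  have /(@derive_val _ _ _ _ _ _ _) <- : is_derive x 1 f 0.
    apply: (@derive1_at_max _ f (x - r) (x + r)) => //; first lra.
      by move=> t /inb/Hr[[]].
    by move=> t /inb/Hr[].
  by have [[_ <-] _] := Hr x (inb x xx).
have pos : \forall h \near 0^', 0 < h^-1 *: (f1 (h *: 1 + x) - f1 x).
  have [/cvg_ex[l cl] dl] := df1.
  have el : l = d2 by rewrite -dl; apply/esym/cvg_lim.
  move/cvgrPdist_lt : cl => /(_ d2 d20); apply: filterS => h.
  rewrite el ltr_norml => /andP[_]; rewrite -[X in _ < X -> _]add0r ltrBlDr.
  by rewrite addrC; lra.
have [r r0 Hr] : exists2 r : R, 0 < r & forall t, x < t < x + r ->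
    [/\ is_derive t 1 f (f1 t), f t <= f x & 0 < f1 t].
  have /nbhs_ballP[r /= r0 Hr] : nbhs x ((fun t : R => is_derive t 1 f (f1 t)) `&`
    (fun t => f t <= f x)) by exact: filterI.
  have /nbhs_ballP[s /= s0 Hs] := pos.
  exists (Num.min r s); first by rewrite lt_min r0.
  move=> t /andP[xt]; rewrite -ltrBlDl lt_min => /andP[tr ts].
  have tx0 : 0 < t - x by rewrite subr_gt0.
  have [] := Hr t; first by rewrite -ball_normE /= distrC gtr0_norm.
  move=> ? ?; split => //.
  have := Hs (t - x); rewrite /= -ball_normE /= sub0r normrN gtr0_norm//.
  move=> /(_ ts); rewrite gt_eqF// => /(_ isT).
  by rewrite f1x subr0 /GRing.scale/= mulr1 subrK pmulr_rgt0// invr_gt0.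
have xr : x < x + r / 2 by rewrite ltrDl divr_gt0.
have fx : is_derive x 1 f (f1 x) by exact: (nbhs_singleton df).
have r2 : r / 2 < r by lra.
have Hr2 t : x < t -> t <= x + r / 2 -> [/\ is_derive t 1 f (f1 t), f t <= f x & 0 < f1 t].
  by move=> xt tr; apply: Hr; rewrite xt /=; lra.
have d t : t \in `]x, x + r / 2[ -> is_derive t 1 f (f1 t).
  by rewrite in_itv/= => /andP[xt /ltW tr]; case: (Hr2 t xt tr).
have c : {within `[x, x + r / 2], continuous f}.
  apply: continuous_in_subspaceT => t; rewrite inE/= in_itv/= => /andP[xt tr].
  apply/differentiable_continuous/derivable1_diffP.
  have [<-|tx] := eqVneq x t; first by case: fx.
  have xt' : x < t by rewrite lt_neqAle tx.
  by have [[]] := Hr2 t xt' tr.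
have [t] := MVT xr d c.
rewrite in_itv/= => /andP[xt /ltW tr] e.
have [_ _ f1t] := Hr2 t xt tr.
have [_ m _] := Hr2 (x + r / 2) xr (lexx _).
have : 0 < f1 t * (x + r / 2 - x) by rewrite mulr_gt0 ?subr_gt0.
lra.
Qed.

(** At a maximum both second derivatives of [U + e (x ^ 2 + y ^ 2)] are at most 0,
    whereas their sum is [a + b + 4 e = 4 e]. *)
Lemma laplacian_max (U Ux Uy : R * R -> R) z (a b e : R) :
  (\forall t \near z, is_derive (t : R * R) (1, 0) U (Ux t) /\
     is_derive (t : R * R) (0, 1) U (Uy t)) ->
  is_derive z (1, 0) Ux a -> is_derive z (0, 1) Uy b -> a + b = 0 -> 0 < e ->
  ~ \forall t \near z, U t + e * nsq (toC t) <= U z + e * nsq (toC z).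
Proof.
move=> dU da db ab e0 mx.
case: z dU da db mx => x y dU /is_derive_slice_x/= da /is_derive_slice_y/= db mx.
move/nbhs_boxP : dU => [r r0 Hr]; move/nbhs_boxP : mx => [s s0 Hs].
have a0 : a + 2 * e <= 0.
  apply: (@second_derivative_max (fun t => U (t, y) + e * (t ^+ 2 + y ^+ 2))
    (fun t => Ux (t, y) + e * (2 * t)) x).
  - apply: filterS (near_dist x r0) => t tx.
    have [/is_derive_slice_x/= d _] := Hr (t, y) tx ltac:(by rewrite subrr normr0).
    apply: is_deriveD.
    have dt : is_derive t 1 (fun t : R => t ^+ 2 + y ^+ 2) (2 * t).
      apply: (is_derive_eq (is_deriveD (is_deriveX 2 (is_derive_id t 1)) (is_derive_cst (y ^+ 2) t 1))).
      by rewrite /GRing.scale/= expr1; ring.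
    exact: (is_deriveZ e dt).
  - apply: (is_derive_eq (is_deriveD da (is_deriveZ e (is_deriveZ 2 (is_derive_id x 1))))).
    by rewrite /GRing.scale/=; ring.
  - apply: filterS (near_dist x s0) => t tx.
    exact: (Hs (t, y) tx ltac:(by rewrite subrr normr0)).
have b0 : b + 2 * e <= 0.
  apply: (@second_derivative_max (fun t => U (x, t) + e * (x ^+ 2 + t ^+ 2))
    (fun t => Uy (x, t) + e * (2 * t)) y).
  - apply: filterS (near_dist y r0) => t ty.
    have [_ /is_derive_slice_y/= d] := Hr (x, t) ltac:(by rewrite subrr normr0) ty.
    apply: is_deriveD.
    have dt : is_derive t 1 (fun t : R => x ^+ 2 + t ^+ 2) (2 * t).
      apply: (is_derive_eq (is_deriveD (is_derive_cst (x ^+ 2) t 1) (is_deriveX 2 (is_derive_id t 1)))).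
      by rewrite /GRing.scale/= expr1; ring.
    exact: (is_deriveZ e dt).
  - apply: (is_derive_eq (is_deriveD db (is_deriveZ e (is_deriveZ 2 (is_derive_id y 1))))).
    by rewrite /GRing.scale/=; ring.
  - apply: filterS (near_dist y s0) => t ty.
    exact: (Hs (x, t) ltac:(by rewrite subrr normr0) ty).
lra.
Qed.

End SecondDerivativeTest.

Section MaximumPrinciple.
Variable R : realType.
Implicit Types (z v : R * R) (D K : set (R * R)) (f g F G : R * R -> complex R).

(** Holomorphic with a holomorphic derivative, so that the real part has second
    derivatives and the second derivative test applies to it. *)
Definition hol2 D f := exists f1, (forall z, D z -> cdiff f z (f1 z)) /\ hol D f1.

Lemma hol2_hol D f : open D -> hol2 D f -> hol D f.
Proof.
move=> oD [f1 [df hf1]]; exists f1 => z Dz; split; first exact: df.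
exact: hol_continuous Dz.
Qed.

Lemma hol2M D f g : open D -> hol2 D f -> hol2 D g -> hol2 D (fun t => f t * g t).
Proof.
move=> oD hf hg; have hf0 := hol2_hol oD hf; have hg0 := hol2_hol oD hg.
case: hf hg => [f1 [df hf1]] [g1 [dg hg1]].
exists (fun z => f z * g1 z + f1 z * g z); split.
  by move=> z Dz; apply: cdiffM; [exact: df|exact: dg].
by apply: holD; apply: holM.
Qed.

Lemma hol2_inv_dist D (c : complex R) : open D -> (forall z, D z -> toC z != c) ->
  hol2 D (fun t => (toC t - c)^-1).
Proof.
move=> oD Dc.
have Dc0 z : D z -> toC z - c != 0 by move=> /Dc; rewrite subr_eq0.
have dB z : cdiff (fun t => toC t - c) z 1.
  by rewrite -[1]addr0; apply: cdiffD; [exact: cdiff_id|exact: cdiff_cst].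
have hB : hol D (fun t => toC t - c).
  by exists (fun=> 1) => z _; split; [exact: dB|exact: ccont_cst].
exists (fun z => - 1 / (toC z - c) ^+ 2); split.
  by move=> z Dz; exact: cdiffV (Dc0 z Dz) (dB z).
apply: holM => //; first exact: hol_cst.
apply: holV => //; first by move=> z /Dc0 ?; rewrite expf_neq0.
exact: holM.
Qed.

Lemma cvg_toC z : nsq (toC t) @[t --> z] --> nsq (toC z).
Proof. by apply: cvg_nsq; split; [exact: cvg_fst|exact: cvg_snd]. Qed.

(** The real part [U] of [conj (G w) * G] is harmonic, so [U] plus a small
    multiple of the squared distance to the origin has positive Laplacian, and its
    maximum over [K] is attained where [nsq (G z) <= M].  At [w] the function [U]
    takes the value [nsq (G w)]. *)
Lemma max_modulus D K G (M : R) : open D -> K `<=` D -> compact K -> hol2 D G ->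
  (forall z, K z -> nbhs z K \/ nsq (G z) <= M) ->
  forall z, K z -> nsq (G z) <= M.
Proof.
move=> oD KD cK hG bdK w Kw.
have cG := hol_continuous oD (hol2_hol oD hG).
case: hG => [G1 [dG [G2 HG2]]].
pose a := complex.Re (G w); pose b := complex.Im (G w).
pose U t := a * complex.Re (G t) + b * complex.Im (G t).
have Uw : U w = nsq (G w) by rewrite /U /nsq !expr2.
have cU z : D z -> U t @[t --> z] --> U z.
  move=> /cG[c1 c2]; apply: cvgD; apply: cvgM => //; exact: cvg_cst.
have cwithin (u : R * R -> R) : (forall z, D z -> u t @[t --> z] --> u z) ->
    {within K, continuous u}.
  by move=> cu; apply: continuous_in_subspaceT => z; rewrite inE => /KD; exact: cu.
have K0 : K !=set0 by exists w.
have [cB _ HB] := compact_EVT_max K0 cK (cwithin _ (fun z _ => @cvg_toC z)).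
set B := nsq (toC cB) in HB.
apply/ler_addgt0Pr => e e0.
pose d := e / (2 * (B + 1)).
have B0 : 0 <= B by exact: nsq_ge0.
have d0 : 0 < d by rewrite divr_gt0// mulr_gt0// ltr_wpDl.
have cpsi z : D z -> (U t + d * nsq (toC t)) @[t --> z] --> U z + d * nsq (toC z).
  move=> Dz; apply: cvgD; first exact: cU.
  by apply: cvgM; [exact: cvg_cst|exact: cvg_toC].
have [c /set_mem Kc Hc] := compact_EVT_max K0 cK (cwithin _ cpsi).
have [ic|Mc] := bdK c Kc.
  exfalso; have Dc := KD c Kc; have nD : nbhs c D by exact: open_nbhs_nbhs.
  have dU z (v : R * R) : forall w1, cderive G z v w1 ->
    is_derive z v U (a * complex.Re w1 + b * complex.Im w1).
    move=> w1 [d1 d2]; apply: is_deriveD; exact: is_deriveZ.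
  have [[h1 h2] _] := HG2 c Dc.
  have dU1 z (v : R * R) (x y : R): forall w1, cderive G1 z v w1 ->
    is_derive z v (fun t => x * complex.Re (G1 t) + y * complex.Im (G1 t))
      (x * complex.Re w1 + y * complex.Im w1).
    move=> w1 [d1 d2]; apply: is_deriveD; exact: is_deriveZ.
  apply: (@laplacian_max _ U
    (fun t => a * complex.Re (G1 t) + b * complex.Im (G1 t))
    (fun t => b * complex.Re (G1 t) + (- a) * complex.Im (G1 t)) c _ _ d _
    (dU1 c _ a b _ h1) (dU1 c _ b (- a) _ h2) _ d0).
  - apply: filterS nD => t Dt; have [e1 e2] := dG t Dt; split; first exact: dU.
    apply: (is_derive_eq (dU _ _ _ e2)); rewrite cReM cImM /=; ring.
  - rewrite cReM cImM /=; ring.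
  - by apply: filterS ic => t Kt; apply: Hc; rewrite inE.
have h1 := Hc w (mem_set Kw); rewrite Uw in h1.
have h2 := HB c (mem_set Kc).
(* The arithmetic-geometric inequality for the scalar product of [G w] and
   [G c]; it gives the bound for squared moduli with no square root. *)
have h3 : U c <= (nsq (G w) + nsq (G c)) / 2.
  have : 0 <= (a - complex.Re (G c)) ^+ 2 + (b - complex.Im (G c)) ^+ 2.
    by rewrite addr_ge0 ?sqr_ge0.
  rewrite /U /nsq -/a -/b; nra.
have h4 : d * nsq (toC c) <= e / 2.
  apply: (@le_trans _ _ (d * (B + 1))); first by rewrite ler_pM2l//; lra.
  by rewrite /d invfM mulrA -mulrA mulVf ?mulr1// gt_eqF// ltr_wpDl.
have h5 : 0 <= d * nsq (toC w) by rewrite mulr_ge0 ?nsq_ge0 ?ltW.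
lra.
Qed.

Lemma nsqV (a : complex R) : nsq a^-1 = (nsq a)^-1.
Proof.
have [->|a0] := eqVneq a 0; first by rewrite invr0 /nsq /= expr0n addr0 invr0.
have n0 : nsq a != 0 by rewrite nsq_eq0.
by apply: (mulfI n0); rewrite -nsqM mulfV// mulfV// /nsq /= expr1n expr0n addr0.
Qed.

Lemma nsqX (a : complex R) n : nsq (a ^+ n) = nsq a ^+ n.
Proof.
elim: n => [|n IH]; first by rewrite !expr0 /nsq /= expr1n expr0n addr0.
by rewrite !exprS nsqM IH.
Qed.

(** Applying the maximum principle to [F / (z - c) ^ n] bounds [nsq (F w)] by
    a constant times the [n]-th power of [nsq (w - c) / rho], a ratio smaller
    than 1. *)
Lemma zero_of_boundary_zero D K F (c : complex R) (rho : R) :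
  open D -> K `<=` D -> compact K -> hol2 D F ->
  (forall z, D z -> toC z != c) -> 0 < rho ->
  (forall z, K z -> [\/ nbhs z K, F z = 0 | rho <= nsq (toC z - c)]) ->
  forall z, K z -> nsq (toC z - c) < rho -> F z = 0.
Proof.
move=> oD KD cK hF Dc rho0 bdK w Kw w_rho.
pose W t := (toC t - c)^-1.
have hG n : hol2 D (fun t => F t * W t ^+ n).
  elim: n => [|n IH]; first by under eq_fun do rewrite expr0 mulr1.
  under eq_fun do rewrite exprSr mulrA.
  by apply: (hol2M oD IH); exact: hol2_inv_dist.
have [cM _ HM] : exists2 c, c \in K & forall t, t \in K -> nsq (F t) <= nsq (F c).
  apply: compact_EVT_max => //; first by exists w.
  apply: continuous_in_subspaceT => z; rewrite inE => /KD Dz.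
  by apply: cvg_nsq; exact: (hol_continuous oD (hol2_hol oD hF)).
set M := nsq (F cM) in HM.
have M0 : 0 <= M by exact: nsq_ge0.
have bnd n : nsq (F w) <= M * (nsq (toC w - c) / rho) ^+ n.
  have Wc z : D z -> 0 < nsq (toC z - c).
    by move=> /Dc; rewrite nsq_gt0 subr_eq0.
  have GE z : nsq (F z * W z ^+ n) = nsq (F z) / nsq (toC z - c) ^+ n.
    by rewrite nsqM nsqX nsqV exprVn.
  have : nsq (F w * W w ^+ n) <= M / rho ^+ n.
    apply: (max_modulus oD KD cK (hG n)) => // z Kz.
    have [?|Fz|rz] := bdK z Kz; [by left| |].
      by right; rewrite Fz mul0r /nsq /= expr0n addr0 divr_ge0// exprn_ge0// ltW.
    right; rewrite GE ler_pM ?nsq_ge0//.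
    + by rewrite invr_ge0 exprn_ge0// nsq_ge0.
    + by apply: HM; rewrite inE.
    + rewrite lef_pV2 ?posrE ?exprn_gt0// ?Wc//; first
        by rewrite lerXn2r ?nnegrE ?nsq_ge0// ltW.
      exact: KD.
  rewrite GE ler_pdivrMr ?exprn_gt0 ?Wc//; last exact: KD.
  by rewrite expr_div_n mulrAC mulrA.
have q0 : 0 <= nsq (toC w - c) / rho by rewrite divr_ge0 ?nsq_ge0 ?ltW.
have q1 : nsq (toC w - c) / rho < 1 by rewrite ltr_pdivrMr ?mul1r.
have cv : M * (nsq (toC w - c) / rho) ^+ n @[n --> \oo] --> M * 0.
  by apply: cvgM; [exact: cvg_cst|apply: cvg_expr; rewrite ger0_norm].
have : nsq (F w) <= M * 0.
  apply: (@cvgr_to_ge _ _ _ _ _ _ _ cv); exact: nearW.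
rewrite mulr0 => le0; apply/eqP; rewrite -nsq_eq0 eq_le le0 nsq_ge0//.
Qed.

Lemma near_zero_cdiff F z w : cdiff F z w -> (\forall t \near z, F t = 0) -> w = 0.
Proof.
move=> dF F0; apply: (cdiff_uniq dF).
have d v : cderive F z v 0.
  split.
    have e : \forall t \near z, 0 = complex.Re (F t) by apply: filterS F0 => t ->.
    exact: (near_eq_is_derive e (is_derive_cst 0 z v)).
  have e : \forall t \near z, 0 = complex.Im (F t) by apply: filterS F0 => t ->.
  exact: (near_eq_is_derive e (is_derive_cst 0 z v)).
by split; rewrite ?mulr0; exact: d.
Qed.

Lemma cdiff_zero_const F z0 (r : R) :
  (forall z, `|z.1 - z0.1| < r -> `|z.2 - z0.2| < r -> cdiff F z 0) ->
  F z0 = 0 -> forall z, `|z.1 - z0.1| < r -> `|z.2 - z0.2| < r -> F z = 0.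
Proof.
move=> dF F0 [x y] /= xr yr.
have z0E : z0 = (z0.1, z0.2) by case: (z0).
have z02r : `|z0.2 - z0.2| < r by rewrite subrr normr0 (le_lt_trans _ xr).
have e1 : F (x, z0.2) = F z0.
  rewrite [in RHS]z0E; apply: complexP; apply/eqP; rewrite -subr_eq0 -normr_le0.
    rewrite -(mul0r `|x - z0.1|).
    apply: (@mean_value_bound _ (fun x => complex.Re (F (x, z0.2))) (fun=> 0)) => t tx.
    rewrite normr0; split => //.
    by have [[/is_derive_slice_x ? _] _] := dF (t, z0.2) (le_lt_trans tx xr) z02r.
  rewrite -(mul0r `|x - z0.1|).
  apply: (@mean_value_bound _ (fun x => complex.Im (F (x, z0.2))) (fun=> 0)) => t tx.
  rewrite normr0; split => //.
  by have [[_ /is_derive_slice_x ?] _] := dF (t, z0.2) (le_lt_trans tx xr) z02r.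
rewrite -F0 -e1; apply: complexP; apply/eqP; rewrite -subr_eq0 -normr_le0.
  rewrite -(mul0r `|y - z0.2|).
  apply: (@mean_value_bound _ (fun y => complex.Re (F (x, y))) (fun=> 0)) => t ty.
  rewrite normr0; split => //.
  have [_ [/is_derive_slice_y]] := dF (x, t) xr (le_lt_trans ty yr).
  by rewrite mulr0.
rewrite -(mul0r `|y - z0.2|).
apply: (@mean_value_bound _ (fun y => complex.Im (F (x, y))) (fun=> 0)) => t ty.
rewrite normr0; split => //.
have [_ [_ /is_derive_slice_y]] := dF (x, t) xr (le_lt_trans ty yr).
by rewrite mulr0.
Qed.

End MaximumPrinciple.

(** * Unique continuation *)

Section UniqueContinuation.
Variable R : realType.
Implicit Types (z v : R * R) (D K E : set (R * R)) (f g F G : R * R -> complex R).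

Lemma box_nbhs z0 (r : R) : 0 < r -> nbhs z0 (box z0 r).
Proof. by move=> r0; apply/nbhs_boxP; exists r. Qed.

Lemma compact_closed_box K z0 (s : R) : closed K -> K `<=` box z0 s -> compact K.
Proof.
move=> cK Ks.
have cc : compact (`[z0.1 - s, z0.1 + s] `*` `[z0.2 - s, z0.2 + s]).
  by apply: compact_setX; exact: segment_compact.
apply: (subclosed_compact cK cc) => z /Ks[]; rewrite !ltr_norml.
by move=> /andP[? ?] /andP[? ?]; split; rewrite /= in_itv/=; apply/andP; lra.
Qed.

Lemma cont_dist (c : complex R) : continuous (fun z : R * R => nsq (toC z - c)).
Proof.
move=> z; apply: (@cvg_nsq _ (fun z => toC z - c)); apply: ccontD; last exact: ccont_cst.
by split; [exact: cvg_fst|exact: cvg_snd].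
Qed.

Lemma hol_sub D E f : D `<=` E -> hol E f -> hol D f.
Proof. by move=> DE [f' H]; exists f' => z /DE /H. Qed.

Lemma nsqB_toC z c : nsq (toC z - toC c) = (z.1 - c.1) ^+ 2 + (z.2 - c.2) ^+ 2.
Proof. by rewrite /nsq cReD cImD cReN cImN. Qed.

Lemma toC_inj z c : toC z = toC c -> z = c.
Proof. by case: z c => [? ?] [? ?] [-> ->]. Qed.

Lemma open_dist_lt c (a : R) : open [set z | nsq (toC z - toC c) < a].
Proof.
apply: (@open_comp _ _ (fun z : R * R => nsq (toC z - toC c)) [set x | x < a]).
  by move=> z _; exact: cont_dist.
exact: open_lt.
Qed.

Lemma dist_lt_box z c (a : R) : 0 < a -> nsq (toC z - toC c) < a ^+ 2 -> box c a z.
Proof.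
move=> a0; rewrite nsqB_toC => za.
have sq_lt (x : R) : x ^+ 2 < a ^+ 2 -> `|x| < a.
  by rewrite -(real_normK (num_real x)) ltr_sqr// nnegrE ltW.
split; apply: sq_lt; apply: le_lt_trans za.
  by rewrite lerDl sqr_ge0.
by rewrite lerDr sqr_ge0.
Qed.

(** Here [F] is a primitive of [f], and [P `\` Q] is thought of as the boundary
    of the closed region [P].  The part of [P] in the closed disc is compact, and
    a point of it is an interior point, or a zero of [F], or a point of the
    circle, as [zero_of_boundary_zero] requires. *)
Lemma zero_in_disc F f z0 c (r rho : R) (P Q : set (R * R)) :
  0 < rho -> hol (box z0 r) f ->
  (forall z, box z0 r z -> cdiff F z (f z)) ->
  closed P -> open Q -> ~ P c -> Q `<=` P ->
  (forall z, P z -> nsq (toC z - toC c) <= rho -> box z0 r z) ->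
  (forall z, P z -> ~ Q z -> nsq (toC z - toC c) <= rho -> F z = 0) ->
  forall z, P z -> nsq (toC z - toC c) < rho -> F z = 0.
Proof.
move=> rho0 hf dF cP oQ Pc QP Pbox FPQ.
pose D := box z0 r `&` [set z | nsq (toC z - toC c) != 0].
have oD : open D.
  apply: openI; first exact: open_box.
  apply: (@open_comp _ _ (fun z : R * R => nsq (toC z - toC c)) [set x | x != 0]).
    by move=> z _; exact: cont_dist.
  exact: open_neq.
pose K := P `&` [set z | nsq (toC z - toC c) <= rho].
have KD : K `<=` D.
  move=> z [Pz zrho]; split; first exact: Pbox.
  by rewrite /= nsq_eq0 subr_eq0; apply/eqP => /toC_inj zc; apply: Pc; rewrite -zc.
have cK : compact K.
  apply: (@compact_closed_box K z0 r) => [|z /KD[]//].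
  apply: closedI => //.
  apply: (@closed_comp _ _ (fun z : R * R => nsq (toC z - toC c)) [set x | x <= rho]).
    by move=> z _; exact: cont_dist.
  exact: closed_le.
have hF : hol2 D F.
  exists f; split; first by move=> z [/dF].
  by apply: hol_sub hf => z [].
move=> z Pz z_rho.
apply: (zero_of_boundary_zero oD KD cK hF _ rho0 _ _ z_rho).
- by move=> t [_ /=]; apply: contraNneq => ->; rewrite subrr /nsq /= expr0n addr0.
- move=> t [Pt trho].
  have [tr|tr] := leP rho (nsq (toC t - toC c)); first by constructor 3.
  have [Qt|Qt] := pselect (Q t); last by constructor 2; exact: FPQ.
  constructor 1; have : nbhs t (Q `&` [set z | nsq (toC z - toC c) < rho]).
    apply: open_nbhs_nbhs; split => //; apply: openI => //; exact: open_dist_lt.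
  by apply: filterS => s [/QP ? /ltW ?].
- by split => //; exact: ltW.
Qed.

(** The region is the complement of a small disc around [c] on which a primitive
    of [f] vanishes. *)
Lemma local_unique_continuation f z0 c (r : R) : 0 < r -> hol (box z0 r) f ->
  box z0 (r / 8) c -> (\forall t \near c, f t = 0) -> \forall t \near z0, f t = 0.
Proof.
move=> r0 hf [c1 c2] fc.
have r20 : 0 < r / 2 by rewrite divr_gt0.
have boxc : box c (r / 2) `<=` box z0 r.
  move=> t [t1 t2]; split.
    by have := ler_normD (t.1 - c.1) (c.1 - z0.1); rewrite subrKA; lra.
  by have := ler_normD (t.2 - c.2) (c.2 - z0.2); rewrite subrKA; lra.
have [F [Fc dF]] := local_primitive r20 (hol_sub boxc hf).
set r4 := r / 2 / 2 in dF.
have r4E : r4 = r / 4 by rewrite /r4; lra.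
have r40 : 0 < r4 by rewrite r4E; lra.
have /nbhs_boxP[d0 d00 Hd0] := fc.
pose d := Num.min d0 r4.
have d_gt0 : 0 < d by rewrite lt_min d00 r4E divr_gt0.
have d_le : d <= r4 by rewrite ge_min lexx orbT.
have d_le0 : d <= d0 by rewrite ge_min lexx.
clearbody d.
have F0 : forall z, `|z.1 - c.1| < d -> `|z.2 - c.2| < d -> F z = 0.
  apply: cdiff_zero_const => // z z1 z2.
  rewrite -(Hd0 z (lt_le_trans z1 d_le0) (lt_le_trans z2 d_le0)).
  by apply: dF; [exact: lt_le_trans d_le|exact: lt_le_trans d_le].
(* The disc of radius [r / 5] about [c] is inside the box of size [r / 4] where
   [F] is known, and contains [z0], at distance less than [sqrt 2 * r / 8]. *)
pose rho : R := (r / 5) ^+ 2.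
have rho0 : 0 < rho by rewrite exprn_gt0// divr_gt0.
have d20 : 0 < d ^+ 2 by rewrite exprn_gt0.
pose eps := d ^+ 2 / 4.
have eps0 : 0 < eps by rewrite divr_gt0.
have eps_d : eps < d ^+ 2 by rewrite /eps; lra.
have near_d z : nsq (toC z - toC c) < d ^+ 2 -> F z = 0.
  by move=> /(dist_lt_box d_gt0)[]; exact: F0.
have inbox z : nsq (toC z - toC c) <= rho -> box c r4 z.
  move=> zrho; apply: dist_lt_box => //; apply: le_lt_trans zrho _.
  by rewrite /rho r4E; nra.
have Fz z : nsq (toC z - toC c) < rho -> F z = 0.
  move=> z_rho; have [ze|ze] := ltP (nsq (toC z - toC c)) (d ^+ 2); first exact: near_d.
  apply: (@zero_in_disc F f c c r4 rho [set z | eps <= nsq (toC z - toC c)]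
    [set z | eps < nsq (toC z - toC c)]) => //.
  - by apply: hol_sub hf => t [t1 t2]; apply: boxc; split; rewrite r4E in t1 t2; lra.
  - by move=> t []; exact: dF.
  - apply: (@closed_comp _ _ (fun z : R * R => nsq (toC z - toC c)) [set x | eps <= x]).
      by move=> t _; exact: cont_dist.
    exact: closed_ge.
  - apply: (@open_comp _ _ (fun z : R * R => nsq (toC z - toC c)) [set x | eps < x]).
      by move=> t _; exact: cont_dist.
    exact: open_gt.
  - by rewrite /= subrr /nsq /= expr0n addr0; apply/negP; rewrite -ltNge.
  - by move=> t /ltW.
  - by move=> t _; exact: inbox.
  - by move=> t /= _ /negP; rewrite -leNgt => te _; apply: near_d; exact: le_lt_trans eps_d.
  - exact: le_trans (ltW eps_d) ze.
have z0rho : nsq (toC z0 - toC c) < rho.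
  rewrite nsqB_toC /rho; rewrite ltr_norml in c1; rewrite ltr_norml in c2.
  by case/andP: c1 c2 => ? ? /andP[? ?]; nra.
have nrho t : nsq (toC t - toC c) < rho -> nbhs t [set z | nsq (toC z - toC c) < rho].
  by move=> ?; apply: open_nbhs_nbhs; split => //; exact: open_dist_lt.
apply: filterS (nrho z0 z0rho) => t t_rho; have [t1 t2] := inbox t (ltW t_rho).
apply: (near_zero_cdiff (dF t t1 t2)).
by apply: filterS (nrho t t_rho) => s /Fz.
Qed.

(** The primitive of [f] vanishing at the centre vanishes on the real segment as
    well, hence in the upper half of a disc centred just below the real axis. *)
Lemma real_zeros_near_zero f (x0 r : R) : 0 < r -> hol (box (x0, 0) r) f ->
  (forall x, `|x - x0| < r -> f (x, 0) = 0) ->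
  \forall t \near (x0, r / 16), f t = 0.
Proof.
move=> r0 hf f0.
have [F [Fc dF]] := local_primitive r0 hf.
have r20 : 0 < r / 2 by lra.
have F0 x : `|x - x0| < r / 2 -> F (x, 0) = 0.
  move=> xr; transitivity (F (x0, 0)); last exact: Fc.
  have dF0 t : `|t - x0| <= `|x - x0| -> cdiff F (t, 0) 0.
    move=> tx; have tr := le_lt_trans tx xr.
    by rewrite -(f0 t); [apply: dF; rewrite //= subrr normr0|lra].
  apply: complexP; apply/eqP; rewrite -subr_eq0 -normr_le0.
    suff : `|complex.Re (F (x, 0)) - complex.Re (F (x0, 0))| <= 0 * `|x - x0|.
      by rewrite mul0r.
    apply: (@mean_value_bound _ (fun x => complex.Re (F (x, 0))) (fun=> 0)) => t tx.
    by rewrite normr0; split => //; have [[/is_derive_slice_x ? _] _] := dF0 t tx.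
  suff : `|complex.Im (F (x, 0)) - complex.Im (F (x0, 0))| <= 0 * `|x - x0|.
    by rewrite mul0r.
  apply: (@mean_value_bound _ (fun x => complex.Im (F (x, 0))) (fun=> 0)) => t tx.
  by rewrite normr0; split => //; have [[_ /is_derive_slice_x ?] _] := dF0 t tx.
pose c := (x0, - (r / 8)).
pose rho : R := (r / 4) ^+ 2.
have rho0 : 0 < rho by rewrite exprn_gt0// divr_gt0.
have inbox z : 0 <= z.2 -> nsq (toC z - toC c) <= rho -> box (x0, 0) (r / 2) z.
  move=> z2 zrho; have [] := @dist_lt_box z c (r / 3) ltac:(lra).
    by apply: le_lt_trans zrho _; rewrite /rho; nra.
  by rewrite /box /= !ltr_norml => /andP[? ?] /andP[? ?]; split; apply/andP; lra.
have cont2 : continuous (fun z : R * R => z.2) by move=> z; exact: cvg_snd.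
have Fz z : 0 <= z.2 -> nsq (toC z - toC c) < rho -> F z = 0.
  move=> z2; apply: (@zero_in_disc F f (x0, 0) c (r / 2) rho [set z | 0 <= z.2]
    [set z | 0 < z.2]) => //.
  - by apply: hol_sub hf => t [t1 t2]; split; lra.
  - by move=> t []; exact: dF.
  - by apply: (@closed_comp _ _ (fun z : R * R => z.2) [set x | 0 <= x]) => //; exact: closed_ge.
  - by apply: (@open_comp _ _ (fun z : R * R => z.2) [set x | 0 < x]) => //; exact: open_gt.
  - by rewrite /= /c /=; apply/negP; rewrite -ltNge; lra.
  - by move=> t /ltW.
  - by move=> [x y] /= y0 /negP; rewrite -leNgt => y0' xr;
    have y00 : y = 0 by [apply/eqP; rewrite eq_le y0']; subst y;
    have [/= /F0] := inbox (x, 0) y0 xr.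
pose V := [set z : R * R | 0 < z.2] `&` [set z | nsq (toC z - toC c) < rho].
have oV : open V.
  apply: openI; last exact: open_dist_lt.
  by apply: (@open_comp _ _ (fun z : R * R => z.2) [set x | 0 < x]) => //; exact: open_gt.
have Vn t : V t -> nbhs t V by move=> ?; exact: open_nbhs_nbhs.
have V0 : V (x0, r / 16).
  split; rewrite /= ?nsqB_toC /=; first lra.
  by rewrite /rho subrr; nra.
apply: filterS (Vn _ V0) => t Vt; have [t1 t2] := Vt.
have [b1 b2] := inbox t (ltW t1) (ltW t2).
apply: (near_zero_cdiff (dF t b1 b2)).
by apply: filterS (Vn _ Vt) => s [/ltW]; exact: Fz.
Qed.

(** By [local_unique_continuation], the interior of the zero set is closed
    in [E]. *)
Theorem unique_continuation E f z1 : open E -> connected E -> hol E f ->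
  E z1 -> (\forall t \near z1, f t = 0) -> forall z, E z -> f z = 0.
Proof.
move=> oE cE hf Ez1 fz1.
pose B := E `&` [set z | \forall t \near z, f t = 0].
suff BE : B = E by move=> z; rewrite -BE => -[_ /nbhs_singleton].
apply: cE; first by exists z1.
  exists [set z | \forall t \near z, f t = 0] => //.
  exact: (@open_interior _ [set t | f t = 0]).
exists (closure B); first exact: closed_closure.
apply/seteqP; split => [z [Ez Bz]|z [Ez clz]].
  by split => //; apply: subset_closure.
split => //.
have /nbhs_boxP[r r0 Hr] : nbhs z E by exact: open_nbhs_nbhs.
have r80 : 0 < r / 8 by lra.
have [c [[Ec fc] bc]] := clz _ (box_nbhs z r80).
apply: (local_unique_continuation r0 _ bc fc).
by apply: hol_sub hf => t [t1 t2]; exact: Hr.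
Qed.

End UniqueContinuation.

(** * Continuous determinations of the argument *)

Section Argument.
Variable R : realType.
Implicit Types (w : complex R) (a b : R).

(** The modulus [m] is positive, so that having an argument entails being
    nonzero. *)
Definition is_arg w a := exists2 m : R, 0 < m &
  complex.Re w = m * cos a /\ complex.Im w = m * sin a.

Lemma is_argM w w' a b : is_arg w a -> is_arg w' b -> is_arg (w * w') (a + b).
Proof.
move=> [m m0 [wr wi]] [m' m'0 [wr' wi']]; exists (m * m'); first exact: mulr_gt0.
by rewrite cReM cImM wr wi wr' wi' cosD sinD; split; ring.
Qed.

Lemma is_arg_neq0 w a : is_arg w a -> w != 0.
Proof.
move=> [m m0 [wr wi]]; apply/eqP => w0; move: wr wi; rewrite w0 /= => cr ci.
have := cos2Dsin2 a; suff [-> ->] : cos a = 0 /\ sin a = 0.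
  by rewrite expr0n addr0 => /eqP; rewrite eq_sym oner_eq0.
have mn : m != 0 by rewrite gt_eqF.
by split; apply: (mulfI mn); rewrite mulr0.
Qed.

Lemma is_arg_atan w : 0 < complex.Re w ->
  is_arg w (atan (complex.Im w / complex.Re w)).
Proof.
move=> w0; set t := _ / _.
have c0 : 0 < cos (atan t) by rewrite cos_atan invr_gt0 sqrtr_gt0 ltr_pwDl ?sqr_ge0.
have cn : cos (atan t) != 0 by rewrite gt_eqF.
have s : sin (atan t) = t * cos (atan t) by rewrite -{2}(atanK t) /tan divfK.
exists (complex.Re w / cos (atan t)); first by rewrite divr_gt0.
split; first by rewrite divfK.
by rewrite s /t mulrCA divfK// divfK// gt_eqF.
Qed.

Lemma is_arg_exists w : w != 0 -> exists a, is_arg w a.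
Proof.
rewrite -nsq_gt0 => w0; pose m := Num.sqrt (nsq w).
have m0 : 0 < m by rewrite sqrtr_gt0.
have mn : m != 0 by rewrite gt_eqF.
have m2 : m ^+ 2 = nsq w by rewrite sqr_sqrtr ?ltW.
pose c := complex.Re w / m; pose s := complex.Im w / m.
have cs : c ^+ 2 + s ^+ 2 = 1.
  by rewrite /c /s !expr_div_n -mulrDl m2 divff// gt_eqF.
have c1 : -1 <= c <= 1.
  rewrite -ler_norml -(expr_le1 (ltn0Sn 1))// real_normK ?num_real//.
  by have := sqr_ge0 s; lra.
have wr : complex.Re w = m * c by rewrite /c mulrC divfK.
have wi : complex.Im w = m * s by rewrite /s mulrC divfK.
have sa : sin (acos c) = `|s|.
  by rewrite sin_acos// -cs addrAC subrr add0r sqrtr_sqr.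
have ca : cos (acos c) = c by rewrite acosK.
have [s0|s0] := leP 0 s.
  by exists (acos c), m => //; rewrite ca sa ger0_norm.
by exists (- acos c), m => //; rewrite cosN sinN ca sa ltr0_norm// opprK.
Qed.

Lemma is_arg_uniq w a b : is_arg w a -> is_arg w b -> cos a = cos b /\ sin a = sin b.
Proof.
move=> [m m0 [wr wi]] [m' m'0 [wr' wi']].
have mm : m = m'.
  have : m ^+ 2 = m' ^+ 2.
    have e1 : m ^+ 2 = nsq w by rewrite /nsq wr wi !exprMn -mulrDr cos2Dsin2 mulr1.
    have e2 : m' ^+ 2 = nsq w by rewrite /nsq wr' wi' !exprMn -mulrDr cos2Dsin2 mulr1.
    by rewrite e1 e2.
  by move/eqP; rewrite eqrXn2 ?ltW// => /eqP.
have mn : m != 0 by rewrite gt_eqF.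
by split; apply: (mulfI mn); [rewrite -wr wr' mm|rewrite -wi wi' mm].
Qed.

(** Two continuous determinations of the argument differ by a constant: their
    difference takes values in a discrete set. *)
Lemma arg_lift_uniq (psi : R -> complex R) (th1 th2 : R -> R) :
  continuous th1 -> continuous th2 ->
  (forall t, 0 <= t <= 1 -> is_arg (psi t) (th1 t)) ->
  (forall t, 0 <= t <= 1 -> is_arg (psi t) (th2 t)) ->
  forall t, 0 <= t <= 1 -> th1 t - th1 0 = th2 t - th2 0.
Proof.
move=> c1 c2 a1 a2 t /andP[t0 t1].
pose d u := th1 u - th2 u.
have cd : continuous d by move=> u; apply: cvgB; [exact: c1|exact: c2].
have cosd u : 0 <= u <= 1 -> cos (d u) = 1 /\ sin (d u) = 0.
  move=> u01; have [ec es] := is_arg_uniq (a1 u u01) (a2 u u01).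
  rewrite /d cosB sinB ec es -!expr2 cos2Dsin2; split => //.
  by rewrite mulrC subrr.
suff : d t = d 0 by rewrite /d; lra.
have [c0 s0] := cosd 0 ltac:(rewrite lexx ler01//).
have key v : 0 < v -> v <= pi -> forall u, 0 <= u <= 1 -> `|d u - d 0| != v.
  move=> v0 vpi u u01; apply/eqP => duv.
  have cv : cos v = 1.
    have [cu su] := cosd u u01.
    have : cos (d u - d 0) = 1 by rewrite cosB cu su c0 s0 mulr1 mulr0 addr0.
    by rewrite -duv; case: (ger0P (d u - d 0)) => // _; rewrite cosN.
  have : v = 0.
    apply: cos_inj; rewrite ?in_itv/= ?lexx ?cos0 ?pi_ge0 ?vpi ?(ltW v0)//.

  by move=> v00; rewrite v00 ltxx in v0.
apply/eqP; apply: contraT => dt0; exfalso.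
pose v := Num.min `|d t - d 0| pi.
have v0 : 0 < v by rewrite lt_min normr_gt0 subr_eq0 dt0 pi_gt0.
have vpi : v <= pi by rewrite ge_min lexx orbT.
have cn : {within `[0, t], continuous (fun u => `|d u - d 0|)}.
  apply: continuous_subspaceT => u; apply: cvg_norm; apply: cvgB; first exact: cd.
  exact: cvg_cst.
have [u] := @IVT R _ 0 t v t0 cn ltac:(rewrite /= subrr normr0 (min_idPl _)// (max_idPr _)//;
  rewrite (ltW v0)//= ge_min lexx//).
rewrite in_itv/= => /andP[u0 ut] /eqP; apply/negP; apply: key => //.
by rewrite u0 (le_trans ut).
Qed.

(** Multiplying successive ratios with positive real part, whose arguments are
    given by the arctangent. *)
Lemma arg_prod_ratios (psi : nat -> complex R) a N :
  is_arg (psi 0) a -> (forall k, (k < N)%N -> 0 < complex.Re (psi k.+1 / psi k)) ->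
  is_arg (psi N) (a + \sum_(k < N) atan (complex.Im (psi k.+1 / psi k) /
                                          complex.Re (psi k.+1 / psi k))).
Proof.
move=> a0; elim: N => [|N IH] H; first by rewrite big_ord0 addr0.
have psiN : is_arg (psi N) (a + \sum_(k < N) atan (complex.Im (psi k.+1 / psi k) /
                                          complex.Re (psi k.+1 / psi k))).
  by apply: IH => k kN; apply: H; exact: ltnW.
rewrite big_ord_recr/= addrA -{1}(divfK (is_arg_neq0 psiN) (psi N.+1)) mulrC.
by apply: is_argM => //; apply: is_arg_atan; exact: H.
Qed.

End Argument.

Section Lifting.
Variable R : realType.

Definition unit_square : set (R * R) := `[0, 1] `*` `[0, 1].

Lemma in01 (x : R) : (`[0, 1]%classic : set R) x <-> 0 <= x <= 1.
Proof. by rewrite /= in_itv. Qed.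

Lemma unit_square_scale (l : R) z : 0 <= l <= 1 -> unit_square z ->
  unit_square (l * z.1, l * z.2).
Proof.
move=> /andP[l0 l1] [] /in01/andP[? ?] /in01/andP[? ?]; split; apply/in01 => /=; apply/andP.
  by split; [rewrite mulr_ge0|rewrite -[1]mulr1 ler_pM].
by split; [rewrite mulr_ge0|rewrite -[1]mulr1 ler_pM].
Qed.

(** By compactness it suffices to work near one point [z]: there the values of
    [Psi / Psi z] lie in a cone about 1 of total aperture a right angle, and the
    ratio of two points of this cone has positive real part. *)
Lemma ratio_unif (Psi : R * R -> complex R) :
  (forall z, ccont Psi z) -> (forall z, unit_square z -> Psi z != 0) ->
  exists2 d : R, 0 < d & forall z h, unit_square z -> `|h.1| < d -> `|h.2| < d ->
     0 < complex.Re (Psi (z + h) / Psi z).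
Proof.
move=> cPsi Psi0.
have cS : compact unit_square by apply: compact_setX; exact: segment_compact.
have /compact_near_coveringP nc := cS.
have := nc R (0^'+) (fun d z => forall h, `|h.1| < d -> `|h.2| < d ->
   Psi z != 0 -> 0 < complex.Re (Psi (z + h) / Psi z)) _.
case.
  move=> z Sz; have Psiz := Psi0 z Sz.
  pose u t := Psi t / Psi z.
  have cu : ccont u z by apply: ccontM; [exact: cPsi|exact: ccont_cst].
  have uz : u z = 1 by rewrite /u divff.
  have : \forall t \near z, `|complex.Im (u t)| < complex.Re (u t).
    have cd : (complex.Re (u t) - `|complex.Im (u t)|) @[t --> z] -->
        complex.Re (u z) - `|complex.Im (u z)|.
      by case: cu => c1 c2; apply: cvgB => //; exact: cvg_norm.
    have pd : 0 < complex.Re (u z) - `|complex.Im (u z)|.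
      by rewrite uz /= normr0 subr0.
    move/cvgrPdist_lt : cd => /(_ _ pd); apply: filterS => t.
    by rewrite ltr_norml => /andP[_]; lra.
  move=> /nbhs_boxP[r r0 Hr].
  have r20 : 0 < r / 2 by rewrite divr_gt0.
  exists ([set t | `|t.1 - z.1| < r / 2 /\ `|t.2 - z.2| < r / 2], [set d | d < r / 2]).
    split => /=; last exact: nbhs_right_lt.
    by apply/nbhs_boxP; exists (r / 2).
  move=> [t d] [/= [t1 t2] dr] h h1 h2 Psit.
  have a1 := Hr t ltac:(lra) ltac:(lra).
  have a2 : `|complex.Im (u (t + h))| < complex.Re (u (t + h)).
    apply: Hr; rewrite /= addrAC.
      by apply: le_lt_trans (ler_normD _ _) _; lra.
    by apply: le_lt_trans (ler_normD _ _) _; lra.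
  have u0 : u t != 0 by rewrite mulf_neq0// invr_eq0.
  have -> : Psi (t + h) / Psi t = u (t + h) / u t.
    by rewrite /u; field; rewrite Psit Psiz.
  rewrite cReM cReV cImV.
  have n0 : 0 < nsq (u t) by rewrite nsq_gt0.
  have -> : complex.Re (u (t + h)) * (complex.Re (u t) / nsq (u t)) -
    complex.Im (u (t + h)) * (- complex.Im (u t) / nsq (u t)) =
    (complex.Re (u (t + h)) * complex.Re (u t) + complex.Im (u (t + h)) * complex.Im (u t)) / nsq (u t).
    by field; rewrite gt_eqF.
  rewrite divr_gt0//; move: a1 a2; rewrite !ltr_norml => /andP[? ?] /andP[? ?]; nra.
move=> d /= d0 Hd; exists (d / 2); first by rewrite divr_gt0.
move=> z h Sz h1 h2; apply: (Hd (d / 2)) => //=; last exact: Psi0; last first.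
  by rewrite divr_gt0.
by rewrite sub0r normrN gtr0_norm ?divr_gt0//; lra.
Qed.

Lemma cvg_pairR (T : topologicalType) (f g : T -> R) (x : T) :
  f t @[t --> x] --> f x -> g t @[t --> x] --> g x ->
  (f t, g t) @[t --> x] --> (f x, g x).
Proof.
exact: (@cvg_pair T R R (nbhs x) (nbhs (f x)) (nbhs (g x)) _ _ _ f g).
Qed.

(** Composing with the retraction onto the unit interval extends continuous
    functions on the interval to the line, which makes it possible to work with
    plain continuity. *)
Definition clamp (x : R) : R := Num.max 0 (Num.min x 1).

Lemma clamp01 x : 0 <= clamp x <= 1.
Proof. by rewrite /clamp le_max lexx /= ge_max ler01 ge_min lexx orbT. Qed.

Lemma clamp_id x : 0 <= x <= 1 -> clamp x = x.
Proof. by move=> /andP[x0 x1]; rewrite /clamp min_l// max_r. Qed.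

Lemma clamp_continuous : continuous clamp.
Proof.
move=> x; apply: (@continuous_max _ _ (cst 0 : R -> R^o)
  ((id : R -> R^o) \min (cst 1 : R -> R^o))); first exact: cvg_cst.
by apply: continuous_min; [exact: cvg_id|exact: cvg_cst].
Qed.

Lemma cvg_comp_fst (T : topologicalType) (u : R -> T) (z : R * R) :
  u t @[t --> z.1] --> u z.1 -> u t.1 @[t --> z] --> u z.1.
Proof.
exact: (@cvg_comp _ _ _ (fun t : R * R => t.1) u _ (nbhs z.1) _ cvg_fst).
Qed.

Lemma cvg_comp_snd (T : topologicalType) (u : R -> T) (z : R * R) :
  u t @[t --> z.2] --> u z.2 -> u t.2 @[t --> z] --> u z.2.
Proof.
exact: (@cvg_comp _ _ _ (fun t : R * R => t.2) u _ (nbhs z.2) _ cvg_snd).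
Qed.

Definition clamp2 (z : R * R) : R * R := (clamp z.1, clamp z.2).

Lemma clamp2_square z : unit_square (clamp2 z).
Proof. by split; apply/in01; exact: clamp01. Qed.

Lemma clamp2_id z : unit_square z -> clamp2 z = z.
Proof.
by case: z => s t [/= /in01 ? /in01 ?]; rewrite /clamp2 /= !clamp_id.
Qed.

Lemma clamp2_continuous : continuous clamp2.
Proof.
move=> z; apply: (@cvg_pairR _ (fun z => clamp z.1) (fun z => clamp z.2)).
  exact: (@cvg_comp_fst _ clamp _ (@clamp_continuous _)).
exact: (@cvg_comp_snd _ clamp _ (@clamp_continuous _)).
Qed.

(** The argument along the segment from the origin to a point of the square is
    the sum of the small increments between [N] equally spaced points, each of
    which is an arctangent and depends continuously on the point. *)
Lemma square_arg_lift (Psi : R * R -> complex R) :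
  (forall z, ccont Psi z) -> (forall z, unit_square z -> Psi z != 0) ->
  exists Theta : R * R -> R, continuous Theta /\
    forall z, unit_square z -> is_arg (Psi z) (Theta z).
Proof.
move=> cPsi Psi0; have [d d0 Hd] := ratio_unif cPsi Psi0.
have S0 : unit_square (0, 0) by split; apply/in01; rewrite /= lexx ler01.
have [a0 Ha0] := is_arg_exists (Psi0 _ S0).
have [N] : exists N, d^-1 < N.+1%:R.
  by exists (Num.truncn d^-1); exact: truncnS_gt.
set M : R := _%:R => NM.
have M0 : 0 < M by rewrite /M ltr0Sn.
have Mn : M != 0 by rewrite gt_eqF.
pose pt (k : nat) (z : R * R) : R * R := (k%:R / M * (clamp2 z).1, k%:R / M * (clamp2 z).2).
pose q k z := Psi (pt k.+1 z) / Psi (pt k z).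
have kM k : (k <= N.+1)%N -> 0 <= k%:R / M <= 1.
  move=> kN; apply/andP; split; first by rewrite divr_ge0// ler0n.
  by rewrite ler_pdivrMr// mul1r ler_nat.
have Spt k z : (k <= N.+1)%N -> unit_square (pt k z).
  by move=> kN; apply: unit_square_scale; [exact: kM|exact: clamp2_square].
have qpos k z : (k < N.+1)%N -> 0 < complex.Re (q k z).
  move=> kN.
  have small (x : R) : 0 <= x <= 1 -> `|x / M| < d.
    move=> /andP[x0 x1]; rewrite ger0_norm ?divr_ge0 ?(ltW M0)// ltr_pdivrMr//.
    by apply: le_lt_trans x1 _; rewrite -(mulfV (lt0r_neq0 d0)) ltr_pM2l.
  rewrite /q; have -> : pt k.+1 z = pt k z + ((clamp2 z).1 / M, (clamp2 z).2 / M).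
    by apply/pair_equal_spec; split; rewrite /= -[k.+1]addn1 natrD; ring.
  apply: Hd; first by apply: Spt; exact: ltnW.
  - by apply: small => /=; exact: clamp01.
  - by apply: small => /=; exact: clamp01.
have cpt k : continuous (pt k).
  move=> z; apply: (@cvg_pairR _ (fun z => k%:R / M * clamp z.1)
    (fun z => k%:R / M * clamp z.2)); apply: cvgM; (try exact: cvg_cst).
    exact: (@cvg_comp_fst _ clamp _ (@clamp_continuous _)).
  exact: (@cvg_comp_snd _ clamp _ (@clamp_continuous _)).
have cPpt k z : ccont (fun z => Psi (pt k z)) z.
  have [c1 c2] := cPsi (pt k z); split.
    exact: (cvg_comp _ _ (cpt k z) c1).
  exact: (cvg_comp _ _ (cpt k z) c2).
exists (fun z => a0 + \sum_(k < N.+1) atan (complex.Im (q k z) / complex.Re (q k z))).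
split.
  move=> z; apply: cvgD; first exact: cvg_cst.
  suff : forall n, (n <= N.+1)%N ->
      \sum_(k < n) atan (complex.Im (q k t) / complex.Re (q k t)) @[t --> z] -->
      \sum_(k < n) atan (complex.Im (q k z) / complex.Re (q k z)) by exact.
  elim=> [_|k IH kN].
    by rewrite big_ord0; under eq_fun do rewrite big_ord0; exact: cvg_cst.
  rewrite big_ord_recr; under eq_fun do rewrite big_ord_recr.
  apply: cvgD; first by apply: IH; exact: ltnW.
  have cq : ccont (q k) z.
    apply: ccontM => //; apply: ccontV => //.
    by apply: Psi0; apply: Spt; exact: ltnW.
  case: cq => c1 c2.
  apply: (@cvg_comp _ _ _ (fun z => complex.Im (q k z) / complex.Re (q k z)) atan);
    last exact: continuous_atan.
  by apply: cvgM => //; apply: cvgV => //; rewrite gt_eqF// qpos.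
move=> z Sz.
have -> : Psi z = Psi (pt N.+1 z).
  by rewrite /pt divff// !mul1r clamp2_id//; case: (z).
apply: (@arg_prod_ratios _ (fun k => Psi (pt k z))); last by move=> k kN; exact: qpos.
by rewrite /pt !mul0r.
Qed.

Lemma path_arg_lift (psi : R -> complex R) :
  (forall t, complex.Re (psi u) @[u --> t] --> complex.Re (psi t)) ->
  (forall t, complex.Im (psi u) @[u --> t] --> complex.Im (psi t)) ->
  (forall t, 0 <= t <= 1 -> psi t != 0) ->
  exists theta : R -> R, continuous theta /\
    forall t, 0 <= t <= 1 -> is_arg (psi t) (theta t).
Proof.
move=> c1 c2 psi0.
have [||Theta [cT HT]] := @square_arg_lift (fun z => psi z.2).
- move=> z; split.
    exact: (cvg_comp_snd (c1 z.2)).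
  exact: (cvg_comp_snd (c2 z.2)).
- by move=> z [_ /in01]; exact: psi0.
exists (fun t => Theta (0, t)); split.
  move=> t; apply: (@cvg_comp _ _ _ (fun t => (0, t)) Theta _ (nbhs (0, t)));
    last exact: cT.
  by apply: (@cvg_pairR R (fun=> 0) (fun t => t)); [exact: cvg_cst|exact: cvg_id].
by move=> t t01; apply: (HT (0, t)); split; apply/in01 => //=; rewrite lexx ler01.
Qed.

End Lifting.

Section SimplyConnectedArgument.
Variables (R : realType) (T : topologicalType) (A : set T) (phi : T -> complex R).
Hypothesis phi_re : forall x, A x -> complex.Re (phi y) @[y --> x] --> complex.Re (phi x).
Hypothesis phi_im : forall x, A x -> complex.Im (phi y) @[y --> x] --> complex.Im (phi x).
Hypothesis phi_neq0 : forall x, A x -> phi x != 0.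
Implicit Types (gamma alpha beta : R -> T).

(** Paths are parametrized by the whole line, so that they may be restricted and
    reparametrized without care for the endpoints. *)
Definition line_in gamma := continuous gamma /\ forall t, A (gamma t).

Lemma within_comp_continuous (U V : topologicalType) (S : set U) (f : U -> T) (c : V -> U) :
  {within S, continuous f} -> continuous c -> (forall v, S (c v)) ->
  continuous (f \o c).
Proof.
move=> /subspace_continuousP cf cc Sc v.
apply: (@cvg_comp _ _ _ c f _ (within S (nbhs (c v)))); last exact: cf.
move=> P; rewrite /within /= => nP.
have := cc v _ nP; rewrite /= /nbhs /=; apply: filterS => u; apply; exact: Sc.
Qed.

Lemma line_of_path gamma : path_in A gamma -> line_in (gamma \o @clamp R).
Proof.
move=> [cg Ag]; split.
  apply: within_comp_continuous cg (@clamp_continuous R) _ => t; apply/in01; exact: clamp01.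
by move=> t; apply: Ag; exact: clamp01.
Qed.

Lemma path_of_line gamma : line_in gamma -> path_in A gamma.
Proof. by move=> [cg Ag]; split => [|t _]; [exact: continuous_subspaceT|exact: Ag]. Qed.

Definition arg_along gamma (theta : R -> R) :=
  continuous theta /\ forall t, 0 <= t <= 1 -> is_arg (phi (gamma t)) (theta t).

Lemma arg_along_exists gamma : line_in gamma -> exists theta, arg_along gamma theta.
Proof.
move=> [cg Ag]; apply: path_arg_lift.
- move=> t; apply: (@cvg_comp _ _ _ gamma (fun y => complex.Re (phi y)) _ (nbhs (gamma t)));
    [exact: cg|exact: phi_re].
- move=> t; apply: (@cvg_comp _ _ _ gamma (fun y => complex.Im (phi y)) _ (nbhs (gamma t)));
    [exact: cg|exact: phi_im].
- by move=> t _; exact: phi_neq0.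
Qed.

Definition variation gamma (d : R) :=
  exists theta, arg_along gamma theta /\ theta 1 - theta 0 = d.

Lemma variation_uniq gamma d d' : variation gamma d -> variation gamma d' -> d = d'.
Proof.
move=> [th [[c a] <-]] [th' [[c' a'] <-]].
by apply: (arg_lift_uniq c c' a a'); rewrite ler01 lexx.
Qed.

Definition concat alpha beta (t : R) :=
  if t <= 1 / 2 then alpha (2 * t) else beta (2 * t - 1).

Lemma concat_line alpha beta : line_in alpha -> line_in beta -> alpha 1 = beta 0 ->
  line_in (concat alpha beta).
Proof.
move=> [ca Aa] [cb Ab] ab; split; last by move=> t; rewrite /concat; case: ifP.
have c1 : continuous (fun t : R => alpha (2 * t)).
  move=> t; apply: (@cvg_comp _ _ _ (fun t => 2 * t) alpha _ (nbhs (2 * t))); last exact: ca.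
  by apply: cvgM; [exact: cvg_cst|exact: cvg_id].
have c2 : continuous (fun t : R => beta (2 * t - 1)).
  move=> t; apply: (@cvg_comp _ _ _ (fun t => 2 * t - 1) beta _ (nbhs (2 * t - 1))); last exact: cb.
  by apply: cvgB; [apply: cvgM; [exact: cvg_cst|exact: cvg_id]|exact: cvg_cst].
move=> t P; rewrite {1}/concat => nP.
have [th|th] := ltP t (1 / 2).
  have nPa : nbhs (alpha (2 * t)) P by move: nP; rewrite ltW.
  have H : \forall u \near t, u < 1 / 2 by exact: lt_nbhsl.
  apply: filterS (filterI H (c1 t P nPa)) => u [u2 /= Pu].
  by rewrite /concat ltW.
have [th'|th'] := ltP (1 / 2) t.
  have nPb : nbhs (beta (2 * t - 1)) P by move: nP; rewrite leNgt th'.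
  have H : \forall u \near t, 1 / 2 < u by exact: lt_nbhsr.
  apply: filterS (filterI H (c2 t P nPb)) => u [u2 /= Pu].
  by rewrite /concat leNgt u2.
have te : t = 1 / 2 by apply/eqP; rewrite eq_le th th'.
have e1 : 2 * t = 1 by rewrite te; lra.
have nPa : nbhs (alpha (2 * t)) P by move: nP; rewrite th'.
have nPb : nbhs (beta (2 * t - 1)) P by move: nPa; rewrite e1 subrr ab.
have n1 : nbhs t [set u | P (alpha (2 * u))] by exact: c1 nPa.
have n2 : nbhs t [set u | P (beta (2 * u - 1))] by exact: c2 nPb.
apply: filterS (filterI n1 n2) => u [/= Pu1 Pu2].
by rewrite /concat; case: ifP.
Qed.

Lemma concat0 alpha beta : concat alpha beta 0 = alpha 0.
Proof. by rewrite /concat mulr0 divr_ge0. Qed.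

Lemma concat1 alpha beta : concat alpha beta 1 = beta 1.
Proof.
rewrite /concat ifF; last by apply/negP; lra.
by congr beta; lra.
Qed.

(** An argument along the concatenation restricts to arguments along both paths,
    and the variation along a path is unique. *)
Lemma variation_concat alpha beta a b : line_in alpha -> line_in beta ->
  alpha 1 = beta 0 -> variation alpha a -> variation beta b ->
  variation (concat alpha beta) (a + b).
Proof.
move=> la lb ab va vb.
have [Th [cT HT]] := arg_along_exists (concat_line la lb ab).
exists Th; split => //.
have -> : a = Th (1 / 2) - Th 0.
  apply: (variation_uniq va); exists (fun t => Th (t / 2)); split; last by rewrite mul0r.
  split.
    move=> t; apply: (@cvg_comp _ _ _ (fun t => t / 2) Th _ (nbhs (t / 2))); last exact: cT.
    by apply: cvgM; [exact: cvg_id|exact: cvg_cst].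
  move=> t /andP[t0 t1]; have := HT (t / 2); rewrite /concat ifT; last by lra.
  have -> : 2 * (t / 2) = t by field.
  by apply; apply/andP; lra.
have -> : b = Th 1 - Th (1 / 2); last by ring.
apply: (variation_uniq vb); exists (fun t => Th ((t + 1) / 2)); split; last first.
  by congr (Th _ - Th _); field.
split.
  move=> t; apply: (@cvg_comp _ _ _ (fun t => (t + 1) / 2) Th _ (nbhs ((t + 1) / 2)));
    last exact: cT.
  by apply: cvgM; [apply: cvgD; [exact: cvg_id|exact: cvg_cst]|exact: cvg_cst].
move=> t /andP[t0 t1]; have := HT ((t + 1) / 2); rewrite /concat.
case: ifPn => [th|_].
  have -> : t = 0 by lra.
  have -> : 2 * ((0 + 1) / 2) = 1 :> R by field.
  by rewrite ab; apply; apply/andP; lra.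
have -> : 2 * ((t + 1) / 2) - 1 = t by field.
by apply; apply/andP; lra.
Qed.

Definition reverse gamma (t : R) := gamma (1 - t).

Lemma cvg_reverse (V : topologicalType) (u : R -> V) : continuous u ->
  continuous (fun t : R => u (1 - t)).
Proof.
move=> cu t; apply: (@cvg_comp _ _ _ (fun t => 1 - t) u _ (nbhs (1 - t))); last exact: cu.
by apply: cvgB; [exact: cvg_cst|exact: cvg_id].
Qed.

Lemma reverse_line gamma : line_in gamma -> line_in (reverse gamma).
Proof. by move=> [cg Ag]; split; [exact: cvg_reverse|move=> t; exact: Ag]. Qed.

Lemma variation_reverse gamma d : variation gamma d -> variation (reverse gamma) (- d).
Proof.
move=> [th [[c a] <-]]; exists (fun t => th (1 - t)); split.
  split; first exact: cvg_reverse.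
  by move=> t /andP[t0 t1]; apply: a; apply/andP; lra.
by rewrite subrr subr0 opprB.
Qed.

Hypothesis Asc : simply_connected R A.

(** Lifting the argument over a homotopy that contracts the loop: it is constant
    on the three sides of the square that are mapped to the base point. *)
Lemma variation_loop gamma d : line_in gamma -> gamma 0 = gamma 1 ->
  variation gamma d -> d = 0.
Proof.
move=> lg g01 vd.
have [H [cH AH H0 H1]] := Asc.2 gamma (path_of_line lg) g01.
pose Psi z := phi (H (clamp2 z)).
have cHc : continuous (H \o @clamp2 R).
  by apply: within_comp_continuous cH (@clamp2_continuous R) _ => z; exact: clamp2_square.
have AHc z : A (H (clamp2 z)).
  by have [/in01 ? /in01 ?] := clamp2_square z; rewrite [clamp2 z]surjective_pairing; exact: AH.
have [||Th [cT HT]] := @square_arg_lift _ Psi.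
- move=> z; split.
    apply: (@cvg_comp _ _ _ (H \o @clamp2 R) (fun y => complex.Re (phi y)) _
      (nbhs (H (clamp2 z)))); [exact: cHc|exact: phi_re].
  apply: (@cvg_comp _ _ _ (H \o @clamp2 R) (fun y => complex.Im (phi y)) _
    (nbhs (H (clamp2 z)))); [exact: cHc|exact: phi_im].
- by move=> z _; exact: phi_neq0.
have S z1 z2 : 0 <= z1 <= 1 -> 0 <= z2 <= 1 -> is_arg (phi (H (z1, z2))) (Th (z1, z2)).
  move=> h1 h2; have : unit_square (z1, z2) by split; apply/in01.
  by move=> sq; have := HT _ sq; rewrite /Psi clamp2_id.
have i0 : 0 <= (0 : R) <= 1 by rewrite lexx ler01.
have i1 : 0 <= (1 : R) <= 1 by rewrite lexx ler01.
have cT1 s : continuous (fun t => Th (s, t)).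
  move=> t; apply: (@cvg_comp _ _ _ (fun t => (s, t)) Th _ (nbhs (s, t))); last exact: cT.
  by apply: (@cvg_pairR R R (fun=> s) (fun t => t)); [exact: cvg_cst|exact: cvg_id].
have cT2 s : continuous (fun t => Th (t, s)).
  move=> t; apply: (@cvg_comp _ _ _ (fun t => (t, s)) Th _ (nbhs (t, s))); last exact: cT.
  by apply: (@cvg_pairR R R (fun t => t) (fun=> s)); [exact: cvg_id|exact: cvg_cst].
have const (th : R -> R) : continuous th ->
    (forall t, 0 <= t <= 1 -> is_arg (phi (gamma 0)) (th t)) -> th 1 = th 0.
  move=> c a; have cc : continuous (fun _ : R => th 0) by move=> t; exact: cvg_cst.
  have := arg_lift_uniq c cc a (fun t _ => a 0 i0) i1.
  by rewrite subrr; lra.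
have e1 : Th (1, 1) = Th (1, 0).
  by apply: (const (fun t => Th (1, t))) => // t ht; have := S 1 t i1 ht; rewrite (H0 t ht).2.
have e2 : Th (1, 0) = Th (0, 0).
  by apply: (const (fun t => Th (t, 0))) => // t ht; have := S t 0 ht i0; rewrite (H1 t ht).1.
have e3 : Th (1, 1) = Th (0, 1).
  by apply: (const (fun t => Th (t, 1))) => // t ht; have := S t 1 ht i1; rewrite (H1 t ht).2.
apply: (variation_uniq vd); exists (fun t => Th (0, t)); split.
  by split => // t ht; have := S 0 t i0 ht; rewrite (H0 t ht).1.
by rewrite -e3 e1 e2 subrr.
Qed.

(** The first path followed by the second one backwards is a loop. *)
Lemma variation_homotopic alpha beta a b : line_in alpha -> line_in beta ->
  alpha 0 = beta 0 -> alpha 1 = beta 1 -> variation alpha a -> variation beta b -> a = b.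
Proof.
move=> la lb ab0 ab1 va vb.
have ab : alpha 1 = reverse beta 0 by rewrite /reverse subr0.
have lr := reverse_line lb.
have v := variation_concat la lr ab va (variation_reverse vb).
have : a - b = 0.
  apply: variation_loop v; first exact: concat_line.
  by rewrite concat0 concat1 /reverse subrr.
lra.
Qed.

(** The argument at [x] is its value at a base point plus the variation along a
    chosen path to [x]; going to a point of [sigma] through the beginning of
    [sigma] instead gives the same value, so the argument is continuous along
    [sigma].  In a general space, where small neighbourhoods need not be connected
    by paths, this is the form of continuity that holds. *)
Lemma exists_argument : exists theta : T -> R,
  (forall x, A x -> is_arg (phi x) (theta x)) /\
  (forall sigma, line_in sigma -> exists2 th, arg_along sigma th &
     forall t, 0 <= t <= 1 -> theta (sigma t) = th t).
Proof.
have [[x0 Ax0]|A0] := pselect (exists x, A x); last first.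
  exists (fun=> 0); split; first by move=> x Ax; exfalso; apply: A0; exists x.
  by move=> s [_ As]; exfalso; apply: A0; exists (s 0).
have i0 : 0 <= (0 : R) <= 1 by rewrite lexx ler01.
have i1 : 0 <= (1 : R) <= 1 by rewrite lexx ler01.
have [a0 Ha0] := is_arg_exists (phi_neq0 Ax0).
have ex x : exists gd : (R -> T) * R, A x ->
    [/\ line_in gd.1, gd.1 0 = x0, gd.1 1 = x & variation gd.1 gd.2].
  have [Ax|nAx] := pselect (A x); last by exists (fun=> x, 0).
  have [g [pg g0 g1]] := Asc.1 _ _ Ax0 Ax.
  have lg := line_of_path pg.
  have [th ath] := arg_along_exists lg.
  exists (g \o @clamp R, th 1 - th 0) => _; split => //=.
  - by rewrite clamp_id.
  - by rewrite clamp_id.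
  - by exists th.
have /choice[gd Hgd] := ex.
have Harg x : A x -> is_arg (phi x) (a0 + (gd x).2).
  move=> Ax; have [lg g0 g1 [th [[c a] <-]]] := Hgd x Ax.
  have b0 := a 0 i0; rewrite g0 in b0.
  have [ec es] := is_arg_uniq Ha0 b0.
  have := a 1 i1; rewrite g1 => -[m m0 [wr wi]]; exists m => //.
  have -> : a0 + (th 1 - th 0) = (a0 - th 0) + th 1 by ring.
  have c1 : cos (a0 - th 0) = 1 by rewrite cosB ec es -!expr2 cos2Dsin2.
  have s1 : sin (a0 - th 0) = 0 by rewrite sinB ec es mulrC subrr.
  move: c1 s1; move: (a0 - th 0) => d c1 s1.
  by rewrite cosD sinD c1 s1 !mul1r !mul0r subr0 add0r.
exists (fun x => a0 + (gd x).2); split => // sigma ls; have [th ath] := arg_along_exists ls.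
have As0 := ls.2 0; have [lg g0 g1 vg] := Hgd _ As0.
suff eq t : 0 <= t <= 1 ->
    a0 + (gd (sigma t)).2 = a0 + (gd (sigma 0)).2 + (th t - th 0).
  exists (fun t => a0 + (gd (sigma 0)).2 + (th t - th 0)) => //; split.
    move=> t; apply: cvgD; first exact: cvg_cst.
    by apply: cvgB; [exact: ath.1|exact: cvg_cst].
  by move=> t ht; rewrite -eq//; apply: Harg; exact: ls.2.
move=> ht.
have As := ls.2 t; have [lgt gt0 gt1 vgt] := Hgd _ As.
pose sig u := sigma (u * t).
have lsig : line_in sig.
  split; last by move=> u; exact: ls.2.
  move=> u; apply: (@cvg_comp _ _ _ (fun u => u * t) sigma _ (nbhs (u * t))); last exact: ls.1.
  by apply: cvgM; [exact: cvg_id|exact: cvg_cst].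
have vsig : variation sig (th t - th 0).
  exists (fun u => th (u * t)); rewrite mul1r mul0r; split => //; split.
    move=> u; apply: (@cvg_comp _ _ _ (fun u => u * t) th _ (nbhs (u * t))); last exact: ath.1.
    by apply: cvgM; [exact: cvg_id|exact: cvg_cst].
  move=> u /andP[u0 u1]; case/andP: ht => t0 t1; apply: ath.2.
  by rewrite mulr_ge0//= -[1]mulr1 ler_pM.
have gs : (gd (sigma 0)).1 1 = sig 0 by rewrite g1 /sig mul0r.
have := variation_homotopic lgt (concat_line lg lsig gs) _ _ vgt
  (variation_concat lg lsig gs vg vsig).
rewrite concat0 concat1 gt0 gt1 g0 /sig mul1r => /(_ erefl erefl) ->.
by rewrite addrA.
Qed.

End SimplyConnectedArgument.

(** * Logarithms on simply connected open sets *)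

Section Logarithm.
Variable R : realType.
Implicit Types (z v : R * R) (D B : set (R * R)) (c L : R * R -> complex R).

Lemma is_derive_line (u : R * R -> R) z v d :
  is_derive z v u d <-> is_derive (0 : R) 1 (fun h : R => u (h *: v + z)) d.
Proof.
have e : (fun h : R => h^-1 *: ((u \o shift z) (h *: v) - u z)) =
  (fun h : R => h^-1 *: (((fun h : R => u (h *: v + z)) \o shift 0) (h *: 1) - u (0 *: v + z))).
  by apply/funext => h /=; rewrite addr0 scale0r add0r [_%:A]mulr1.
split=> -[].
  by rewrite /derivable /derive e => ? ?; split.
by rewrite /derivable /derive -e => ? ?; split.
Qed.

Lemma is_derive_comp_fun (g : R -> R) (u : R * R -> R) z v a b :
  is_derive (u z) 1 g a -> is_derive z v u b ->
  is_derive z v (fun t => g (u t)) (a * b).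
Proof.
move=> dg /is_derive_line du; apply/is_derive_line.
apply: (@is_derive1_comp _ g (fun h : R => u (h *: v + z))) => //.
by rewrite scale0r add0r.
Qed.

Definition cexp (w : complex R) : complex R :=
  Complex (expR (complex.Re w) * cos (complex.Im w))
          (expR (complex.Re w) * sin (complex.Im w)).

(** Along the segment from [z] to a close point [t], the right hand side is a
    continuous argument, which must agree with [theta]. *)
Lemma local_argument B c (theta : R * R -> R) z : open B ->
  (forall z, B z -> ccont c z) -> (forall z, B z -> c z != 0) ->
  (forall x, B x -> is_arg (c x) (theta x)) ->
  (forall sigma, line_in B sigma -> exists2 th, arg_along c sigma th &
     forall t, 0 <= t <= 1 -> theta (sigma t) = th t) ->
  B z -> \forall t \near z, theta t =
    theta z + atan (complex.Im (c t / c z) / complex.Re (c t / c z)).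
Proof.
move=> oB cc c0 ath lth Bz; have cz := c0 z Bz.
have cr t : B t -> ccont (fun t => c t / c z) t.
  by move=> Bt; apply: ccontM; [exact: cc|exact: ccont_cst].
have : \forall t \near z, B t /\ 0 < complex.Re (c t / c z).
  have p1 : 0 < complex.Re (c z / c z) by rewrite divff.
  have [cre _] := cr z Bz.
  have n1 : \forall t \near z, 0 < complex.Re (c t / c z).
    move/cvgrPdist_lt : cre => /(_ _ p1); apply: filterS => t.
    by rewrite ltr_norml => /andP[_]; lra.
  have n2 : nbhs z B by exact: open_nbhs_nbhs.
  by apply: filterS (filterI n1 n2) => t [].
move=> /nbhs_boxP[r r0 Hr]; apply/nbhs_boxP; exists r => // t t1 t2.
pose sig (s : R) : R * R := (z.1 + clamp s * (t.1 - z.1), z.2 + clamp s * (t.2 - z.2)).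
have csig : continuous sig.
  move=> s; apply: (@cvg_pairR _ _ (fun s => z.1 + clamp s * (t.1 - z.1))
    (fun s => z.2 + clamp s * (t.2 - z.2))); apply: cvgD; (try exact: cvg_cst);
  apply: cvgM; (try exact: cvg_cst); exact: clamp_continuous.
have Bsig s : B (sig s) /\ 0 < complex.Re (c (sig s) / c z).
  have /andP[s0 s1] := clamp01 s.
  apply: Hr; rewrite /= addrAC subrr add0r normrM (ger0_norm s0).
    by apply: le_lt_trans t1; rewrite ler_piMl.
  by apply: le_lt_trans t2; rewrite ler_piMl.
have [th [cth ath'] eth] := lth sig (conj csig (fun s => (Bsig s).1)).
have sig0 : sig 0 = z.
  by rewrite /sig clamp_id ?lexx ?ler01// !mul0r !addr0; case: (z).
have sig1 : sig 1 = t.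
  by rewrite /sig clamp_id ?lexx ?ler01// !mul1r !subrKC; case: (t).
pose th2 s := theta z + atan (complex.Im (c (sig s) / c z) / complex.Re (c (sig s) / c z)).
have cth2 : continuous th2.
  move=> s; apply: cvgD; first exact: cvg_cst.
  apply: (@cvg_comp _ _ _
    (fun s => complex.Im (c (sig s) / c z) / complex.Re (c (sig s) / c z)) atan);
    last exact: continuous_atan.
  have [c1 c2] := cr _ (Bsig s).1.
  apply: cvgM.
    exact: (@cvg_comp _ _ _ sig (fun t => complex.Im (c t / c z)) _ (nbhs (sig s)) _ (csig s) c2).
  apply: cvgV; first by rewrite gt_eqF// (Bsig s).2.
  exact: (@cvg_comp _ _ _ sig (fun t => complex.Re (c t / c z)) _ (nbhs (sig s)) _ (csig s) c1).
have ath2 s : 0 <= s <= 1 -> is_arg (c (sig s)) (th2 s).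
  move=> _; rewrite -[c (sig s)](divfK cz) mulrC; apply: is_argM; first exact: ath.
  by apply: is_arg_atan; exact: (Bsig s).2.
have i1 : 0 <= (1 : R) <= 1 by rewrite lexx ler01.
have i0 : 0 <= (0 : R) <= 1 by rewrite lexx ler01.
have := arg_lift_uniq cth cth2 ath' ath2 i1.
rewrite -(eth 1 i1) -(eth 0 i0) /th2 sig0 sig1 divff//= mul0r atan0 addr0.
by lra.
Qed.

(** The arctangent is evaluated at 0, where its derivative is 1; so the derivative
    of the argument is the imaginary part of the logarithmic derivative of
    [c]. *)
Lemma derive_argument c (theta : R * R -> R) z v w : c z != 0 ->
  (\forall t \near z, theta t =
    theta z + atan (complex.Im (c t / c z) / complex.Re (c t / c z))) ->
  cderive c z v w -> is_derive z v theta (complex.Im (w / c z)).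
Proof.
move=> c0 near_th dc.
have [d1 d2] : cderive (fun t => c t / c z) z v (w / c z).
  have := cderiveM dc (cderive_cst (c z)^-1 z v).
  by rewrite mulr0 add0r.
have r1 : complex.Re (c z / c z) != 0 by rewrite divff// oner_eq0.
have dq := is_deriveM_fun d2 (is_deriveV_fun r1 d1).
have da := is_derive_comp_fun (is_derive1_atan _) dq.
have e : \forall t \near z,
    theta z + atan (complex.Im (c t / c z) / complex.Re (c t / c z)) = theta t.
  by apply: filterS near_th => t ->.
apply: (near_eq_is_derive e).
apply: (is_derive_eq (is_deriveD_fun (is_derive_cst (theta z) z v) da)).
rewrite divff//= !mul0r expr0n/= addr0 invr1 !mul1r add0r; ring.
Qed.

(** The real part of the logarithm is [ln (nsq c) / 2] and its imaginary part is a
    continuous argument; their derivatives are the two parts of the logarithmic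
    derivative [c' / c]. *)
Theorem holomorphic_log B c : open B -> simply_connected R B -> hol B c ->
  (forall z, B z -> c z != 0) -> exists L, hol B L /\ forall z, B z -> c z = cexp (L z).
Proof.
move=> oB sB hc c0; have cc := hol_continuous oB hc.
have [theta [ath lth]] := exists_argument (fun z Bz => (cc z Bz).1)
  (fun z Bz => (cc z Bz).2) c0 sB.
case: hc => c' dc'.
exists (fun z => Complex (ln (nsq (c z)) / 2) (theta z)); split; last first.
  move=> z Bz; have [m m0 [wr wi]] := ath z Bz.
  have e : expR (ln (nsq (c z)) / 2) = m.
    have m2 : nsq (c z) = m ^+ 2 by rewrite /nsq wr wi !exprMn -mulrDr cos2Dsin2 mulr1.
    rewrite m2 lnXn// (_ : ln m *+ 2 / 2 = ln m) ?lnK//; by field.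
  by apply: complexP; rewrite /= e.
exists (fun z => c' z / c z) => z Bz; have [dc ccz] := dc' z Bz.
have cz := c0 z Bz; have nz : nsq (c z) != 0 by rewrite nsq_eq0.
split; last by apply: ccontM => //; apply: ccontV => //; exact: cc.
have lth' := local_argument oB cc c0 ath lth Bz.
have key v w : cderive c z v w ->
    cderive (fun z => Complex (ln (nsq (c z)) / 2) (theta z)) z v (w / c z).
  move=> dcv; split => /=; last exact: derive_argument lth' dcv.
  have np : 0 < nsq (c z) by rewrite nsq_gt0.
  have dl := is_derive_comp_fun (is_derive1_ln np) (is_derive_nsq dcv).
  have d2 := is_deriveM_fun dl (is_derive_cst (2^-1 : R) z v).
  apply: (is_derive_eq d2).
  rewrite /= cReM cReV cImV mulr0 add0r; move: nz; rewrite /nsq => nz; field => //.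
by case: dc => d1 d2; split; [exact: key|rewrite mulrA; exact: key].
Qed.

End Logarithm.

(** * The exponential series *)

Section ExpSeries.
Variable R : realType.
Implicit Types (z v : R * R) (w L : complex R).

Local Notation rc := (real_complex R).

(** Submultiplicative, and a sum of moduli of real numbers, hence easy to bound by
    means of the real mean value theorem. *)
Definition norm1c w : R := `|complex.Re w| + `|complex.Im w|.

Lemma norm1cM w w' : norm1c (w * w') <= norm1c w * norm1c w'.
Proof.
rewrite /norm1c cReM cImM.
have := ler_normB (complex.Re w * complex.Re w') (complex.Im w * complex.Im w').
have := ler_normD (complex.Re w * complex.Im w') (complex.Im w * complex.Re w').
by rewrite !normrM; lra.
Qed.

Lemma norm1c_ge0 w : 0 <= norm1c w. Proof. by rewrite addr_ge0. Qed.

Lemma norm1cX w n : norm1c (w ^+ n) <= norm1c w ^+ n.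
Proof.
elim: n => [|n IH]; first by rewrite !expr0 /norm1c /= normr1 normr0 addr0.
by rewrite !exprS; apply: le_trans (norm1cM _ _) _; rewrite ler_wpM2l// norm1c_ge0.
Qed.

Lemma cexp0 : cexp (0 : complex R) = 1.
Proof. by apply: complexP; rewrite /= expR0 ?cos0 ?sin0 mul1r. Qed.

Lemma cexpN w : cexp w * cexp (- w) = 1.
Proof.
have e : expR (complex.Re w) * expR (- complex.Re w) = 1 by rewrite -expRD subrr expR0.
have cs := cos2Dsin2 (complex.Im w).
apply: complexP; last by rewrite cImM /= cReN cImN cosN sinN; ring.
transitivity (expR (complex.Re w) * expR (- complex.Re w) *
  (cos (complex.Im w) ^+ 2 + sin (complex.Im w) ^+ 2)); last by rewrite e cs mulr1.
by rewrite cReM /= cReN cImN cosN sinN; ring.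
Qed.

Lemma cdiff_cexp (f : R * R -> complex R) z w : cdiff f z w ->
  cdiff (fun t => cexp (f t)) z (w * cexp (f z)).
Proof.
have key v w1 : cderive f z v w1 -> cderive (fun t => cexp (f t)) z v (w1 * cexp (f z)).
  move=> [d1 d2].
  have de := is_derive_comp_fun (is_derive_expR (complex.Re (f z))) d1.
  have dc := is_derive_comp_fun (is_derive_cos (complex.Im (f z))) d2.
  have ds := is_derive_comp_fun (is_derive_sin (complex.Im (f z))) d2.
  split => /=; rewrite (cReM, cImM) /=.
    have h := is_deriveM_fun de dc; apply: (is_derive_eq h); ring.
  have h := is_deriveM_fun de ds; apply: (is_derive_eq h); ring.
by move=> [d1 d2]; split; [exact: key|rewrite mulrA; exact: key].
Qed.

Definition exp_poly (w : complex R) n : complex R :=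
  \sum_(k < n) rc (k`!%:R^-1) * w ^+ k.

Lemma cdiff_exp_poly L z n : cdiff (fun t => exp_poly (toC t * L) n.+1) z
  (L * exp_poly (toC z * L) n).
Proof.
have dl : cdiff (fun t : R * R => toC t * L) z L.
  have := cdiffM (cdiff_id z) (cdiff_cst L z); by rewrite mulr0 add0r mul1r.
have dX k : cdiff (fun t => (toC t * L) ^+ k.+1) z (k.+1%:R * (toC z * L) ^+ k * L).
  elim: k => [|k IH].
    by rewrite expr0 mulr1 mul1r; under eq_fun do rewrite expr1.
  under eq_fun do rewrite exprSr.
  have := cdiffM IH dl; congr (cdiff _ _ _).
  by rewrite [in RHS]mulrSr exprSr; ring.
elim: n => [|n IH].
  rewrite /exp_poly big_ord0 mulr0; under eq_fun do rewrite big_ord_recr big_ord0 /= expr0.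
  exact: cdiff_cst.
rewrite /exp_poly big_ord_recr /=; under eq_fun do rewrite big_ord_recr /=.
rewrite mulrDr; apply: cdiffD => //.
have := cdiffM (cdiff_cst (rc (n.+1`!%:R^-1)) z) (dX n).
rewrite mul0r addr0; congr (cdiff _ _ _).
have -> : rc (n`!%:R^-1) = rc (n.+1`!%:R^-1) * n.+1%:R.
  rewrite -[X in _ * X](rmorph_nat rc) factS natrM invfM.
  apply: complexP; rewrite (cReM, cImM) /= ?mulr0 ?mul0r ?subr0 ?addr0//.
  by rewrite mulrAC mulVf ?mul1r// pnatr_eq0.
ring.
Qed.

(** The error is controlled by the derivative of
    [z |-> cexp (- z L) * exp_poly (z L) n.+1], in which all terms but the last
    one of the polynomial cancel. *)
Lemma exp_poly_remainder L n :
  norm1c (cexp (- L) * exp_poly L n.+1 - 1) <=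
  4 * expR `|complex.Re L| * norm1c L * (norm1c L ^+ n / n`!%:R).
Proof.
pose Q z := cexp (- (toC z * L)) * exp_poly (toC z * L) n.+1.
pose Q' z := - (L * cexp (- (toC z * L)) * (rc (n`!%:R^-1) * (toC z * L) ^+ n)).
have dQ z : cdiff Q z (Q' z).
  have dl : cdiff (fun t : R * R => - (toC t * L)) z (- L).
    have := cdiffM (cdiff_id z) (cdiff_cst (- L) z); rewrite mulr0 add0r mul1r.
    by under eq_fun do rewrite mulrN.
  have := cdiffM (cdiff_cexp dl) (cdiff_exp_poly L z n); congr (cdiff _ _ _).
  by rewrite /Q' /exp_poly big_ord_recr /=; ring.
have toC0 : toC ((0, 0) : R * R) = 0 by [].
have toC1 : toC ((1, 0) : R * R) = 1 by [].
have Q0 : Q (0, 0) = 1.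
  rewrite /Q toC0 mul0r oppr0 cexp0 mul1r /exp_poly big_ord_recl /= expr0 mulr1.
  rewrite big1 ?addr0; last by move=> i _; rewrite exprS mul0r mulr0.
  by rewrite invr1.
have Q1 : Q (1, 0) = cexp (- L) * exp_poly L n.+1 by rewrite /Q toC1 mul1r.
pose C : R := 2 * expR `|complex.Re L| * norm1c L * (norm1c L ^+ n / n`!%:R).
have bQ t : `|t| <= 1 -> norm1c (Q' (t, 0)) <= C.
  move=> t1.
  have norm1cN w : norm1c (- w) = norm1c w by rewrite /norm1c cReN cImN !normrN.
  have norm1crc (r : R) : norm1c (rc r) = `|r| by rewrite /norm1c /= normr0 addr0.
  have zL : norm1c (toC (t, 0) * L) <= norm1c L.
    apply: le_trans (norm1cM _ _) _; rewrite [norm1c (toC _)](norm1crc t).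
    by rewrite ler_piMl// norm1c_ge0.
  have nE : norm1c (cexp (- (toC (t, 0) * L))) <= 2 * expR `|complex.Re L|.
    rewrite /norm1c /= !normrM (ger0_norm (expR_ge0 _)) -mulrDr mulrC.
    apply: ler_pM; rewrite ?expR_ge0 ?addr_ge0//.
      have := cos_max (complex.Im (- (toC (t, 0) * L))).
      have := sin_max (complex.Im (- (toC (t, 0) * L))).
      by rewrite /=; lra.
    rewrite ler_expR cReN cReM /= mul0r subr0.
    apply: le_trans (ler_norm _) _; rewrite normrN normrM ler_piMl//.
  rewrite /Q' norm1cN /C; apply: le_trans (norm1cM _ _) _; apply: ler_pM; rewrite ?norm1c_ge0//.
    by rewrite mulrC; apply: le_trans (norm1cM _ _) _; rewrite ler_wpM2r// norm1c_ge0.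
  rewrite mulrC; apply: le_trans (norm1cM _ _) _; rewrite norm1crc ger0_norm ?invr_ge0//.
  rewrite ler_wpM2r// ?invr_ge0//; apply: le_trans (norm1cX _ _) _.
  by rewrite lerXn2r ?nnegrE ?norm1c_ge0.
have key (u : complex R -> R) :
   (forall t, is_derive (t, 0) ((1, 0) : R * R) (fun z => u (Q z)) (u (Q' (t, 0)))) ->
   (forall w, `|u w| <= norm1c w) -> `|u (Q (1, 0)) - u (Q (0, 0))| <= C.
  move=> du un.
  move: (@mean_value_bound _ (fun t => u (Q (t, 0))) (fun t => u (Q' (t, 0))) 0 1 C).
  rewrite subr0 normr1 mulr1; apply => t; rewrite subr0 => t1; split.
    by have /is_derive_slice_x := du t.
  by apply: le_trans (un _) (bQ t _).
rewrite -Q1 -Q0 {1}/norm1c cReD cImD cReN cImN.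
have k1 := key (@complex.Re R) (fun t => (dQ (t, 0)).1.1) (fun w => _).
have k2 := key (@complex.Im R) (fun t => (dQ (t, 0)).1.2) (fun w => _).
apply: (@le_trans _ _ (C + C)); last by rewrite /C; lra.
apply: lerD; [apply: k1|apply: k2] => w; rewrite /norm1c.
  by rewrite lerDl.
by rewrite lerDr.
Qed.

Lemma exp_poly_cvg L : norm1c (exp_poly L n.+1 - cexp L) @[n --> \oo] --> (0 : R).
Proof.
pose K := norm1c (cexp L) * (4 * expR `|complex.Re L| * norm1c L).
have c0 : K * (exp_coeff (norm1c L) n) @[n --> \oo] --> K * 0.
  apply: cvgM; first exact: cvg_cst.
  exact: cvg_series_cvg_0 (is_cvg_series_exp_coeff _).
rewrite mulr0 in c0.
apply: (@squeeze_cvgr _ _ _ _ (fun=> 0) _ _ _ 0 _ c0); last exact: cvg_cst.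
apply: nearW => n; rewrite norm1c_ge0 /=.
have -> : exp_poly L n.+1 - cexp L = cexp L * (cexp (- L) * exp_poly L n.+1 - 1).
  by rewrite mulrBr mulrA cexpN mul1r mulr1.
apply: le_trans (norm1cM _ _) _; rewrite /K -mulrA ler_wpM2l ?norm1c_ge0//.
exact: exp_poly_remainder.
Qed.

Lemma cexp_series L :
  (series (fun n => n`!%:R^-1 * complex.Re (L ^+ n)) @ \oo --> complex.Re (cexp L)) /\
  (series (fun n => n`!%:R^-1 * complex.Im (L ^+ n)) @ \oo --> complex.Im (cexp L)).
Proof.
have reE n : complex.Re (exp_poly L n) = series (fun n => n`!%:R^-1 * complex.Re (L ^+ n)) n.
  rewrite /series /= big_mkord /exp_poly; elim: n => [|n IH]; first by rewrite !big_ord0.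
  by rewrite !big_ord_recr /= cReD IH cReM /= mul0r subr0.
have imE n : complex.Im (exp_poly L n) = series (fun n => n`!%:R^-1 * complex.Im (L ^+ n)) n.
  rewrite /series /= big_mkord /exp_poly; elim: n => [|n IH]; first by rewrite !big_ord0.
  by rewrite !big_ord_recr /= cImD IH cImM /= mul0r addr0.
have c := exp_poly_cvg L.
split; rewrite -cvg_shiftS; apply/cvgrPdist_le => e e0.
  move/cvgrPdist_le : c => /(_ e e0); apply: filterS => n.
  rewrite /= sub0r normrN ger0_norm ?norm1c_ge0// -reE distrC.
  by apply: le_trans; rewrite /norm1c cReD cReN lerDl.
move/cvgrPdist_le : c => /(_ e e0); apply: filterS => n.
rewrite /= sub0r normrN ger0_norm ?norm1c_ge0// -imE distrC.
by apply: le_trans; rewrite /norm1c cImD cImN lerDr.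
Qed.

End ExpSeries.

(** * Slices and stem functions *)

Section Stems.
Variable R : realType.
Notation H := (quat R).
Implicit Types (z v : R * R) (D : set (R * R)) (Omega : set H) (I J : H).

(** The square of an imaginary unit has no vector part, so twice the product of its
    real part by its vector part is zero; a nonzero real part would make the
    square a nonnegative real number. *)
Lemma imag_unitP I : imag_unit I ->
  q_re I = 0 /\ q_i I ^+ 2 + q_j I ^+ 2 + q_k I ^+ 2 = 1.
Proof.
rewrite /imag_unit /= => II.
have e0 := congr1 (@q_re R) II; have e1 := congr1 (@q_i R) II.
have e2 := congr1 (@q_j R) II; have e3 := congr1 (@q_k R) II.
move: e0 e1 e2 e3; rewrite !quatE => e0 e1 e2 e3.
have [r0|r0] := eqVneq (q_re I) 0; first by split=> //; rewrite r0 in e0; nra.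
exfalso.
have h x : q_re I * x + x * q_re I = 0 -> x = 0.
  rewrite (mulrC x) -mulr2n => /eqP; rewrite mulrn_eq0 /= mulf_eq0 (negbTE r0) => /eqP//.
have i0 : q_i I = 0 by apply: h; lra.
have j0 : q_j I = 0 by apply: h; lra.
have k0 : q_k I = 0 by apply: h; lra.
rewrite i0 j0 k0 in e0; have := sqr_ge0 (q_re I); nra.
Qed.

Lemma imag_unitN I : imag_unit I -> imag_unit (- I).
Proof. by rewrite /imag_unit /= mulrNN. Qed.

Lemma imag_unit_qI : imag_unit (qI : H).
Proof. by rewrite /imag_unit /=; apply: quat_eq; rewrite /qI !quatE; ring. Qed.

Definition slice_pt I z : H := z.1%:A + z.2 *: I.

Lemma slice_ptE I z : imag_unit I ->
  [/\ q_re (slice_pt I z) = z.1, q_i (slice_pt I z) = z.2 * q_i I,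
      q_j (slice_pt I z) = z.2 * q_j I & q_k (slice_pt I z) = z.2 * q_k I].
Proof.
move=> /imag_unitP[I0 _]; rewrite /slice_pt !quatE I0; split; ring.
Qed.

Lemma norm_vec_slice_pt I z : imag_unit I -> norm_vec (slice_pt I z) = `|z.2|.
Proof.
move=> II; have [_ e1 e2 e3] := slice_ptE z II; have [_ n1] := imag_unitP II.
by rewrite /norm_vec e1 e2 e3 !exprMn -!mulrDr n1 mulr1 sqrtr_sqr.
Qed.

Lemma circular_slice_pt Omega I J z : circular Omega -> imag_unit I -> imag_unit J ->
  Omega (slice_pt I z) -> Omega (slice_pt J z).
Proof.
move=> circ II JJ Oz; have [e0 _ _ _] := slice_ptE z II.
have S K : imag_unit K -> Omega (z.1%:A + `|z.2| *: K).
  move=> KK; apply: (circ _ Oz); exists K => //.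
  by rewrite e0 norm_vec_slice_pt.
have [z0|z0] := leP 0 z.2; first by have := S J JJ; rewrite ger0_norm.
by have := S _ (imag_unitN JJ); rewrite ltr0_norm// scalerN scaleNr opprK.
Qed.

(** By circularity all imaginary units give the same planar domain. *)
Lemma planarP Omega z : circular Omega ->
  planar Omega z <-> forall I, imag_unit I -> Omega (slice_pt I z).
Proof.
move=> circ; split => [[J JJ Oz] I II|OI]; first exact: circular_slice_pt JJ II Oz.
by exists qI; [exact: imag_unit_qI|apply: OI; exact: imag_unit_qI].
Qed.

Definition zconj z : R * R := (z.1, - z.2).

Lemma slice_pt_conj I z : slice_pt I (zconj z) = slice_pt (- I) z.
Proof. by rewrite /slice_pt /= scaleNr scalerN. Qed.

Lemma planar_conj Omega z : circular Omega -> planar Omega z -> planar Omega (zconj z).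
Proof.
move=> circ /(planarP _ circ) Oz; apply/(planarP _ circ) => I II.
by rewrite slice_pt_conj; apply: Oz; exact: imag_unitN.
Qed.

Lemma slice_pt_continuous I : continuous (slice_pt I).
Proof.
move=> z; apply: cvgD; apply: cvgZr_tmp || apply: cvgZl_tmp.
  exact: cvg_fst.
exact: cvg_snd.
Qed.

Lemma open_planar Omega : circular Omega -> open Omega -> open (planar Omega).
Proof.
move=> circ oO; have -> : planar Omega = slice_pt qI @^-1` Omega.
  apply/seteqP; split => z /=.
    by move/(planarP _ circ); apply; exact: imag_unit_qI.
  by move=> ?; exists qI => //; exact: imag_unit_qI.
by apply: open_comp => // z _; exact: slice_pt_continuous.
Qed.

(** The four coordinates [q_re], [q_i], [q_j], [q_k] are [coord 0] to [coord 3]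
    by definition. *)
Definition coord (k : nat) (q : H) : R := q ord0 (inord k).

Lemma coord_cvg k (q : H) : coord k p @[p --> q] --> coord k q.
Proof. exact: (@coord_continuous R 1 4 ord0 (inord k)). Qed.

Lemma derivable_coord (F : R * R -> H) z v k : derivable F z v ->
  derivable (fun t => coord k (F t)) z v /\
  'D_v (fun t => coord k (F t)) z = coord k ('D_v F z).
Proof.
move=> dF; have dF' : derivable (F : R * R -> 'rV[R]_4) z v := dF.
split; first by move/derivable_mxP : dF'; apply.
have := derive_mx dF'.
move=> e; rewrite /coord.
by have -> : 'D_v F z = 'D_v (F : R * R -> 'rV[R]_4) z by []; rewrite e mxE.
Qed.

Lemma C1_on_coord D (F : R * R -> H) k v z : open D -> C1_on D F ->
  v = (1, 0) \/ v = (0, 1) -> D z ->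
  is_derive z v (fun t => coord k (F t)) (coord k ('D_v F z)) /\
  coord k ('D_v F t) @[t --> z] --> coord k ('D_v F z).
Proof.
move=> oD CF hv Dz; have [dF cF] := CF v hv z Dz.
have [dk ek] := derivable_coord k dF.
split; first by split.
apply: (@cvg_comp _ _ _ ('D_v F) (coord k) _ (nbhs ('D_v F z))); first exact: cF.
exact: coord_cvg.
Qed.

(** A pair of stem functions with quaternion values is the same as four functions
    with complex values. *)
Definition stem_coord (F0 F1 : R * R -> H) k z : complex R :=
  Complex (coord k (F0 z)) (coord k (F1 z)).

Lemma coordN k (q : H) : coord k (- q) = - coord k q.
Proof. by rewrite /coord mxE. Qed.

Lemma stem_coord_hol D F0 F1 k : open D -> slice_regular_stem D F0 F1 ->
  hol D (stem_coord F0 F1 k).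
Proof.
move=> oD [[C0 C1] _ _ CR1 CR2].
exists (fun z => Complex (coord k ('D_(1, 0) F0 z)) (coord k ('D_(1, 0) F1 z))) => z Dz.
have v1 : ((1, 0) : R * R) = (1, 0) \/ ((1, 0) : R * R) = (0, 1) by left.
have v2 : ((0, 1) : R * R) = (1, 0) \/ ((0, 1) : R * R) = (0, 1) by right.
have [d01 c01] := C1_on_coord k oD C0 v1 Dz.
have [d11 c11] := C1_on_coord k oD C1 v1 Dz.
have [d02 _] := C1_on_coord k oD C0 v2 Dz.
have [d12 _] := C1_on_coord k oD C1 v2 Dz.
split; last by split.
split; first by split.
split.
  by rewrite cReM /= mul0r mul1r sub0r -coordN -CR2.
by rewrite cImM /= mul0r mul1r add0r CR1.
Qed.

Lemma QuatE (a b c d : R) : Quat a b c d = a%:A + b *: qI + c *: qJ + d *: qK.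
Proof. by apply: quat_eq; rewrite /qI /qJ /qK !quatE; ring. Qed.

Lemma is_derive_Quat (a b c d : R * R -> R) z v (a' b' c' d' : R) :
  is_derive z v a a' -> is_derive z v b b' -> is_derive z v c c' ->
  is_derive z v d d' ->
  is_derive z v (fun t => Quat (a t) (b t) (c t) (d t) : H) (Quat a' b' c' d').
Proof.
move=> da db dc dd.
pose F t : 'rV[R]_4 := Quat (a t) (b t) (c t) (d t).
have key (j : 'I_4) : is_derive z v (fun t => F t ord0 j) ((Quat a' b' c' d' : 'rV[R]_4) ord0 j).
  rewrite /F; under eq_fun do rewrite mxE; rewrite mxE.
  by case: j => -[|[|[|[|]]]].
have dF : derivable F z v.
  by apply/derivable_mxP => i j; rewrite ord1; case: (key j).
split; first exact: dF.
transitivity ('D_v F z); first by [].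
rewrite derive_mx//; apply/matrixP => i j; rewrite mxE ord1.
by case: (key j).
Qed.

Lemma cvg_Quat (T : Type) (F : set_system T) {FF : Filter F}
    (a b c d : T -> R) (a' b' c' d' : R) :
  a @ F --> a' -> b @ F --> b' -> c @ F --> c' -> d @ F --> d' ->
  (Quat (a t) (b t) (c t) (d t) : H) @[t --> F] --> (Quat a' b' c' d' : H).
Proof.
move=> ca cb cc cd; rewrite QuatE; under eq_fun do rewrite QuatE.
by apply: cvgD; [apply: cvgD; [apply: cvgD|]|]; apply: cvgZr_tmp.
Qed.

Lemma C1_on_Quat D (a b c d : R * R -> R) (a' b' c' d' : R * R -> R * R -> R) :
  open D ->
  (forall v, v = (1, 0) \/ v = (0, 1) -> forall z, D z ->
    [/\ is_derive z v a (a' v z), is_derive z v b (b' v z),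
        is_derive z v c (c' v z) & is_derive z v d (d' v z)] /\
    [/\ a' v t @[t --> z] --> a' v z, b' v t @[t --> z] --> b' v z,
        c' v t @[t --> z] --> c' v z & d' v t @[t --> z] --> d' v z]) ->
  C1_on D (fun t => Quat (a t) (b t) (c t) (d t) : H).
Proof.
move=> oD Hd v hv z Dz.
have dQ t : D t -> is_derive t v (fun t => Quat (a t) (b t) (c t) (d t) : H)
    (Quat (a' v t) (b' v t) (c' v t) (d' v t)).
  by move=> Dt; have [[? ? ? ?] _] := Hd v hv t Dt; exact: is_derive_Quat.
have [_ [ca cb cc cd]] := Hd v hv z Dz.
split; first by case: (dQ z Dz).
rewrite /prop_for /continuous_at; have [_ ->] := dQ z Dz.
have nD : nbhs z D by exact: open_nbhs_nbhs.
apply: cvg_trans (cvg_Quat ca cb cc cd).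
apply: near_eq_cvg; apply: filterS nD => t /dQ[_ ->]//.
Qed.

Definition conj_sym D (c : R * R -> complex R) :=
  forall z, D z -> c (zconj z) = conjc (c z).

(** Conversely, four holomorphic functions make a stem; the two directions [v] are
    treated together, [toC v] being 1 or the imaginary unit. *)
Lemma stem_of_hol D (c0 c1 c2 c3 : R * R -> complex R) : open D ->
  hol D c0 -> hol D c1 -> hol D c2 -> hol D c3 ->
  conj_sym D c0 -> conj_sym D c1 -> conj_sym D c2 -> conj_sym D c3 ->
  slice_regular_stem D
    (fun z => Quat (complex.Re (c0 z)) (complex.Re (c1 z)) (complex.Re (c2 z)) (complex.Re (c3 z)))
    (fun z => Quat (complex.Im (c0 z)) (complex.Im (c1 z)) (complex.Im (c2 z)) (complex.Im (c3 z))).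
Proof.
move=> oD [d0 H0] [d1 H1] [d2 H2] [d3 H3] s0 s1 s2 s3.
have key (c d : R * R -> complex R) v z : (forall z, D z -> cdiff c z (d z) /\ ccont d z) ->
    v = (1, 0) \/ v = (0, 1) -> D z ->
    cderive c z v (toC v * d z) /\ ccont (fun t => toC v * d t) z.
  move=> Hc hv Dz; have [[dx dy] cd] := Hc z Dz.
  split; last by apply: ccontM => //; exact: ccont_cst.
  by case: hv => ->; rewrite -?[toC (1, 0)]/1 ?mul1r.
have dv1 c d z : (forall z, D z -> cdiff c z (d z) /\ ccont d z) -> D z ->
    is_derive z (1, 0) (fun t => complex.Re (c t)) (complex.Re (d z)) /\
    is_derive z (1, 0) (fun t => complex.Im (c t)) (complex.Im (d z)).
  by move=> Hc Dz; have [[dx _] _] := Hc z Dz.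
have dv2 c d z : (forall z, D z -> cdiff c z (d z) /\ ccont d z) -> D z ->
    is_derive z (0, 1) (fun t => complex.Re (c t)) (- complex.Im (d z)) /\
    is_derive z (0, 1) (fun t => complex.Im (c t)) (complex.Re (d z)).
  move=> Hc Dz; have [[_ [dr di]] _] := Hc z Dz; move: dr di.
  by rewrite cReM cImM /= !mul0r !mul1r sub0r add0r.
split.
- split.
    apply: (@C1_on_Quat D _ _ _ _ (fun v z => complex.Re (toC v * d0 z))
      (fun v z => complex.Re (toC v * d1 z)) (fun v z => complex.Re (toC v * d2 z))
      (fun v z => complex.Re (toC v * d3 z))) => // v hv z Dz.
    have [[? _] [? _]] := key _ _ _ _ H0 hv Dz; have [[? _] [? _]] := key _ _ _ _ H1 hv Dz.
    by have [[? _] [? _]] := key _ _ _ _ H2 hv Dz; have [[? _] [? _]] := key _ _ _ _ H3 hv Dz.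
  apply: (@C1_on_Quat D _ _ _ _ (fun v z => complex.Im (toC v * d0 z))
    (fun v z => complex.Im (toC v * d1 z)) (fun v z => complex.Im (toC v * d2 z))
    (fun v z => complex.Im (toC v * d3 z))) => // v hv z Dz.
  have [[_ ?] [_ ?]] := key _ _ _ _ H0 hv Dz; have [[_ ?] [_ ?]] := key _ _ _ _ H1 hv Dz.
  by have [[_ ?] [_ ?]] := key _ _ _ _ H2 hv Dz; have [[_ ?] [_ ?]] := key _ _ _ _ H3 hv Dz.
- by move=> z Dz; rewrite -/(zconj z) s0// s1// s2// s3// !cRe_conj.
- move=> z Dz; rewrite -/(zconj z) s0// s1// s2// s3// !cIm_conj.
  by apply: quat_eq; rewrite !quatE.
- move=> z Dz.
  have [a0 _] := dv1 _ _ _ H0 Dz; have [a1 _] := dv1 _ _ _ H1 Dz.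
  have [a2 _] := dv1 _ _ _ H2 Dz; have [a3 _] := dv1 _ _ _ H3 Dz.
  have [_ b0] := dv2 _ _ _ H0 Dz; have [_ b1] := dv2 _ _ _ H1 Dz.
  have [_ b2] := dv2 _ _ _ H2 Dz; have [_ b3] := dv2 _ _ _ H3 Dz.
  have [_ ->] := is_derive_Quat a0 a1 a2 a3.
  by have [_ ->] := is_derive_Quat b0 b1 b2 b3.
- move=> z Dz.
  have [_ a0] := dv1 _ _ _ H0 Dz; have [_ a1] := dv1 _ _ _ H1 Dz.
  have [_ a2] := dv1 _ _ _ H2 Dz; have [_ a3] := dv1 _ _ _ H3 Dz.
  have [b0 _] := dv2 _ _ _ H0 Dz; have [b1 _] := dv2 _ _ _ H1 Dz.
  have [b2 _] := dv2 _ _ _ H2 Dz; have [b3 _] := dv2 _ _ _ H3 Dz.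
  have [_ ->] := is_derive_Quat a0 a1 a2 a3.
  have [_ ->] := is_derive_Quat b0 b1 b2 b3.
  by apply: quat_eq; rewrite !quatE.
Qed.

End Stems.

(** * The star product on stem functions *)

Section SliceAlgebra.
Variable R : realType.
Notation H := (quat R).
Notation C := (complex R).
Implicit Types (z v : R * R) (D E : set (R * R)) (Omega : set H) (I J q : H).

Definition stem_val (a0 a1 a2 a3 : C) I : H :=
  Quat (complex.Re a0) (complex.Re a1) (complex.Re a2) (complex.Re a3) +
  I * Quat (complex.Im a0) (complex.Im a1) (complex.Im a2) (complex.Im a3).

Lemma slice_polar q : exists I z, imag_unit I /\ q = slice_pt I z.
Proof.
have S0 : 0 <= q_i q ^+ 2 + q_j q ^+ 2 + q_k q ^+ 2 by rewrite !addr_ge0 ?sqr_ge0.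
have n2 : norm_vec q ^+ 2 = q_i q ^+ 2 + q_j q ^+ 2 + q_k q ^+ 2 by rewrite sqr_sqrtr.
have [n0|n0] := eqVneq (norm_vec q) 0.
  exists qI, (q_re q, 0); split; first exact: imag_unit_qI.
  move: n2; rewrite n0 expr0n /= => /esym/eqP.
  rewrite !paddr_eq0 ?addr_ge0 ?sqr_ge0// !sqrf_eq0 => /andP[/andP[/eqP i0 /eqP j0] /eqP k0].
  by rewrite /slice_pt /=; apply: quat_eq; rewrite !quatE ?i0 ?j0 ?k0; ring.
exists ((norm_vec q)^-1 *: (q - (q_re q)%:A)), (q_re q, norm_vec q); split; last first.
  by rewrite /slice_pt /= scalerA mulfV// scale1r subrKC.
move: n0 n2; move: (norm_vec q) => n n0 n2.
have e : n ^+ 2 != 0 by rewrite expf_neq0.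
rewrite /imag_unit /=; apply: quat_eq; rewrite !quatE; last by ring.
  transitivity (- (q_i q ^+ 2 + q_j q ^+ 2 + q_k q ^+ 2) / n ^+ 2); first by field.
  by rewrite -n2 mulNr divff.
all: by ring.
Qed.

(** The values at two opposite units give the two parts separately. *)
Lemma stem_val_eq0 (a0 a1 a2 a3 : C) : (forall I, imag_unit I -> stem_val a0 a1 a2 a3 I = 0) ->
  [/\ a0 = 0, a1 = 0, a2 = 0 & a3 = 0].
Proof.
move=> h; have h1 := h _ (imag_unit_qI R); have h2 := h _ (imag_unitN (imag_unit_qI R)).
have e0 : Quat (complex.Re a0) (complex.Re a1) (complex.Re a2) (complex.Re a3) = 0 :> H.
  apply: (scalerI (a := 2)); first by rewrite pnatr_eq0.
  rewrite scaler0 -[RHS](addr0 0) -{1}h1 -h2 /stem_val mulNr addrACA subrr addr0.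
  by rewrite scaler_nat mulr2n.
have e1 : Quat (complex.Im a0) (complex.Im a1) (complex.Im a2) (complex.Im a3) = 0 :> H.
  move: h1; rewrite /stem_val e0 add0r => h1.
  by rewrite -[LHS]mul1r -[1]opprK -[-1](imag_unit_qI R) mulNr -mulrA h1 mulr0 oppr0.
move: (congr1 (@q_re R) e0) (congr1 (@q_i R) e0) (congr1 (@q_j R) e0) (congr1 (@q_k R) e0).
move: (congr1 (@q_re R) e1) (congr1 (@q_i R) e1) (congr1 (@q_j R) e1) (congr1 (@q_k R) e1).
by rewrite !quatE => *; split; apply: complexP.
Qed.

Lemma stem_coordE (F0 F1 : R * R -> H) I z : F0 z + I * F1 z =
  stem_val (stem_coord F0 F1 0 z) (stem_coord F0 F1 1 z) (stem_coord F0 F1 2 z)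
    (stem_coord F0 F1 3 z) I.
Proof. by rewrite /stem_val; congr (_ + _ * _); apply: quat_eq; rewrite !quatE. Qed.

(** Conjugation of [slice_pt I z] by a nonzero [p = f (slice_pt I z)] changes the
    unit [I] to [J = p^-1 * I * p], another imaginary unit, and [p * J = I * p]
    moves the unit back to the left.  The outcome is the product of quaternions
    with complex coefficients. *)
Lemma star_stem Omega (f h : H -> H) (a0 a1 a2 a3 b0 b1 b2 b3 : C) z :
  circular Omega -> planar Omega z ->
  (forall I, imag_unit I -> f (slice_pt I z) = stem_val a0 a1 a2 a3 I) ->
  (forall I, imag_unit I -> h (slice_pt I z) = stem_val b0 b1 b2 b3 I) ->
  forall I, imag_unit I -> star f h (slice_pt I z) = stem_val
    (a0 * b0 - a1 * b1 - a2 * b2 - a3 * b3) (a0 * b1 + a1 * b0 + a2 * b3 - a3 * b2)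
    (a0 * b2 - a1 * b3 + a2 * b0 + a3 * b1) (a0 * b3 + a1 * b2 - a2 * b1 + a3 * b0) I.
Proof.
move=> circ Dz fE hE I II; have fI := fE I II.
have Hprod : stem_val
    (a0 * b0 - a1 * b1 - a2 * b2 - a3 * b3) (a0 * b1 + a1 * b0 + a2 * b3 - a3 * b2)
    (a0 * b2 - a1 * b3 + a2 * b0 + a3 * b1) (a0 * b3 + a1 * b2 - a2 * b1 + a3 * b0) I =
    f (slice_pt I z) * Quat (complex.Re b0) (complex.Re b1) (complex.Re b2) (complex.Re b3) +
    I * f (slice_pt I z) * Quat (complex.Im b0) (complex.Im b1) (complex.Im b2) (complex.Im b3).
  have key (X0 X1 Y0 Y1 : H) : (X0 + I * X1) * Y0 + I * (X0 + I * X1) * Y1 =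
      (X0 * Y0 - X1 * Y1) + I * (X1 * Y0 + X0 * Y1).
    rewrite !(mulrDl, mulrDr, mulrA) II mulN1r mulNr [I * X0 * Y1 + _]addrC.
    by rewrite addrACA.
  rewrite fI /stem_val key; congr (_ + _ * _).
    by apply: quat_eq; rewrite !quatE !(cReD, cReN, cReM); ring.
  by apply: quat_eq; rewrite !quatE !(cImD, cImN, cImM); ring.
rewrite Hprod /star; set p := f (slice_pt I z); case: eqP => [->|/eqP p0].
  by rewrite mulr0 !mul0r addr0.
have pu : p \is a GRing.unit by [].
pose J := p^-1 * I * p.
have JJ : imag_unit J.
  by rewrite /imag_unit /= /J -!mulrA (mulrA p) divrr// mul1r (mulrA I) II mulN1r mulrN mulVr.
have -> : p^-1 * slice_pt I z * p = slice_pt J z.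
  rewrite /slice_pt mulrDr mulrDl; congr (_ + _).
    by rewrite -scalerAr mulr1 -scalerAl mulVr.
  by rewrite -scalerAr -scalerAl.
rewrite hE// /stem_val mulrDr; congr (_ + _).
by rewrite /J !mulrA divrr// mul1r.
Qed.

End SliceAlgebra.

(** * Zero divisors *)

Section ZeroDivisors.
Variable R : realType.
Notation H := (quat R).
Notation C := (complex R).
Implicit Types (z v : R * R) (D E : set (R * R)) (Omega : set H) (I J q : H).

(** The components of slice preserving functions; such functions are usually called
    intrinsic. *)
Definition intrinsic D c := hol D c /\ conj_sym D c.

Definition real_stem Omega (f : H -> H) (c : R * R -> C) :=
  intrinsic (planar Omega) c /\ forall z I, planar Omega z -> imag_unit I ->
    f (slice_pt I z) = (complex.Re (c z))%:A + complex.Im (c z) *: I.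

Lemma stem_coord_conj_sym D F0 F1 k : slice_regular_stem D F0 F1 ->
  conj_sym D (@stem_coord R F0 F1 k).
Proof.
move=> [_ e0 e1 _ _] z Dz; rewrite /stem_coord /zconj e0// e1// coordN//.
Qed.

Lemma stem_value Omega f F0 F1 : circular Omega ->
  (forall I, imag_unit I -> forall a b : R, Omega (a%:A + b *: I) ->
    f (a%:A + b *: I) = F0 (a, b) + I * F1 (a, b)) ->
  forall z I, planar Omega z -> imag_unit I -> f (slice_pt I z) = F0 z + I * F1 z.
Proof.
move=> circ fE [a b] I /(planarP _ circ) Dz II; apply: fE => //; exact: Dz.
Qed.

(** The stem functions of a slice preserving function take values in every
    [slice J], and two different slices meet in the real numbers only. *)
Lemma slice_preserving_stem Omega (f : H -> H) : open Omega -> circular Omega ->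
  slice_preserving Omega f -> exists c, real_stem Omega f c.
Proof.
move=> oO circ [[F0 [F1 [st fE]]] fS].
have oD := open_planar circ oO.
have fv := stem_value circ fE.
exists (stem_coord F0 F1 0); split.
  by split; [exact: stem_coord_hol|exact: stem_coord_conj_sym].
move=> z I Dz II.
have [_ s0 s1 _ _] := st.
have inS J : imag_unit J -> slice J (F0 z) /\ slice J (J * F1 z).
  move=> JJ.
  have sl w : planar Omega w -> slice J (f (slice_pt J w)).
    move=> Dw; apply: (fS J JJ); exists (slice_pt J w) => //; split.
      by move/(planarP _ circ) : Dw; apply.
    by exists w.1, w.2.
  have [a [b e]] := sl z Dz; have [a' [b' e']] := sl _ (planar_conj circ Dz).
  rewrite (fv _ _ Dz JJ) in e.
  rewrite (fv _ _ (planar_conj circ Dz) JJ) (s0 z Dz) (s1 z Dz) mulrN in e'.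
  split; [exists ((a + a') / 2), ((b + b') / 2)|exists ((a - a') / 2), ((b - b') / 2)].
    have -> : F0 z = 2^-1 *: ((F0 z + J * F1 z) + (F0 z - J * F1 z)).
      by apply: quat_eq; rewrite !quatE; field.
    by rewrite e e'; apply: quat_eq; rewrite !quatE; ring.
  have -> : J * F1 z = 2^-1 *: ((F0 z + J * F1 z) - (F0 z - J * F1 z)).
    by apply: quat_eq; rewrite !quatE; field.
  by rewrite e e'; apply: quat_eq; rewrite !quatE; ring.
have qJJ : imag_unit (qJ : H).
  by rewrite /imag_unit /=; apply: quat_eq; rewrite /qJ !quatE; ring.
have real (X : H) : slice qI X -> slice qJ X -> X = (coord 0 X)%:A.
  move=> [a [b e]] [a' [b' e']].
  apply: quat_eq; rewrite ?quatE.
  - by rewrite mulr1.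
  - by rewrite mulr0 e' /qJ !quatE; ring.
  - by rewrite mulr0 e /qI !quatE; ring.
  - by rewrite mulr0 e /qI !quatE; ring.
have inS1 J : imag_unit J -> slice J (F1 z).
  move=> JJ; have [_ [a [b e]]] := inS J JJ; exists b, (- a).
  have -> : F1 z = - (J * (J * F1 z)) by rewrite mulrA JJ mulN1r opprK.
  by rewrite e mulrDr -!scalerAr mulr1 JJ scalerN opprD opprK scaleNr addrC.
have iI := imag_unit_qI R.
have r0 := real _ (inS _ iI).1 (inS _ qJJ).1.
have r1 := real _ (inS1 _ iI) (inS1 _ qJJ).
by rewrite fv//= {1}r0 {1}r1 -scalerAr mulr1.
Qed.

Lemma vector_part_stem Omega (f fv : H -> H) : open Omega -> circular Omega ->
  is_vector_part Omega f fv -> exists c0 c1 c2 c3 : R * R -> C,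
  [/\ intrinsic (planar Omega) c0, intrinsic (planar Omega) c1,
      intrinsic (planar Omega) c2 & intrinsic (planar Omega) c3] /\
  forall z I, planar Omega z -> imag_unit I ->
    f (slice_pt I z) = stem_val (c0 z) (c1 z) (c2 z) (c3 z) I /\
    fv (slice_pt I z) = stem_val 0 (c1 z) (c2 z) (c3 z) I.
Proof.
move=> oO circ [f0 [f1 [f2 [f3 [[p0 p1 p2 p3] fE fvE]]]]].
have [c0 [h0 e0]] := slice_preserving_stem oO circ p0.
have [c1 [h1 e1]] := slice_preserving_stem oO circ p1.
have [c2 [h2 e2]] := slice_preserving_stem oO circ p2.
have [c3 [h3 e3]] := slice_preserving_stem oO circ p3.
exists c0, c1, c2, c3; split; first by split.
move=> z I Dz II; have Oz : Omega (slice_pt I z) by move/(planarP _ circ) : Dz; exact.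
have fz := fE _ Oz; rewrite e0// e1// e2// e3// in fz.
have I0 := (imag_unitP II).1.
split; first by rewrite fz /stem_val; apply: quat_eq; rewrite /qI /qJ /qK !quatE; ring.
by rewrite fvE// fz e0// /stem_val; apply: quat_eq; rewrite /qI /qJ /qK !quatE; ring.
Qed.

(** Both products of the vector [(c1, c2, c3)] with a quaternion are treated at
    once: [e] is the sign of the cross product.  The equations say that the product
    is zero; another multiplication by the vector gives the multiple by [s]. *)
Lemma vector_mul_eq0 (c1 c2 c3 b0 b1 b2 b3 : C) (e : C) : (e = 1 \/ e = -1) ->
  c1 * b1 + c2 * b2 + c3 * b3 = 0 ->
  c1 * b0 + e * (c2 * b3 - c3 * b2) = 0 ->
  c2 * b0 + e * (c3 * b1 - c1 * b3) = 0 ->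
  c3 * b0 + e * (c1 * b2 - c2 * b1) = 0 ->
  let s := c1 ^+ 2 + c2 ^+ 2 + c3 ^+ 2 in
  [/\ s * b0 = 0, s * b1 = 0, s * b2 = 0 & s * b3 = 0].
Proof.
move=> he q0 q1 q2 q3 s; have e2 : e * e = 1 by case: he => ->; rewrite ?mulr1// mulrNN mulr1.
split.
- transitivity (c1 * (c1 * b0 + e * (c2 * b3 - c3 * b2)) + c2 * (c2 * b0 + e * (c3 * b1 - c1 * b3))
    + c3 * (c3 * b0 + e * (c1 * b2 - c2 * b1))); first by rewrite /s; ring.
  by rewrite q1 q2 q3 !mulr0 !addr0.
- transitivity (c1 * (c1 * b1 + c2 * b2 + c3 * b3)
    + e * (c3 * (c2 * b0 + e * (c3 * b1 - c1 * b3)) - c2 * (c3 * b0 + e * (c1 * b2 - c2 * b1)))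
    + (1 - e * e) * ((c3 ^+ 2 + c2 ^+ 2) * b1 - c1 * (c2 * b2 + c3 * b3))); first by rewrite /s; ring.
  by rewrite q0 q2 q3 e2 !mulr0 subrr mulr0 subrr mul0r !addr0.
- transitivity (c2 * (c1 * b1 + c2 * b2 + c3 * b3)
    + e * (c1 * (c3 * b0 + e * (c1 * b2 - c2 * b1)) - c3 * (c1 * b0 + e * (c2 * b3 - c3 * b2)))
    + (1 - e * e) * ((c3 ^+ 2 + c1 ^+ 2) * b2 - c2 * (c1 * b1 + c3 * b3))); first by rewrite /s; ring.
  by rewrite q0 q1 q3 e2 !mulr0 subrr mulr0 subrr mul0r !addr0.
- transitivity (c3 * (c1 * b1 + c2 * b2 + c3 * b3)
    + e * (c2 * (c1 * b0 + e * (c2 * b3 - c3 * b2)) - c1 * (c2 * b0 + e * (c3 * b1 - c1 * b3)))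
    + (1 - e * e) * ((c2 ^+ 2 + c1 ^+ 2) * b3 - c3 * (c1 * b1 + c2 * b2))); first by rewrite /s; ring.
  by rewrite q0 q1 q2 e2 !mulr0 subrr mulr0 subrr mul0r !addr0.
Qed.

(** In a product domain the planar domain has two symmetric components and [E] is
    one of them; in a slice domain it is connected and [E] is all of it. *)
Definition half_of E D :=
  [/\ open E, connected E, E `<=` D & forall z, D z -> E z \/ E (zconj z)].

(** [V] is annihilated by the stem [b] of the other factor, so [s] annihilates
    [b] ([vector_mul_eq0]).  Near a point of [E] where [b] is not zero, [s] is
    zero; then [unique_continuation] applies on [E], and symmetry on the rest. *)
Lemma zero_divisor_norm Omega E (fv : H -> H) (c1 c2 c3 : R * R -> C) :
  open Omega -> circular Omega -> half_of E (planar Omega) ->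
  intrinsic (planar Omega) c1 -> intrinsic (planar Omega) c2 ->
  intrinsic (planar Omega) c3 ->
  (forall z I, planar Omega z -> imag_unit I ->
     fv (slice_pt I z) = stem_val 0 (c1 z) (c2 z) (c3 z) I) ->
  zero_divisor Omega fv ->
  forall z, planar Omega z -> c1 z ^+ 2 + c2 z ^+ 2 + c3 z ^+ 2 = 0.
Proof.
move=> oO circ [oE cE ED DE] [h1 s1] [h2 s2] [h3 s3] fvE [_ _ [h [sh hnz zd]]].
have oD := open_planar circ oO.
case: sh => H0 [H1 [st hE]].
have hv := stem_value circ hE.
pose b k := stem_coord H0 H1 k.
have bh k : hol (planar Omega) (b k) by exact: stem_coord_hol.
have bs k : conj_sym (planar Omega) (b k) by exact: stem_coord_conj_sym st.
have hvE z I : planar Omega z -> imag_unit I ->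
    h (slice_pt I z) = stem_val (b 0 z) (b 1 z) (b 2 z) (b 3 z) I.
  by move=> Dz II; rewrite hv// stem_coordE.
pose s z := c1 z ^+ 2 + c2 z ^+ 2 + c3 z ^+ 2.
have sb z : planar Omega z ->
    [/\ s z * b 0 z = 0, s z * b 1 z = 0, s z * b 2 z = 0 & s z * b 3 z = 0].
  move=> Dz; have Oz I : imag_unit I -> Omega (slice_pt I z).
    by move: Dz => /(planarP _ circ); apply.
  case: zd => zd.
    have [q0 q1 q2 q3] := stem_val_eq0 (fun I II => etrans
      (esym (star_stem circ Dz (fun I => fvE z I Dz) (fun I => hvE z I Dz) II)) (zd _ (Oz I II))).
    apply: (@vector_mul_eq0 _ _ _ _ _ _ _ 1); first by left.
    - by rewrite -[LHS]opprK -[RHS]oppr0 -q0; congr (- _); ring.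
    - by rewrite -q1; ring.
    - by rewrite -q2; ring.
    - by rewrite -q3; ring.
  have [q0 q1 q2 q3] := stem_val_eq0 (fun I II => etrans
    (esym (star_stem circ Dz (fun I => hvE z I Dz) (fun I => fvE z I Dz) II)) (zd _ (Oz I II))).
  apply: (@vector_mul_eq0 _ _ _ _ _ _ _ (-1)); first by right.
  - by rewrite -[LHS]opprK -[RHS]oppr0 -q0; congr (- _); ring.
  - by rewrite -q1; ring.
  - by rewrite -q2; ring.
  - by rewrite -q3; ring.
have [k [z0 [k4 Ez0 bz0]]] : exists k z0, [/\ (k < 4)%N, E z0 & b k z0 != 0].
  apply: contrapT => nb.
  have bE0 k z : (k < 4)%N -> E z -> b k z = 0.
    by move=> k4 Ez; apply/eqP; apply: contraT => bz; exfalso; apply: nb; exists k, z.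
  have b0 k z : (k < 4)%N -> planar Omega z -> b k z = 0.
    move=> k4 Dz; have [/bE0->//|Ez] := DE z Dz.
    by apply/eqP; rewrite -conjc_eq0 -bs// bE0.
  apply: hnz => q Oq; have [I [z [II qE]]] := slice_polar q.
  have Dz : planar Omega z by exists I => //; rewrite -/(slice_pt I z) -qE.
  rewrite qE hvE// !b0// /stem_val.
  by apply: quat_eq; rewrite !quatE; ring.
have sbk z : planar Omega z -> s z * b k z = 0.
  by move=> Dz; have [] := sb z Dz; move: k k4 bz0 => [|[|[|[|]]]].
have Dz0 := ED z0 Ez0.
have hs : hol (planar Omega) s.
  by apply: holD => //; [apply: holD => //|]; rewrite /GRing.exp /=; apply: holM.
have s0 z : E z -> s z = 0.
  apply: (unique_continuation oE cE (hol_sub ED hs) Ez0).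
  have cb := cvg_nsq (hol_continuous oD (bh k) Dz0).
  have p : 0 < nsq (b k z0) by rewrite nsq_gt0.
  have nD : nbhs z0 (planar Omega) by exact: open_nbhs_nbhs.
  have n2 : \forall t \near z0, 0 < nsq (b k t).
    move/cvgrPdist_lt : cb => /(_ _ p); apply: filterS => t.
    by rewrite ltr_norml => /andP[_]; lra.
  apply: filterS (filterI nD n2) => t [Dt]; rewrite nsq_gt0 => bt.
  by have /eqP := sbk t Dt; rewrite mulf_eq0 (negbTE bt) orbF => /eqP.
move=> z Dz; rewrite -/(s z); have [/s0//|Ez] := DE z Dz.
by apply/eqP; rewrite -conjc_eq0 !rmorphD !rmorphXn /= -s1// -s2// -s3// -/(s _) s0.
Qed.

End ZeroDivisors.

(** * Real points, units and half planes *)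

Section Transfer.
Variable R : realType.
Notation H := (quat R).
Notation C := (complex R).
Implicit Types (z v : R * R) (D E : set (R * R)) (Omega : set H) (I J q : H).

(** On the real axis the three functions are real, so the sum of their squares
    vanishes only if they do. *)
Lemma sum_squares_real_point D (c1 c2 c3 : R * R -> C) (a : R) :
  open D -> connected D -> D (a, 0) ->
  intrinsic D c1 -> intrinsic D c2 -> intrinsic D c3 ->
  (forall z, D z -> c1 z ^+ 2 + c2 z ^+ 2 + c3 z ^+ 2 = 0) ->
  forall z, D z -> [/\ c1 z = 0, c2 z = 0 & c3 z = 0].
Proof.
move=> oD cD Da [h1 s1] [h2 s2] [h3 s3] ss.
have im0 c x : conj_sym D c -> D (x, 0) -> complex.Im (c (x, 0)) = 0.
  move=> sc Dx; have := congr1 (@complex.Im R) (sc _ Dx).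
  by rewrite cIm_conj /zconj /= oppr0; lra.
have z0 x : D (x, 0) -> [/\ c1 (x, 0) = 0, c2 (x, 0) = 0 & c3 (x, 0) = 0].
  move=> Dx; have := congr1 (@complex.Re R) (ss _ Dx).
  rewrite !expr2 !cReD !cReM !im0// !mulr0 !subr0 /= -!expr2 => /eqP.
  rewrite !paddr_eq0 ?addr_ge0 ?sqr_ge0// !sqrf_eq0 => /andP[/andP[/eqP e1 /eqP e2] /eqP e3].
  by split; apply: complexP => //; exact: im0.
have /nbhs_boxP[r r0 Hr] : nbhs (a, 0) D by exact: open_nbhs_nbhs.
have Dr x : `|x - a| < r -> D (x, 0).
  by move=> xr; apply: Hr => //=; rewrite subrr normr0.
have key c : hol D c -> (forall x, `|x - a| < r -> c (x, 0) = 0) -> forall z, D z -> c z = 0.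
  move=> hc c0; apply: (@unique_continuation _ D c (a, r / 16)) => //.
    by apply: Hr; rewrite /= ?subrr ?normr0 ?subr0 ?gtr0_norm; lra.
  by apply: real_zeros_near_zero => //; apply: hol_sub hc => z [? ?]; exact: Hr.
move=> z Dz; split.
- by apply: (key c1) => // x /Dr/z0[].
- by apply: (key c2) => // x /Dr/z0[].
- by apply: (key c3) => // x /Dr/z0[].
Qed.

(** Suppose that [c0 z = 0], and let [X] and [Y] be the real and imaginary parts of
    the vector with components [c1 z], [c2 z], [c3 z].  By hypothesis they are
    orthogonal and have the same length, so that [X + I * Y = 0] for some
    imaginary unit [I], namely [- X * Y^-1] if [Y] is not zero. *)
Lemma invertible_real_part Omega (g : H -> H) (c0 c1 c2 c3 : R * R -> C) z :
  circular Omega -> planar Omega z ->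
  (forall I, imag_unit I -> g (slice_pt I z) = stem_val (c0 z) (c1 z) (c2 z) (c3 z) I) ->
  (forall q, Omega q -> g q != 0) -> c1 z ^+ 2 + c2 z ^+ 2 + c3 z ^+ 2 = 0 ->
  c0 z != 0.
Proof.
move=> circ Dz gE g0 ss; apply/eqP => c0z.
have Oz I : imag_unit I -> Omega (slice_pt I z) by move: Dz => /(planarP _ circ); apply.
set x1 := complex.Re (c1 z); set x2 := complex.Re (c2 z); set x3 := complex.Re (c3 z).
set y1 := complex.Im (c1 z); set y2 := complex.Im (c2 z); set y3 := complex.Im (c3 z).
have re : x1 ^+ 2 + x2 ^+ 2 + x3 ^+ 2 = y1 ^+ 2 + y2 ^+ 2 + y3 ^+ 2.
  have := congr1 (@complex.Re R) ss.
  by rewrite !expr2 !cReD !cReM /= -/x1 -/x2 -/x3 -/y1 -/y2 -/y3; lra.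
have im : x1 * y1 + x2 * y2 + x3 * y3 = 0.
  have := congr1 (@complex.Im R) ss.
  by rewrite !expr2 !cImD !cImM /= -/x1 -/x2 -/x3 -/y1 -/y2 -/y3; lra.
have gz I : imag_unit I -> g (slice_pt I z) = Quat 0 x1 x2 x3 + I * Quat 0 y1 y2 y3.
  by move=> II; rewrite gE// c0z.
pose n := y1 ^+ 2 + y2 ^+ 2 + y3 ^+ 2.
have [n0|n0] := eqVneq n 0.
  have y0 : [/\ y1 = 0, y2 = 0 & y3 = 0].
    move: n0 => /eqP; rewrite /n !paddr_eq0 ?addr_ge0 ?sqr_ge0// !sqrf_eq0.
    by move=> /andP[/andP[/eqP ? /eqP ?] /eqP ?].
  have x0 : [/\ x1 = 0, x2 = 0 & x3 = 0].
    move: re; rewrite -/n n0 => /eqP; rewrite !paddr_eq0 ?addr_ge0 ?sqr_ge0// !sqrf_eq0.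
    by move=> /andP[/andP[/eqP ? /eqP ?] /eqP ?].
  have iI := imag_unit_qI R; have := g0 _ (Oz _ iI); rewrite gz//.
  case: y0 => -> -> ->; case: x0 => -> -> ->.
  by apply/negP; rewrite negbK; apply/eqP; apply: quat_eq; rewrite !quatE; ring.
(* This is [- X * Y^-1], since [Y^-1 = - n^-1 *: Y]. *)
pose I : H := n^-1 *: (Quat 0 x1 x2 x3 * Quat 0 y1 y2 y3).
have Ire : q_re I = 0 by rewrite /I !quatE; rewrite (_ : _ - _ = 0) ?mulr0//; lra.
have IY : I * Quat 0 y1 y2 y3 = - Quat 0 x1 x2 x3.
  rewrite /I -scalerAl -mulrA.
  have -> : (Quat 0 y1 y2 y3 * Quat 0 y1 y2 y3 : H) = (- n)%:A.
    by apply: quat_eq; rewrite /n !quatE; ring.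
  by rewrite -scalerAr mulr1 scalerA mulrN mulVf// scaleN1r.
have nn : q_i I ^+ 2 + q_j I ^+ 2 + q_k I ^+ 2 = 1.
  have : q_re I ^+ 2 + q_i I ^+ 2 + q_j I ^+ 2 + q_k I ^+ 2 = 1.
    transitivity (n^-1 ^+ 2 * ((x1 ^+ 2 + x2 ^+ 2 + x3 ^+ 2) * n)).
      by rewrite /I /n !quatE; ring.
    by rewrite re -/n; field.
  by rewrite Ire expr0n add0r.
clearbody I.
have II : imag_unit I.
  by rewrite /imag_unit /=; apply: quat_eq; rewrite !quatE !Ire; lra.
by have := g0 _ (Oz _ II); rewrite gz// IY subrr eqxx.
Qed.

Lemma within_comp (S T U : topologicalType) (P : set S) (f : S -> T) (g : T -> U) :
  {within P, continuous f} -> continuous g -> {within P, continuous (g \o f)}.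
Proof.
move=> /subspace_continuousP cf cg; apply/subspace_continuousP => x Px.
by apply: (cvg_comp _ _ (cf x Px)); exact: cg.
Qed.

Lemma simply_connected_transfer (T U : topologicalType) (A : set T) (B : set U)
    (e : U -> T) (k : T -> U) : continuous e -> continuous k ->
  (forall u, B u -> A (e u)) -> (forall t, A t -> B (k t)) -> cancel e k ->
  simply_connected R A -> simply_connected R B.
Proof.
move=> ce ck eA kB ek [pA lA]; split.
  move=> x y Bx By; have [g [[cg Ag] g0 g1]] := pA _ _ (eA _ Bx) (eA _ By).
  exists (k \o g); split; last 2 first.
  - by rewrite /= g0 ek.
  - by rewrite /= g1 ek.
  by split; [exact: within_comp|move=> t /Ag/kB].
move=> g [cg Bg] g01.
have [||F [cF AF F0 F1]] := lA (e \o g).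
- by split; [exact: within_comp|move=> t /Bg/eA].
- by rewrite /= g01.
exists (k \o F); split; first exact: within_comp.
- by move=> s t hs ht; apply: kB; exact: AF.
- by move=> t /F0[/= -> ->]; rewrite !ek.
- by move=> s /F1[/= -> ->]; rewrite !ek.
Qed.

(** The coordinates of a point of [slice I]: the second one is the real part of
    [- q * I]. *)
Definition slice_coord I q : R * R := (q_re q, - q_re (q * I)).

Lemma slice_ptK I : imag_unit I -> cancel (slice_pt I) (slice_coord I).
Proof.
move=> II [a b]; rewrite /slice_coord /slice_pt /=; have [I0 nI] := imag_unitP II.
congr (_, _); rewrite !quatE I0; first by ring.
transitivity (b * (q_i I ^+ 2 + q_j I ^+ 2 + q_k I ^+ 2)); first by ring.
by rewrite nI mulr1.
Qed.

Lemma slice_coord_continuous I : continuous (slice_coord I).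
Proof.
move=> q; apply: (@cvg_pair H R R (nbhs q) (nbhs (q_re q)) (nbhs (- q_re (q * I)))
  _ _ _ (fun q => q_re q) (fun q => - q_re (q * I))); first exact: (@coord_cvg R 0).
have e (p : H) : - q_re (p * I) = - (coord 0 p * q_re I - coord 1 p * q_i I
  - coord 2 p * q_j I - coord 3 p * q_k I) by rewrite q_reM.
rewrite e; under eq_fun do rewrite e.
apply: cvgN; apply: cvgB; [apply: cvgB; [apply: cvgB|]|];
  by apply: cvgM; [exact: coord_cvg|exact: cvg_cst].
Qed.

(** Topological properties of a part of a slice pass to its coordinates; both
    kinds of domains use this, for the whole slice and for a half of it. *)
Lemma planar_half I (E : set (R * R)) (A : set H) :
  imag_unit I -> (forall z, E z <-> A (slice_pt I z)) -> A `<=` slice I ->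
  connected A -> simply_connected R A -> connected E /\ simply_connected R E.
Proof.
move=> II EA AI cA sA.
have kE q : A q -> E (slice_coord I q).
  move=> Aq; have [a [b qE]] := AI q Aq; apply/EA.
  by rewrite qE -/(slice_pt I (a, b)) slice_ptK// /slice_pt /= -qE.
split; last first.
  apply: (simply_connected_transfer (@slice_pt_continuous R I)
    (@slice_coord_continuous I) _ kE (slice_ptK II) sA) => z /EA //.
have -> : E = slice_coord I @` A.
  apply/seteqP; split => [z /EA Az|z [q Aq <-]]; last exact: kE.
  by exists (slice_pt I z) => //; rewrite slice_ptK.
apply: connected_continuous_connected => //; apply: continuous_subspaceT.
exact: slice_coord_continuous.
Qed.

Lemma cexp_conj (w : C) : cexp (conjc w) = conjc (cexp w).
Proof. by apply: complexP; rewrite /= ?cRe_conj ?cIm_conj /= ?cosN ?sinN ?mulrN. Qed.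

Lemma zconjK z : zconj (zconj z) = z.
Proof. by case: z => a b; rewrite /zconj /= opprK. Qed.

Lemma zconj_continuous : continuous (@zconj R).
Proof.
move=> z; apply: (@cvg_pair _ R R (nbhs z) (nbhs z.1) (nbhs (- z.2)) _ _ _
  (fun z => z.1) (fun z => - z.2)); first exact: cvg_fst.
by apply: cvgN; exact: cvg_snd.
Qed.

Lemma cdiff_conj (L : R * R -> C) z w : cdiff L (zconj z) w ->
  cdiff (fun t => conjc (L (zconj t))) z (conjc w).
Proof.
case: z => x y [[d1 d2] [d3 d4]]; move: d3 d4; rewrite cReM cImM /= !mul0r !mul1r sub0r add0r.
move=> d3 d4.
have dN : is_derive y 1 (fun t : R => - t) (-1).
  by apply: is_deriveN.
have flip (u : R * R -> R) d : is_derive (zconj (x, y)) (0, 1) u d ->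
    is_derive (x, y) ((0, 1) : R * R) (fun t => u (zconj t)) (- d).
  move=> /is_derive_slice_y /= du; apply/is_derive_slice_y => /=.
  rewrite -mulrN1; exact: (@is_derive1_comp _ (fun t => u (x, t)) (fun t => - t)).
have flat (u : R * R -> R) d : is_derive (zconj (x, y)) (1, 0) u d ->
    is_derive (x, y) ((1, 0) : R * R) (fun t => u (zconj t)) d.
  by move=> /is_derive_slice_x /= du; apply/is_derive_slice_x.
split; split; rewrite ?cReM ?cImM ?cRe_conj ?cIm_conj /= ?mul0r ?mul1r ?sub0r ?add0r ?opprK;
  under eq_fun do rewrite ?cRe_conj ?cIm_conj.
- exact: flat.
- by apply: is_deriveN_fun; exact: flat.
- have := flip _ _ d3; rewrite opprK//.
- by have := is_deriveN_fun (flip _ _ d4); rewrite opprK.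
Qed.

(** Away from the real axis there is nothing to glue: the two half planes are
    open. *)
Lemma conj_extension D (L : R * R -> C) : open D ->
  (forall z, D z -> z.2 != 0) -> (forall z, D z -> D (zconj z)) ->
  hol (D `&` [set z | 0 < z.2]) L ->
  exists M, intrinsic D M /\ forall z, 0 < z.2 -> M z = L z.
Proof.
move=> oD D0 Dc [L' HL].
pose ext (f : R * R -> C) z := if 0 < z.2 then f z else conjc (f (zconj z)).
exists (ext L); split; last by move=> z z0; rewrite /ext z0.
have Dneg z : D z -> (0 < z.2) = false -> (D `&` [set z | 0 < z.2]) (zconj z).
  move=> Dz /negbT; rewrite -leNgt le_eqVlt (negbTE (D0 z Dz)) /= => z0.
  by split; [exact: Dc|rewrite /= oppr_gt0].
split; last first.
  move=> z Dz; rewrite /ext /= oppr_gt0.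
  have [z0|z0] := ltP 0 z.2; first by rewrite ltNge (ltW z0) /= zconjK.
  by rewrite lt_neqAle z0 (D0 z Dz) /= conjcK.
have n2 z : 0 < z.2 -> \forall t \near z, 0 < t.2.
  move=> z0; apply/nbhs_boxP; exists z.2 => // t _; rewrite ltr_norml => /andP[]; lra.
have n2' z : D z -> (0 < z.2) = false -> \forall t \near z, (0 < t.2) = false.
  move=> Dz z0; have [_ /= zc] := Dneg z Dz z0.
  apply/nbhs_boxP; exists (- z.2) => // t _; rewrite ltr_norml => /andP[? ?].
  by apply/negbTE; rewrite -leNgt; lra.
have near_cdiff (f g : R * R -> C) z w : (\forall t \near z, f t = g t) ->
    cdiff f z w -> cdiff g z w.
  move=> fg [[d1 d2] [d3 d4]].
  have e1 : \forall t \near z, complex.Re (f t) = complex.Re (g t) by apply: filterS fg => t ->.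
  have e2 : \forall t \near z, complex.Im (f t) = complex.Im (g t) by apply: filterS fg => t ->.
  by split; split; [exact: near_eq_is_derive e1 d1|exact: near_eq_is_derive e2 d2|
    exact: near_eq_is_derive e1 d3|exact: near_eq_is_derive e2 d4].
have near_ccont (f g : R * R -> C) z : (\forall t \near z, f t = g t) ->
    ccont f z -> ccont g z.
  move=> fg [c1 c2]; split; rewrite -(nbhs_singleton fg).
    by apply: cvg_trans c1; apply: near_eq_cvg; apply: filterS fg => t ->.
  by apply: cvg_trans c2; apply: near_eq_cvg; apply: filterS fg => t ->.
exists (ext L') => z Dz; have [z0|z0] := boolP (0 < z.2).
  have [dL cL] := HL z (conj Dz z0).
  have e (f : R * R -> C) : \forall t \near z, f t = ext f t.
    by apply: filterS (n2 z z0) => t t0; rewrite /ext t0.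
  by split; [rewrite /ext z0; exact: near_cdiff (e L) dL|exact: near_ccont (e L') cL].
have {}z0 := negbTE z0; have [dL [cL1 cL2]] := HL _ (Dneg z Dz z0).
have e (f : R * R -> C) : \forall t \near z, conjc (f (zconj t)) = ext f t.
  by apply: filterS (n2' z Dz z0) => t t0; rewrite /ext t0.
split; first by rewrite /ext z0; apply: near_cdiff (e L) _; exact: cdiff_conj.
apply: near_ccont (e L') _; split; rewrite ?cRe_conj ?cIm_conj;
  under eq_fun do rewrite ?cRe_conj ?cIm_conj.
  exact: (@cvg_comp _ _ _ (@zconj R) (fun t => complex.Re (L' t)) _ (nbhs (zconj z))
    _ (@zconj_continuous z) cL1).
apply: cvgN.
exact: (@cvg_comp _ _ _ (@zconj R) (fun t => complex.Im (L' t)) _ (nbhs (zconj z))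
  _ (@zconj_continuous z) cL2).
Qed.

End Transfer.

(** * Exponentials of stem functions *)

Section Exponential.
Variable R : realType.
Notation H := (quat R).
Notation C := (complex R).
Implicit Types (z v : R * R) (D E : set (R * R)) (Omega : set H) (I J q : H).

(** The point determines its slice, but the unit only up to sign; the symmetries of
    the stem make the value independent of this choice. *)
Lemma slice_function_of_stem D (F0 F1 : R * R -> H) :
  (forall z, D z -> z.2 != 0) ->
  (forall z, D z -> F0 (zconj z) = F0 z) -> (forall z, D z -> F1 (zconj z) = - F1 z) ->
  exists f : H -> H, forall z I, D z -> imag_unit I ->
    f (slice_pt I z) = F0 z + I * F1 z.
Proof.
move=> D0 s0 s1.
pose dir q : H := (norm_vec q)^-1 *: (q - (q_re q)%:A).
exists (fun q => F0 (q_re q, norm_vec q) + dir q * F1 (q_re q, norm_vec q)) => z I Dz II.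
have [e0 _ _ _] := slice_ptE z II.
rewrite /dir norm_vec_slice_pt// e0.
have -> : slice_pt I z - z.1%:A = z.2 *: I by rewrite /slice_pt addrAC subrr add0r.
rewrite scalerA.
have [z0|z0] := ltP 0 z.2.
  by rewrite gtr0_norm// mulVf ?D0// scale1r -surjective_pairing.
rewrite ler0_norm// invrN mulNr mulVf ?D0// scaleN1r -/(zconj z) s0// s1//.
by rewrite mulrNN.
Qed.

(** [L] is central and the square of the vector part is
    [- (n1 ^ 2 + n2 ^ 2 + n3 ^ 2) = 0], so only the terms of degree at most 1 in
    the vector part remain.  For [n = 0] the factor [n%:R] makes up for the
    meaningless exponent [n.-1]. *)
Lemma star_pow_stem Omega (f : H -> H) (L n1 n2 n3 : C) z :
  circular Omega -> planar Omega z ->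
  (forall I, imag_unit I -> f (slice_pt I z) = stem_val L n1 n2 n3 I) ->
  n1 ^+ 2 + n2 ^+ 2 + n3 ^+ 2 = 0 ->
  forall n I, imag_unit I -> star_pow f n (slice_pt I z) =
    stem_val (L ^+ n) (n%:R * L ^+ n.-1 * n1) (n%:R * L ^+ n.-1 * n2)
      (n%:R * L ^+ n.-1 * n3) I.
Proof.
move=> circ Dz fE nn; elim=> [|n IH] I II.
  rewrite /star_pow /= expr0 !mul0r /stem_val.
  by apply: quat_eq; rewrite !quatE /=; ring.
rewrite /star_pow /= -/(star_pow f n) (star_stem circ Dz fE IH II).
have e (m : C) : L * (n%:R * L ^+ n.-1 * m) + m * L ^+ n = n.+1%:R * L ^+ n * m.
  rewrite mulrSr; case: n {IH} => [|n]; first by rewrite expr0; ring.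
  by rewrite /= exprS; ring.
congr stem_val.
- rewrite exprS.
  transitivity (L * L ^+ n - n%:R * L ^+ n.-1 * (n1 ^+ 2 + n2 ^+ 2 + n3 ^+ 2)); first by ring.
  by rewrite nn mulr0 subr0.
- by rewrite -e; ring.
- by rewrite -e; ring.
- by rewrite -e; ring.
Qed.

Lemma cvg_mulI (I : H) (u : nat -> H) (l : H) : u @ \oo --> l ->
  (I * u n) @[n --> \oo] --> I * l.
Proof.
move=> cu.
have e (p : H) : I * p = coord 0 p *: I + coord 1 p *: (I * qI) + coord 2 p *: (I * qJ)
    + coord 3 p *: (I * qK).
  rewrite -{1}[p](_ : Quat (coord 0 p) (coord 1 p) (coord 2 p) (coord 3 p) = p); last first.
    by apply: quat_eq; rewrite !quatE.
  by rewrite QuatE !mulrDr -!scalerAr mulr1.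
rewrite e; under eq_fun do rewrite e.
have ck k : coord k (u n) @[n --> \oo] --> coord k l.
  by apply: (@cvg_comp _ _ _ u (coord k) _ (nbhs l)); [exact: cu|exact: coord_cvg].
by apply: cvgD; [apply: cvgD; [apply: cvgD|]|]; apply: cvgZr_tmp; exact: ck.
Qed.

(** The value of a stem at a fixed unit depends linearly on the eight real parts
    and imaginary parts of its components. *)
Lemma series_stem_val (a0 a1 a2 a3 : nat -> C) (b0 b1 b2 b3 : C) I :
  let cv (a : nat -> C) (b : C) :=
    series (fun n => n`!%:R^-1 * complex.Re (a n)) @ \oo --> complex.Re b /\
    series (fun n => n`!%:R^-1 * complex.Im (a n)) @ \oo --> complex.Im b in
  cv a0 b0 -> cv a1 b1 -> cv a2 b2 -> cv a3 b3 ->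
  series (fun n => (n`!%:R^-1 : R) *: stem_val (a0 n) (a1 n) (a2 n) (a3 n) I) @ \oo -->
    stem_val b0 b1 b2 b3 I.
Proof.
move=> cv [r0 i0] [r1 i1] [r2 i2] [r3 i3].
pose re (a : nat -> C) := series (fun n => n`!%:R^-1 * complex.Re (a n)).
pose im (a : nat -> C) := series (fun n => n`!%:R^-1 * complex.Im (a n)).
have -> : series (fun n => (n`!%:R^-1 : R) *: stem_val (a0 n) (a1 n) (a2 n) (a3 n) I) =
   (fun n => (Quat (re a0 n) (re a1 n) (re a2 n) (re a3 n) : H) +
    I * Quat (im a0 n) (im a1 n) (im a2 n) (im a3 n)).
  apply/funext; elim=> [|n IH].
    rewrite /re /im /series /= !big_nil -[LHS]addr0; congr (_ + _).
      by apply: quat_eq; rewrite !quatE.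
    by rewrite [X in I * X](_ : _ = 0) ?mulr0//; apply: quat_eq; rewrite !quatE.
  rewrite /re /im !seriesSr IH /re /im /stem_val scalerDr scalerAr addrACA -mulrDr.
  by congr (_ + _ * _); apply: quat_eq; rewrite !quatE.
apply: cvgD; first exact: cvg_Quat.
by apply: cvg_mulI; exact: cvg_Quat.
Qed.

(** The term of index 0 vanishes, and [n / n!] is [1 / (n - 1)!]: this is the
    exponential series with indices shifted by one. *)
Lemma series_shift_exp (L m : C) :
  (series (fun n => n`!%:R^-1 * complex.Re (n%:R * L ^+ n.-1 * m)) @ \oo -->
    complex.Re (cexp L * m)) /\
  (series (fun n => n`!%:R^-1 * complex.Im (n%:R * L ^+ n.-1 * m)) @ \oo -->
    complex.Im (cexp L * m)).
Proof.
have [cr ci] := cexp_series L.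
have natC n : n%:R = real_complex R n%:R by rewrite rmorph_nat.
have fact (n : nat) (x : R) : (n.+1)`!%:R^-1 * (n.+1%:R * x) = n`!%:R^-1 * x.
  by rewrite factS natrM invfM mulrA -[_ * _ * n.+1%:R]mulrAC mulVf ?mul1r// pnatr_eq0.
have reE n : series (fun n => n`!%:R^-1 * complex.Re (n%:R * L ^+ n.-1 * m)) n.+1 =
  series (fun n => n`!%:R^-1 * complex.Re (L ^+ n)) n * complex.Re m -
  series (fun n => n`!%:R^-1 * complex.Im (L ^+ n)) n * complex.Im m.
  elim: n => [|n IH].
    by rewrite /series /= big_nat1 !big_nil mul0r mul0r /= !mul0r subr0 mulr0.
  rewrite seriesSr IH !seriesSr /= -mulrA natC !cReM /= mul0r subr0 fact; ring.
have imE n : series (fun n => n`!%:R^-1 * complex.Im (n%:R * L ^+ n.-1 * m)) n.+1 =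
  series (fun n => n`!%:R^-1 * complex.Re (L ^+ n)) n * complex.Im m +
  series (fun n => n`!%:R^-1 * complex.Im (L ^+ n)) n * complex.Re m.
  elim: n => [|n IH].
    by rewrite /series /= big_nat1 !big_nil mul0r mul0r /= !mul0r addr0 mulr0.
  rewrite seriesSr IH !seriesSr /= -mulrA natC cImM /= mul0r addr0 fact cImM; ring.
split; rewrite -cvg_shiftS.
  rewrite cReM; under eq_fun do rewrite reE.
  by apply: cvgB; apply: cvgM => //; exact: cvg_cst.
rewrite cImM; under eq_fun do rewrite imE.
by apply: cvgD; apply: cvgM => //; exact: cvg_cst.
Qed.

End Exponential.

(** * The two kinds of domains *)

Section Main.
Variable R : realType.
Notation H := (quat R).
Notation C := (complex R).
Implicit Types (z v : R * R) (D E : set (R * R)) (Omega : set H) (I J q : H).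

(** The three components of a zero divisor would vanish identically by
    [sum_squares_real_point], while zero divisors are not zero. *)
Lemma slice_domain_no_zero_divisor Omega I (g gv : H -> H) :
  open Omega -> circular Omega -> Omega `&` real_line !=set0 -> imag_unit I ->
  connected (Omega `&` slice I) -> simply_connected R (Omega `&` slice I) ->
  is_vector_part Omega g gv -> ~ zero_divisor Omega gv.
Proof.
move=> oO circ [q0 [Oq [a qa]]] II cA sA vp zd; rewrite qa in Oq.
have oD := open_planar circ oO.
have [c0 [c1 [c2 [c3 [[h0 h1 h2 h3] ge]]]]] := vector_part_stem oO circ vp.
have [cD _] : connected (planar Omega) /\ simply_connected R (planar Omega).
  apply: (@planar_half _ I (planar Omega) _ II _ _ cA sA); last by move=> q [].
  move=> z; split => [Dz|[Oz _]]; last by exists I.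
  by split; [move: Dz => /(planarP _ circ); apply|exists z.1, z.2].
have hD : half_of (planar Omega) (planar Omega) by split => // z; left.
have ss := zero_divisor_norm oO circ hD h1 h2 h3 (fun z I Dz II => (ge z I Dz II).2) zd.
have Da : planar Omega (a, 0) by exists I => //=; rewrite scale0r addr0.
have c0' := sum_squares_real_point oD cD Da h1 h2 h3 ss.
case: zd => _ nz _; apply: nz => q Oq'; have [J [z [JJ qE]]] := slice_polar q.
have Dz : planar Omega z by exists J => //; rewrite -/(slice_pt J z) -qE.
have [e1 e2 e3] := c0' z Dz.
by rewrite qE (ge z J Dz JJ).2 e1 e2 e3 /stem_val; apply: quat_eq; rewrite !quatE; ring.
Qed.

(** [L] is a logarithm of [c0], extended by conjugation from the upper half plane,
    and [f] has the stem [L + V / c0]. *)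
Lemma product_domain_exp Omega I (g gv : H -> H) :
  open Omega -> circular Omega -> Omega `&` real_line = set0 -> imag_unit I ->
  connected (Omega `&` half_slice I) -> simply_connected R (Omega `&` half_slice I) ->
  (forall q, Omega q -> g q != 0) ->
  is_vector_part Omega g gv -> zero_divisor Omega gv ->
  exists f : H -> H, slice_regular Omega f /\ is_star_exp Omega f g.
Proof.
move=> oO circ noreal II cA sA g0 vp zd.
have oD := open_planar circ oO; set D := planar Omega in oD *.
have [c0 [c1 [c2 [c3 [[h0 h1 h2 h3] ge]]]]] := vector_part_stem oO circ vp.
have D0 z : D z -> z.2 != 0.
  move=> [J JJ Oz]; apply/eqP => z2; rewrite z2 scale0r addr0 in Oz.
  suff : (Omega `&` real_line) z.1%:A by rewrite noreal.
  by split => //; exists z.1.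
pose E := D `&` [set z | 0 < z.2].
have oE : open E.
  apply: openI => //; apply: (@open_comp _ _ (fun z : R * R => z.2) [set x | 0 < x]).
    by move=> z _; exact: cvg_snd.
  exact: open_gt.
have [cE sE] : connected E /\ simply_connected R E.
  apply: (@planar_half _ I E _ II _ _ cA sA); last by move=> q [_ [a [b [_ ->]]]]; exists a, b.
  move=> z; split => [[Dz z0]|[Oz [a [b [b0 e]]]]].
    split; first by move: Dz => /(planarP _ circ); apply.
    by exists z.1, z.2; rewrite ltW.
  have zE : z = (a, b) by rewrite -(slice_ptK II z) e -/(slice_pt I (a, b)) slice_ptK.
  have Dz : D z by exists I.
  by split => //=; rewrite lt_neqAle eq_sym D0//= zE.
have Dc z : D z -> D (zconj z) by exact: planar_conj.
have DE z : D z -> E z \/ E (zconj z).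
  move=> Dz; have [z0|z0] := ltP 0 z.2; first by left.
  by right; split; [exact: Dc|rewrite /= oppr_gt0 lt_neqAle z0 D0].
have hE : half_of E D by split => // z [].
have ss := zero_divisor_norm oO circ hE h1 h2 h3 (fun z I Dz II => (ge z I Dz II).2) zd.
have c0n z : D z -> c0 z != 0.
  by move=> Dz; apply: (invertible_real_part circ Dz (fun I II => (ge z I Dz II).1) g0 (ss z Dz)).
have [L0 [hL0 cL0]] : exists L, hol E L /\ forall z, E z -> c0 z = cexp (L z).
  apply: holomorphic_log => //; last by move=> z [Dz _]; exact: c0n.
  by apply: hol_sub h0.1 => z [].
have [L [hL LE]] := conj_extension oD D0 Dc hL0.
have cL z : D z -> cexp (L z) = c0 z.
  move=> Dz; have [Ez|Ez] := DE z Dz.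
    by rewrite LE ?cL0//; exact: Ez.2.
  rewrite -[LHS]conjcK -cexp_conj -hL.2// LE; last exact: Ez.2.
  by rewrite -cL0// h0.2// conjcK.
pose N c z := c z / c0 z.
have hN c : intrinsic D c -> intrinsic D (N c).
  move=> [hc sc]; split; first by apply: holM => //; exact: holV oD c0n h0.1.
  move=> z Dz; rewrite /N sc// h0.2//.
  have c0z := c0n z Dz; have cc0 : conjc (c0 z) != 0.
    by rewrite conjc_eq0.
  by apply: (mulIf cc0); rewrite divfK// -rmorphM divfK.
have st := stem_of_hol oD hL.1 (hN _ h1).1 (hN _ h2).1 (hN _ h3).1
  hL.2 (hN _ h1).2 (hN _ h2).2 (hN _ h3).2.
set F0 := (X in slice_regular_stem _ X _) in st.
set F1 := (X in slice_regular_stem _ _ X) in st.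
have [_ s0 s1 _ _] := st.
have [f fE] := slice_function_of_stem D0 s0 s1.
exists f; split.
  exists F0, F1; split => // J JJ a b Oz.
  by apply: (fE (a, b)) => //; exists J.
move=> q Oq; have [J [z [JJ qE]]] := slice_polar q; rewrite qE in Oq *.
have Dz : D z by exists J.
have fz K : imag_unit K -> f (slice_pt K z) = stem_val (L z) (N c1 z) (N c2 z) (N c3 z) K.
  by move=> KK; rewrite fE.
have nn : N c1 z ^+ 2 + N c2 z ^+ 2 + N c3 z ^+ 2 = 0.
  by rewrite /N !expr_div_n -!mulrDl ss// mul0r.
under eq_fun do rewrite (star_pow_stem circ Dz fz nn _ JJ).
rewrite (ge z J Dz JJ).1.
have eN c : c z = cexp (L z) * N c z by rewrite cL// /N mulrC divfK// c0n.
rewrite -(cL z Dz) (eN c1) (eN c2) (eN c3).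
apply: series_stem_val; first exact: cexp_series.
- exact: series_shift_exp.
- exact: series_shift_exp.
- exact: series_shift_exp.
Qed.

End Main.

Theorem proposition6p4 (R : realType) (Omega : set (quat R))
    (g gv : quat R -> quat R) :
  domain Omega -> circular Omega -> slice_contractible Omega ->
  slice_regular Omega g ->
  (forall q, Omega q -> g q != 0) ->
  is_vector_part Omega g gv -> zero_divisor Omega gv ->
  exists f : quat R -> quat R, slice_regular Omega f /\ is_star_exp Omega f g.
Proof.
move=> [_ _ oO] circ [I II hO] _ g0 vp zd.
case: hO => -[[_ hreal] [_ cA _ sA]].
  by have := slice_domain_no_zero_divisor oO circ hreal II cA sA vp zd.
exact: product_domain_exp oO circ hreal II cA sA g0 vp zd.
Qed.
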